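(* Let $P$ be an ergodic $L^2$-quasi-compact bi-stochastic Markov operator on a probability space $(S,\Sigma,\mu)$ with period $d>1$. Then: (i) The $\sigma$-algebra $\Sigma_{i,d}=\{A\in\Sigma: P^d1_A=1_A\}$ of $P^d$-invariant sets is finite (modulo $\mu$), and has an atom $A_0$ such that for $1\le j\le d-1$ there are disjoint atoms $A_j\in\Sigma_{i,d}$ with $P^j1_{A_0}=1_{A_j}$, $P1_{A_j}=1_{A_{j+1}}$ (where $A_d=A_0$), $P^*1_{A_{j+1}}=1_{A_j}$, and $\Sigma_{i,d}$ is generated by $\{A_0,A_1,\dots,A_{d-1}\}$. (ii) For every $f\in L^p(\mu)$, $1\le p<\infty$, and $0\le j\le d-1$ we have $$\lim_{n\to\infty}\Big\|P^{nd+j}f-d\sum_{\ell=0}^{d-1}\Big(\int_{A_\ell}f\,d\mu\Big)1_{A_{\ell\dot{+}j}}\Big\|_p=0$$ and $$\lim_{n\to\infty}\Big\|(P^* )^{nd+j}f-d\sum_{\ell=0}^{d-1}\Big(\int_{A_\ell}f\,d\mu\Big)1_{A_{\ell\dot{-}j}}\Big\|_p=0,$$ where $\dot{+}$ and $\dot{-}$ denote addition and subtraction modulo $d$. (iii) For $1\le p<\infty$, the unimodular eigenvalues of $P$ on $L^p(\mu)$ are precisely all $d$th roots of unity, and the corresponding eigenfunctions have constant absolute value (a.e.).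
   Context: Let $(S,\Sigma,\mu)$ be a probability space and $P(x,A)$ a transition probability on $S\times\Sigma$, with Markov operator $Pf(x)=\int f(y)P(x,dy)$. $P$ is bi-stochastic on $(S,\Sigma,\mu)$ if $\int P(x,A)\,d\mu(x)=\mu(A)$ for all $A\in\Sigma$; then $P$ induces a contraction of every (complex) $L^p(\mu)$, $1\le p\le\infty$. $P$ is ergodic if $Pf=f\in L^\infty(\mu)$ implies that $f$ is constant a.e. $P^*$ is the dual Markov operator, i.e. the contraction of each $L^p(\mu)$ with $\int (Pf) g\,d\mu=\int f\,(P^*g)\,d\mu$. A bounded operator $T$ on a Banach space is quasi-compact if there are $n\ge1$ and a compact $K$ with $\|T^n-K\|<1$; $P$ is $L^2$-quasi-compact if it is quasi-compact as an operator on $L^2(\mu)$. In that case $\sigma(P)\cap\mathbb T$ (spectrum on complex $L^2$, $\mathbb T$ the unit circle) is a finite set of roots of unity, and the period of $P$ is the smallest integer $d\ge1$ such that every $\lambda\in\sigma(P)\cap\mathbb T$ satisfies $\lambda^d=1$. Sets and equalities of functions are understood modulo $\mu$-null sets. *)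

(* Defs.v *)
From HB Require Import structures.
From mathcomp Require Import all_boot all_order all_algebra.
From mathcomp Require Import complex.
From mathcomp Require Import all_classical all_reals all_analysis.

Set Implicit Arguments.
Unset Strict Implicit.
Unset Printing Implicit Defensive.
Import Order.TTheory GRing.Theory Num.Theory.
Import numFieldNormedType.Exports.

Local Open Scope classical_set_scope.
Local Open Scope ring_scope.
Local Open Scope complex_scope.

(* Neither the Borel structure of R[i] nor the complex L^p spaces are in the
   libraries: elements of L^p are represented here by functions T -> R[i], and
   identities between them are stated mu-almost everywhere. *)
Section complex_Lp.
Context d (T : measurableType d) (R : realType).
Variable mu : {measure set T -> \bar R}.
Implicit Types (f g : T -> R[i]) (p : \bar R) (A B : set T).

Definition cabs (z : R[i]) : R := complex.ComplexField.Normc.normc z.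

Definition cmeasurable f : Prop :=
  measurable_fun setT (fun x => complex.Re (f x)) /\
  measurable_fun setT (fun x => complex.Im (f x)).

Definition cnorm p f : \bar R := 'N[mu]_p[EFin \o (cabs \o f)].

Definition cLp p : set (T -> R[i]) :=
  [set f | cmeasurable f /\ (cnorm p f < +oo)%E].

Definition cintegral A f : R[i] :=
  (\int[mu]_(x in A) complex.Re (f x)) +i* (\int[mu]_(x in A) complex.Im (f x)).

Definition cindic A : T -> R[i] := fun x => (\1_A x)%:C.

Definition set_ae_eq A B : Prop := mu (A `+` B) = 0%E.

End complex_Lp.

(* Operators on L^p(mu), given on representatives.  That a bounded operator
   respects mu-a.e. equality follows from linearity modulo mu and the finiteness
   of its norm; compactness is sequential relative compactness of the image of
   the unit ball; the resolvent requires a bounded two-sided inverse. *)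
Section operators.
Context d (T : measurableType d) (R : realType).
Variables (mu : {measure set T -> \bar R}) (p : \bar R).
Implicit Types (U K V : (T -> R[i]) -> (T -> R[i])) (lambda : R[i]).

Definition opnorm U : \bar R :=
  ereal_sup [set cnorm mu p (U f) | f in [set f | cLp mu p f /\
                                                  (cnorm mu p f <= 1)%E]].

Definition bounded_operator U : Prop :=
  [/\ forall f, cLp mu p f -> cLp mu p (U f),
      forall (a : R[i]) f g, cLp mu p f -> cLp mu p g ->
        U (fun x => a * f x + g x) = (fun x => a * U f x + U g x) %[ae mu] &
      (opnorm U < +oo)%E].

Definition compact_operator K : Prop :=
  bounded_operator K /\
  forall u : nat -> T -> R[i],
    (forall n, cLp mu p (u n) /\ (cnorm mu p (u n) <= 1)%E) ->
    exists (phi : nat -> nat) (g : T -> R[i]),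
      [/\ {homo phi : m n / (m < n)%N}, cLp mu p g &
          cnorm mu p (fun x => K (u (phi n)) x - g x) @[n --> \oo] --> 0%E].

Definition quasi_compact U : Prop :=
  bounded_operator U /\
  exists (n : nat) K, [/\ (0 < n)%N, compact_operator K &
    (opnorm (fun f x => (iter n U f x - K f x)%R) < 1)%E].

Definition resolvent_set U : set R[i] :=
  [set lambda | exists V, bounded_operator V /\
    forall f, cLp mu p f ->
      (fun x => lambda * V f x - U (V f) x) = f %[ae mu] /\
      V (fun x => lambda * f x - U f x) = f %[ae mu]].

Definition spectrum U : set R[i] := ~` resolvent_set U.

Definition eigenfunction U lambda (f : T -> R[i]) : Prop :=
  [/\ cLp mu p f, ~ f = cst 0 %[ae mu] &
      U f = (fun x => lambda * f x) %[ae mu]].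

Definition eigenvalue_op U lambda : Prop := exists f, eigenfunction U lambda f.

End operators.

Section markov.
Context d (T : measurableType d) (R : realType).
Variables (mu : probability T R) (P : R.-pker T ~> T).
Implicit Types (f g : T -> R[i]) (Q : (T -> R[i]) -> (T -> R[i])).

(* For f in L^1(mu) the integral is meaningful for mu-almost every x only; on
   the exceptional null set the value is a default one. *)
Definition markov_op f : T -> R[i] := fun x => cintegral (P x) setT f.

Definition bistochastic : Prop :=
  forall A, measurable A -> (\int[mu]_x P x A)%E = mu A.

Definition ergodic : Prop :=
  forall f, cLp mu +oo%E f -> markov_op f = f %[ae mu] ->
    exists c : R[i], f = cst c %[ae mu].

(* The pairing is bilinear, without complex conjugation. *)
Definition dual_markov Q : Prop :=
  forall p : \bar R, (1 <= p)%E -> forall g, cLp mu p g ->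
    [/\ cLp mu p (Q g), (cnorm mu p (Q g) <= cnorm mu p g)%E &
        forall f, cLp mu (hoelder_conjugate p) f ->
          cintegral mu setT (fun x => markov_op f x * g x) =
          cintegral mu setT (fun x => f x * Q g x)].

Definition is_period (k : nat) : Prop :=
  let annihilates (n : nat) := (0 < n)%N /\
    forall lambda, spectrum mu 2%:E markov_op lambda -> `|lambda| = 1 ->
      lambda ^+ n = 1 in
  annihilates k /\ forall n, annihilates n -> (k <= n)%N.

Definition invariant_sets (k : nat) : set (set T) :=
  [set A | measurable A /\
           iter k markov_op (cindic R A) = cindic R A %[ae mu]].

End markov.

(* An atom of a family of measurable sets, inclusion being modulo mu. *)
Definition atom d (T : measurableType d) (R : realType)
    (mu : {measure set T -> \bar R}) (S : set (set T)) (A : set T) : Prop :=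
  [/\ S A, (0 < mu A)%E &
      forall B, S B -> mu (B `\` A) = 0%E ->
        mu B = 0%E \/ mu (A `\` B) = 0%E].

(* Main.v *)
Require Import Defs.
From HB Require Import structures.
From mathcomp Require Import all_boot all_order all_algebra.
From mathcomp Require Import complex.
From mathcomp Require Import all_classical all_reals all_analysis.
From mathcomp Require Import measurable_realfun ess_sup_inf lra ring.
From mathcomp Require Import separable cyclotomic.

(** Quasi-compactness enters through one consequence, [asymptotic_compactness]:
    if [f_k] lies in the unit ball of [L^2] and [m_k >= k], then [P^(m_k) f_k] has
    an [L^2]-convergent subsequence. Indeed, if [P^n = K + S] with [K] compact and
    [||S|| < 1], then along a subsequence that [K] nearly collapses, [P^n] shrinks
    the mutual distances by a fixed factor.

    Work first with real functions, and call a function persistent when it starts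
    a bounded backward orbit of [P]. Compactness makes a persistent [f] recurrent,
    so [||P f|| = ||f||]. As [||f||^2 - ||P f||^2] is the integral of the variance
    of [f] under [P(x,.)], almost every [P(x,.)] sees a constant function
    ([deterministic]): [P] acts on [f] as composition with a point map. Hence the
    sets with a persistent indicator form an algebra that [P] maps to itself,
    preserving measures. Compactness bounds their nonzero measures from below, so
    there are atoms. An atom [A_0] is carried to atoms [A_1], [A_2], and so on;
    recurrence forces a first return, at some time [N], and by ergodicity the sets
    [A_0], ..., [A_(N-1)] partition the space ([exists_cyclic_partition]). The only
    persistent function orthogonal to all their indicators is 0.

    On the functions orthogonal to the cycle the powers of [P] tend to 0 in norm
    ([centered_decay]): if not, the limits of the [P^(m_k) f_k] would contain a
    nonzero persistent function orthogonal to the cycle. This is the convergence of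
    (ii) in [L^2]; truncation and interpolation carry it to every [L^p]
    ([Lp_convergence]). The dual moves the cycle backwards and shares the decay,
    because [||P*^m f||^2 = <P^m P*^m f, f>].

    Applied to an eigenfunction with [|lambda| = 1], the convergence yields
    [lambda^N = 1] and exhibits the eigenfunction as a combination of the indicators
    of the [A_j] whose coefficients have the same modulus; conversely, if
    [lambda^N = 1], the function with the value [lambda^(-j)] on [A_j] is an
    eigenfunction. This is (iii) with [N] for [d]. When [|lambda| = 1] and [lambda^N <> 1], the operator [lambda - P] is
    invertible on [L^2]: [P^N] is the identity on the span of the cycle, and a
    Neumann series works on its orthogonal complement. So the unimodular spectrum is
    the set of the [N]-th roots of unity, and [N] is the period ([period_cyclic]).
    Finally the indicator of a [P^d]-invariant set equals the limit given by (ii),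
    so the set is a union of classes, which is (i). *)

Set Implicit Arguments.
Unset Strict Implicit.
Unset Printing Implicit Defensive.
Import Order.TTheory GRing.Theory Num.Theory.
Import numFieldNormedType.Exports.

Local Open Scope classical_set_scope.
Local Open Scope ring_scope.

(** * Real L^p spaces, as functions with a finite seminorm *)

Section real_Lp.
Context d (T : measurableType d) (R : realType).
Variable mu : {measure set T -> \bar R}.
Implicit Types (f g h : T -> R) (p c : R).

Definition Lp p : set (T -> R) := [set f | measurable_fun setT f /\
  ('N[mu]_p%:E[EFin \o f] < +oo)%E].

Definition nrm p f : R := fine ('N[mu]_p%:E[EFin \o f])%E.

Lemma nrm_ge0 p f : 0 <= nrm p f.
Proof. by rewrite fine_ge0// Lnorm_ge0. Qed.

Lemma nrmE p f : Lp p f -> ((nrm p f)%:E = 'N[mu]_p%:E[EFin \o f])%E.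
Proof. by move=> [_ h]; rewrite fineK// ge0_fin_numE// Lnorm_ge0. Qed.

Lemma measurable_powRnorm p f : measurable_fun setT f ->
  measurable_fun setT (fun x => `|f x| `^ p).
Proof.
move=> mf; apply: (@measurableT_comp _ _ _ _ _ _ (@powR R ^~ p)) => //.
exact: measurableT_comp.
Qed.

Lemma Lp_powR p f : 0 < p -> measurable_fun setT f ->
  Lp p f <-> (\int[mu]_x (`|f x| `^ p)%:E < +oo)%E.
Proof.
move=> p0 mf; rewrite /Lp /=.
have -> : (\int[mu]_x (`|f x| `^ p)%:E = 'N[mu]_p%:E[EFin \o f] `^ p)%E.
  by rewrite powR_Lnorm ?gt_eqF.
split=> [[_ h]|h]; first exact: poweR_lty.
by split=> //; apply: (@lty_poweRy _ _ p); rewrite ?gt_eqF.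
Qed.

Lemma nrm_powR p f : 0 < p -> Lp p f ->
  (nrm p f `^ p)%:E = (\int[mu]_x (`|f x| `^ p)%:E)%E.
Proof. by move=> p0 fp; rewrite -poweR_EFin nrmE// powR_Lnorm ?gt_eqF. Qed.

Lemma Lp_dom p f g : 0 < p -> Lp p f -> measurable_fun setT g ->
  {ae mu, forall x, `|g x| <= `|f x|} -> Lp p g /\ nrm p g <= nrm p f.
Proof.
move=> p0 fp mg gf; have mf := fp.1.
have h : (\int[mu]_x (`|g x| `^ p)%:E <= \int[mu]_x (`|f x| `^ p)%:E)%E.
  apply: ae_ge0_le_integral => //.
  - exact/measurable_EFinP/measurable_powRnorm.
  - exact/measurable_EFinP/measurable_powRnorm.
  - apply: filterS gf => x gfx _; rewrite lee_fin.
    by rewrite ge0_ler_powR// ?nnegrE// ltW.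
have gp : Lp p g by apply/Lp_powR => //; apply: (le_lt_trans h); apply/Lp_powR.
split=> //; rewrite leNgt; apply/negP => fg.
have := gt0_ltr_powR p0 _ _ fg.
rewrite !nnegrE !nrm_ge0 => /(_ isT isT).
by rewrite -lte_fin !nrm_powR// ltNge h.
Qed.

Lemma nrm_ae p f g : 0 < p -> Lp p f -> measurable_fun setT g ->
  f = g %[ae mu] -> Lp p g /\ nrm p g = nrm p f.
Proof.
move=> p0 fp mg fg.
have [gp gf] : Lp p g /\ nrm p g <= nrm p f.
  by apply: Lp_dom => //; apply: filterS fg => x /(_ I) ->.
split=> //; apply/eqP; rewrite eq_le gf/=.
by apply: (Lp_dom p0 gp fp.1 _).2; apply: filterS fg => x /(_ I) ->.
Qed.

Lemma LpZ p c f : 1 <= p -> Lp p f ->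
  Lp p (fun x => c * f x) /\ nrm p (fun x => c * f x) = `|c| * nrm p f.
Proof.
move=> p1 fp; have p0 : 0 < p by exact: lt_le_trans p1.
have mf := fp.1.
have fL : f \in Lfun mu p%:E by rewrite inE; apply/andP; split; rewrite inE//=; exact: fp.2.
have p1' : (1 <= p%:E)%E by rewrite lee_fin.
have h : ('N[mu]_p%:E[EFin \o (fun x => c * f x)%R] =
          `|c|%:E * 'N[mu]_p%:E[EFin \o f])%E.
  exact: (LnormZ (Lfun_Sub p1' fL) c).
rewrite /Lp /nrm /= h; split; [split|].
- exact: measurable_funM.
- by rewrite -nrmE// -EFinM ltry.
- by rewrite -nrmE.
Qed.

Lemma LpD p f g : 1 <= p -> Lp p f -> Lp p g ->
  Lp p (fun x => f x + g x) /\ nrm p (fun x => f x + g x) <= nrm p f + nrm p g.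
Proof.
move=> p1 fp gp; have mf := fp.1; have mg := gp.1.
have := @minkowski_EFin _ _ _ mu f g p mf mg p1.
rewrite -(nrmE fp) -(nrmE gp) -EFinD => h.
have fgp : Lp p (fun x => f x + g x).
  split; first exact: measurable_funD.
  exact: le_lt_trans h (ltry _).
by split=> //; rewrite -lee_fin nrmE.
Qed.

Lemma LpB p f g : 1 <= p -> Lp p f -> Lp p g ->
  Lp p (fun x => f x - g x) /\ nrm p (fun x => f x - g x) <= nrm p f + nrm p g.
Proof.
move=> p1 fp gp; have [gp' ng] := LpZ (-1) p1 gp.
have [] := LpD p1 fp gp'; rewrite ng normrN1 mul1r.
by under eq_fun do rewrite mulN1r.
Qed.

Lemma nrmBC p f g : nrm p (fun x => f x - g x) = nrm p (fun x => g x - f x).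
Proof.
rewrite /nrm -oppe_Lnorm; congr (fine (Lnorm _ _ _)).
by apply/funext => x/=; rewrite opprB.
Qed.

Lemma nrm_triangle p f g h : 1 <= p -> Lp p f -> Lp p g -> Lp p h ->
  nrm p (fun x => f x - h x) <=
  nrm p (fun x => f x - g x) + nrm p (fun x => g x - h x).
Proof.
move=> p1 fp gp hp.
have := (LpD p1 (LpB p1 fp gp).1 (LpB p1 gp hp).1).2.
by under eq_fun do rewrite addrA subrK.
Qed.

Lemma nrm_leB p f g : 1 <= p -> Lp p f -> Lp p g ->
  nrm p f <= nrm p g + nrm p (fun x => f x - g x).
Proof.
move=> p1 fp gp; have := (LpD p1 gp (LpB p1 fp gp).1).2.
by under eq_fun do rewrite addrC subrK.
Qed.

Lemma Lp0 p : 1 <= p -> Lp p (fun=> 0) /\ nrm p (fun=> 0) = 0.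
Proof.
move=> p1; rewrite /Lp /nrm /= (_ : EFin \o _ = cst 0%E)//.
have p0 : p%:E != 0%E :> \bar R by rewrite eqe gt_eqF// (lt_le_trans _ p1).
by rewrite Lnorm0.
Qed.

Lemma nrm_eq0 p f : 1 <= p -> Lp p f -> nrm p f <= 0 -> f = cst 0 %[ae mu].
Proof.
move=> p1 fp n0; have p0 : 0 < p by exact: lt_le_trans p1.
have : ('N[mu]_p%:E[EFin \o f] = 0)%E.
  by rewrite -nrmE//; congr EFin; apply/eqP; rewrite eq_le n0 nrm_ge0.
move=> /Lnorm_eq0_eq0; have /measurable_EFinP mf := fp.1.
move=> /(_ mf); rewrite lte_fin => /(_ p0).
by apply: filterS => x /(_ I) [].
Qed.

Lemma Lp_sum p n (F : nat -> T -> R) : 1 <= p -> (forall i, Lp p (F i)) ->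
  Lp p (fun x => \sum_(i < n) F i x) /\
  nrm p (fun x => \sum_(i < n) F i x) <= \sum_(i < n) nrm p (F i).
Proof.
move=> p1 Fp; elim: n => [|n [IH1 IH2]].
  have [h1 h2] := Lp0 p1.
  by under eq_fun do rewrite big_ord0; rewrite h2 big_ord0.
under eq_fun do rewrite big_ord_recr/=.
have [h1 h2] := LpD p1 IH1 (Fp n); split=> //.
by rewrite (le_trans h2)// big_ord_recr/= lerD2r.
Qed.

Lemma Lp1_integrable f : Lp 1 f <-> mu.-integrable setT (EFin \o f).
Proof.
rewrite -Lfun1_integrable; split=> [[mf h]|].
  by rewrite inE; apply/andP; split; rewrite inE.
by rewrite inE => /andP[]; rewrite !inE.
Qed.

Lemma nrm1E f : nrm 1 f = \int[mu]_x `|f x|.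
Proof. by rewrite /nrm Lnorm1. Qed.

End real_Lp.
Arguments Lp {d T R} mu p.
Arguments nrm {d T R} mu p f.

Section prob_Lp.
Context d (T : measurableType d) (R : realType).
Variable mu : {measure set T -> \bar R}.
Hypothesis mu1 : mu setT = 1%E.
Implicit Types (f g h : T -> R) (p c : R).

Lemma Lp_cst p c : 1 <= p -> Lp mu p (fun=> c) /\ nrm mu p (fun=> c) = `|c|.
Proof.
move=> p1.
have n1 : ('N[mu]_p%:E[cst 1] = 1)%E by rewrite Lnorm_cst1 mu1 poweR1r.
have h1 : Lp mu p (fun=> 1).
  split; first exact: measurable_cst.
  by rewrite (_ : EFin \o _ = cst 1%E)// n1 ltry.
have [] := LpZ c p1 h1; rewrite (_ : (fun=> c * 1) = (fun=> c)); last first.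
  by apply/funext => x; rewrite mulr1.
by move=> h2 ->; split => //; rewrite /nrm (_ : EFin \o _ = cst 1%E)// n1 mulr1.
Qed.

Lemma Lp_bounded p c f : 1 <= p -> measurable_fun setT f ->
  {ae mu, forall x, `|f x| <= c} -> Lp mu p f /\ nrm mu p f <= `|c|.
Proof.
move=> p1 mf fc; have [h1 <-] := Lp_cst c p1.
apply: Lp_dom => //; first exact: lt_le_trans p1.
by apply: filterS fc => x /le_trans; apply; exact: ler_norm.
Qed.

Lemma Lp_sub1 p f : 1 <= p -> Lp mu p f ->
  Lp mu 1 f /\ nrm mu 1 f <= nrm mu p f.
Proof.
rewrite le_eqVlt => /predU1P[<-//|p1] fp.
have p0 : 0 < p by exact: lt_trans p1.
have q0 : 0 < (1 - p^-1)^-1 by rewrite invr_gt0 subr_gt0 invf_lt1.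
have := @hoelder _ _ _ mu f (cst 1) p (1 - p^-1)^-1 fp.1.
move=> /(_ (measurable_cst _) p0 q0); rewrite invrK addrC subrK => /(_ erefl).
rewrite [X in (_ * X)%E](_ : _ = 1%E); last first.
  by rewrite (_ : EFin \o _ = cst 1%E)// Lnorm_cst1 mu1 poweR1r.
rewrite mule1 (_ : _ \* _ = f); last by apply/funext => x /=; rewrite mulr1.
move=> h; have f1 : Lp mu 1 f by split; [exact: fp.1|exact: le_lt_trans h fp.2].
by split=> //; rewrite -lee_fin !nrmE.
Qed.

End prob_Lp.

(** * The inner product of L^2 *)

Lemma measurable_level d (T : measurableType d) (R : realType) (f : T -> R) t :
  measurable_fun setT f -> measurable [set x | t < f x].
Proof.
move=> mf; rewrite -[X in measurable X]setTI.
have -> : [set x | t < f x] = f @^-1` `]t, +oo[%classic.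
  by apply/seteqP; split => y /=; rewrite in_itv/= andbT.
by apply: mf => //; exact: measurable_itv.
Qed.

Section L2.
Context d (T : measurableType d) (R : realType).
Variable mu : {measure set T -> \bar R}.
Implicit Types (f g h : T -> R) (c : R).

Definition ip f g : R := \int[mu]_x (f x * g x).

Let lt02 : 0 < 2 :> R. Proof. by rewrite ltr0n. Qed.

Lemma L2_mul f g : Lp mu 2 f -> Lp mu 2 g ->
  mu.-integrable setT (EFin \o (fun x => f x * g x)) /\
  `|ip f g| <= nrm mu 2 f * nrm mu 2 g.
Proof.
move=> f2 g2; have half : 2^-1 + 2^-1 = 1 :> R by lra.
have := @hoelder _ _ _ mu f g 2 2 f2.1 g2.1 _ _ half.
rewrite -(nrmE f2) -(nrmE g2) -EFinM => /(_ lt02 lt02) h.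
have fg : Lp mu 1 (f \* g).
  split; first by apply: measurable_funM; [exact: f2.1|exact: g2.1].
  exact: le_lt_trans h (ltry _).
have ifg := (Lp1_integrable _ _).1 fg; split=> //.
rewrite -nrmE// lee_fin in h; apply: le_trans h.
by rewrite nrm1E /ip; apply: le_normr_Rintegral.
Qed.

Lemma ipC f g : ip f g = ip g f.
Proof. by rewrite /ip; under eq_Rintegral do rewrite mulrC. Qed.

Lemma ip_lin c f g h : Lp mu 2 f -> Lp mu 2 g -> Lp mu 2 h ->
  ip (fun x => c * f x + g x) h = c * ip f h + ip g h.
Proof.
move=> f2 g2 h2; rewrite /ip.
under eq_Rintegral do rewrite mulrDl -mulrA.
rewrite RintegralD//; first rewrite RintegralZl//.
- exact: (L2_mul f2 h2).1.
- exact: (integrableZl measurableT c (L2_mul f2 h2).1).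
- exact: (L2_mul g2 h2).1.
Qed.

Lemma nrm2_ip f : Lp mu 2 f -> nrm mu 2 f ^+ 2 = ip f f.
Proof.
move=> f2; have := nrm_powR lt02 f2.
rewrite powR_mulrn ?nrm_ge0// => h.
rewrite /ip /Rintegral; rewrite -[LHS]/(fine (_%:E)) h.
congr fine; apply: eq_integral => x _; congr EFin.
by rewrite powR_mulrn ?normr_ge0// -normrX ger0_norm ?sqr_ge0// expr2.
Qed.

Lemma Lp2P f : measurable_fun setT f ->
  Lp mu 2 f <-> mu.-integrable setT (EFin \o (fun x => f x ^+ 2)).
Proof.
move=> mf; have e x : `|f x| `^ 2 = f x ^+ 2.
  by rewrite powR_mulrn ?normr_ge0// -normrX ger0_norm ?sqr_ge0.
rewrite Lp_powR//; under eq_integral do rewrite e.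
split=> [h|/integrableP[_]].
  apply/integrableP; split; first exact/measurable_EFinP/measurable_funX.
  by under eq_integral do rewrite /= ger0_norm ?sqr_ge0//.
by under eq_integral do rewrite /= ger0_norm ?sqr_ge0//.
Qed.

End L2.

(** * Geometric series and diagonal subsequences *)

Lemma sum_geometric_le (R : realType) (C r : R) (n m : nat) :
  0 <= C -> 0 <= r < 1 -> \sum_(i < m) C * r ^+ (n + i) <= C * r ^+ n / (1 - r).
Proof.
move=> C0 /andP[r0 r1]; have r10 : 0 < 1 - r by rewrite subr_gt0.
rewrite ler_pdivlMr//.
have -> : (\sum_(i < m) C * r ^+ (n + i)) * (1 - r) =
          C * r ^+ n * (1 - r ^+ m).
  elim: m => [|m IH]; first by rewrite big_ord0 expr0; ring.
  rewrite big_ord_recr/= mulrDl IH exprD exprS; ring.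
rewrite ler_piMr ?mulr_ge0 ?exprn_ge0//.
by rewrite lerBlDr lerDl exprn_ge0.
Qed.

Lemma limn_einf_le (R : realType) (u : (\bar R)^nat) (c : \bar R) :
  (forall n, u n <= c)%E -> (limn_einf u <= c)%E.
Proof.
move=> uc; rewrite limn_einf_lim; apply: lime_le; first exact: is_cvg_einfs.
apply: nearW => n; apply: le_trans (uc n).
by apply: ereal_inf_lbound; exists n => /=.
Qed.

Section Riesz_Fischer.
Context d (T : measurableType d) (R : realType).
Variable mu : {measure set T -> \bar R}.
Hypothesis mu1 : mu setT = 1%E.

Let le12 : 1 <= 2 :> R. Proof. by rewrite ler1n. Qed.
Let lt02 : 0 < 2 :> R. Proof. by rewrite ltr0n. Qed.

Variables (h : nat -> T -> R) (C r : R).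
Hypothesis r01 : 0 <= r < 1.
Hypothesis h2 : forall n, Lp mu 2 (h n).
Hypothesis hC : forall n, nrm mu 2 (h n) <= C * r ^+ n.

Let C0 : 0 <= C.
Proof. by have := le_trans (nrm_ge0 _ _ _) (hC 0); rewrite expr0 mulr1. Qed.

Let F x : \bar R := (\sum_(n <oo) (`|h n x|)%:E)%E.

Let mF : measurable_fun setT F.
Proof.
apply: ge0_emeasurable_sum => // n _.
by apply/measurable_EFinP; apply: measurableT_comp => //; exact: (h2 n).1.
Qed.

Let F_fin : {ae mu, forall x, (F x < +oo)%E}.
Proof.
have iF : (\int[mu]_x F x < +oo)%E.
  rewrite /F integral_nneseries//; last 1 first.
    move=> n; apply/measurable_EFinP; apply: measurableT_comp => //.
    exact: (h2 n).1.
  apply: (@le_lt_trans _ _ (C * r ^+ 0 / (1 - r))%:E); last exact: ltry.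
  apply: lime_le.
    by apply: is_cvg_nneseries => n _ _; exact: integral_ge0.
  apply: nearW => n; rewrite big_mkord.
  apply: (@le_trans _ _ (\sum_(i < n) (C * r ^+ i)%:E)%E).
    apply: lee_sum => i _.
    have [h1 h1'] := Lp_sub1 mu1 le12 (h2 i).
    have := le_trans h1' (hC i); rewrite -lee_fin nrmE// Lnorm1.
    by under eq_integral do rewrite abse_EFin.
  by rewrite sumEFin lee_fin (sum_geometric_le 0 n C0 r01).
have : mu.-integrable setT F.
  apply/integrableP; split => //.
  by under eq_integral do rewrite gee0_abs ?nneseries_ge0//.
move/integrable_ae => /(_ measurableT); apply: filterS => x /(_ I).
by move=> h'; rewrite ltey_eq h'.
Qed.

(* the terms vanish where the series of absolute values diverges, so that the
   partial sums converge at every point *)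
Let G := [set x | (F x < +oo)%E].
Let h' n x := h n x * \1_G x.

Let mG : measurable G.
Proof.
by rewrite -[G]setTI; apply: measurable_lte => //; exact: measurable_cst.
Qed.

Let hh' n : h n = h' n %[ae mu].
Proof.
apply: filterS F_fin => x Fx _; rewrite /h' indicE mem_set ?mulr1//.
Qed.

Let h'2 n : Lp mu 2 (h' n) /\ nrm mu 2 (h' n) = nrm mu 2 (h n).
Proof.
apply: nrm_ae => //; apply: measurable_funM; first exact: (h2 n).1.
exact: (measurable_indic (D := setT) mG).
Qed.

Let S n x := \sum_(i < n) h' i x.

Let S_cvg x : cvgn (S ^~ x).
Proof.
have -> : S ^~ x = series (h' ^~ x).
  by apply/funext => n; rewrite /S /series/= big_mkord.
apply: normed_cvg; rewrite /normed_series_of /=.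
have [Gx|Gx] := pselect (G x); last first.
  rewrite (_ : series _ = cst 0); first exact: is_cvg_cst.
  apply/funext => n; rewrite /series/= big1// => i _.
  by rewrite /h' indicE memNset// mulr0 normr0.
apply: nondecreasing_is_cvgn.
  by apply: nondecreasing_series => n _ _; exact: normr_ge0.
exists (fine (F x)) => _ [n _ <-] /=; rewrite -lee_fin fineK; last first.
  by rewrite ge0_fin_numE// /F nneseries_ge0.
rewrite -sumEFin /F.
apply: le_trans (nneseries_lim_ge n _) => //.
apply: lee_sum => i _; rewrite lee_fin /h' indicE mem_set// mulr1.
by [].
Qed.

Let s x := limn (S ^~ x).

Let mS n : measurable_fun setT (S n).
Proof. by have [[]] := @Lp_sum _ _ _ mu 2 n h' le12 (fun i => (h'2 i).1). Qed.

Let ms : measurable_fun setT s.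
Proof. by apply: (measurable_fun_cvg mS) => x _; exact: S_cvg. Qed.

Let S_tail n m : Lp mu 2 (fun x => S (n + m) x - S n x) /\
  nrm mu 2 (fun x => S (n + m) x - S n x) <= C * r ^+ n / (1 - r).
Proof.
have -> : (fun x => S (n + m) x - S n x) =
          (fun x => \sum_(i < m) h' (n + i)%N x).
  by apply/funext => x; rewrite /S big_split_ord/= addrAC subrr add0r.
have [k1 k2] := @Lp_sum _ _ _ mu 2 m (fun i => h' (n + i)%N) le12
  (fun i => (h'2 _).1).
split=> //; apply: le_trans k2 (le_trans _ (sum_geometric_le n m C0 r01)).
by apply: ler_sum => i _; rewrite (h'2 _).2.
Qed.

Let s_tail n : Lp mu 2 (fun x => s x - S n x) /\
  nrm mu 2 (fun x => s x - S n x) <= C * r ^+ n / (1 - r).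
Proof.
set B := C * r ^+ n / (1 - r).
have B0 : 0 <= B by exact: le_trans (nrm_ge0 _ _ _) (S_tail n 0).2.
have m1 : measurable_fun setT (fun x => s x - S n x).
  exact: measurable_funB.
have pE (k : T -> R) x : `|k x| `^ 2 = k x ^+ 2.
  by rewrite powR_mulrn ?normr_ge0// -normrX ger0_norm ?sqr_ge0.
have key : (\int[mu]_x (`|s x - S n x| `^ 2)%:E <= (B ^+ 2)%:E)%E.
  pose q m x := ((S (n + m) x - S n x) ^+ 2)%:E.
  have -> : (\int[mu]_x (`|s x - S n x| `^ 2)%:E =
             \int[mu]_x limn_einf (q ^~ x))%E.
    apply: eq_integral => x _; rewrite (pE (fun x => s x - S n x)).
    have : q ^~ x @ \oo --> ((s x - S n x) ^+ 2)%:E.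
      apply: cvg_EFin; first exact: nearW.
      apply: (@continuous_cvg _ _ _ _ _ _ (fun y : R => y ^+ 2)).
        exact: exprn_continuous.
      apply: cvgB; last exact: cvg_cst.
      exact: (cvg_comp _ _ (@cvg_addnl n) (@S_cvg x)).
    move=> qs; rewrite is_cvg_limn_einfE; first by rewrite (cvg_lim _ qs).
    by apply/cvg_ex; eexists; exact: qs.
  apply: le_trans (fatou _ _ _ _) _ => //.
  - by move=> m; apply/measurable_EFinP/measurable_funX/measurable_funB.
  - by move=> m x _; rewrite lee_fin sqr_ge0.
  apply: limn_einf_le => m; have [k1 k2] := S_tail n m.
  have := nrm_powR lt02 k1.
  under eq_integral do rewrite (pE (fun x => S (n + m) x - S n x)).
  move=> <-; rewrite lee_fin powR_mulrn ?nrm_ge0//.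
  by rewrite ler_pXn2r ?nnegrE ?nrm_ge0.
have s2 : Lp mu 2 (fun x => s x - S n x).
  by apply/Lp_powR => //; exact: le_lt_trans key (ltry _).
split=> //; rewrite -(@ler_pXn2r _ 2) ?nnegrE ?nrm_ge0//.
by rewrite -lee_fin; apply: le_trans key; rewrite -nrm_powR// powR_mulrn ?nrm_ge0.
Qed.

(** Absolute convergence in norm forces pointwise convergence almost everywhere,
    and Fatou's lemma turns the bounds on the finite tails into bounds on the
    infinite ones. *)
Lemma L2_series : exists2 s, Lp mu 2 s & forall n,
  nrm mu 2 (fun x => s x - \sum_(i < n) h i x) <= C * r ^+ n / (1 - r).
Proof.
exists s.
  by have [] := s_tail 0; under eq_fun do rewrite /S big_ord0 subr0.
move=> n; have [k1 k2] := s_tail n; rewrite (le_trans _ k2)//.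
have [k3 _] := @Lp_sum _ _ _ mu 2 n h le12 h2.
have [|_ ->//] := @nrm_ae _ _ _ mu 2 _ (fun x => s x - \sum_(i < n) h i x) lt02 k1
  (measurable_funB ms k3.1).
have : {ae mu, forall x, forall i, h i x = h' i x}.
  by apply: ae_foralln => i; apply: filterS (hh' i) => x; exact.
by apply: filterS => x hx _; congr (_ - _); apply: eq_bigr => i _; rewrite hx.
Qed.

End Riesz_Fischer.

Section subsequences.

Definition increasing (phi : nat -> nat) := {homo phi : m n / (m < n)%N}.

Lemma increasing_le (phi : nat -> nat) : increasing phi -> forall n, (n <= phi n)%N.
Proof.
move=> h; elim=> // n IH; apply: leq_ltn_trans IH _; exact: h.
Qed.

Lemma increasing_comp (phi psi : nat -> nat) : increasing phi -> increasing psi ->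
  increasing (phi \o psi).
Proof. by move=> h1 h2 m n mn; apply: h1; exact: h2. Qed.

Lemma increasingS (phi : nat -> nat) : (forall n, (phi n < phi n.+1)%N) ->
  increasing phi.
Proof.
move=> h m n; elim: n => // n IH; rewrite ltnS leq_eqVlt => /predU1P[->//|mn].
exact: ltn_trans (IH mn) _.
Qed.

(** The extractions are nested, so that the diagonal indices [j] and [j.+1] both
    lie in the range of the [j]-th subsequence. *)
Lemma diagonal_subsequence (C : nat -> nat -> nat -> Prop) :
  (forall j phi, increasing phi -> exists2 psi, increasing psi &
     forall a b, C j (phi (psi a)) (phi (psi b))) ->
  exists2 phi, increasing phi & forall j, C j (phi j) (phi j.+1).
Proof.
move=> H.
have H' (u : nat * {phi | increasing phi}) : {psi : {phi | increasing phi} |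
    forall a b, C u.1 (sval u.2 (sval psi a)) (sval u.2 (sval psi b))}.
  case: u => j [phi hphi] /=; apply: cid.
  by have [psi h1 h2] := H j phi hphi; exists (exist _ psi h1).
pose next j (u : {phi | increasing phi}) : {phi | increasing phi} :=
  let psi := sval (H' (j, u)) in
  exist _ (sval u \o sval psi) (increasing_comp (svalP u) (svalP psi)).
pose u0 : {phi | increasing phi} := @exist _ increasing id (fun m n mn => mn).
pose U := fix U j := next j (if j is i.+1 then U i else u0).
have Uj j a b : C j (sval (U j) a) (sval (U j) b).
  by case: j => [|j] /=; [exact: (svalP (H' (0, u0)))|exact: (svalP (H' (j.+1, U j)))].
have UE j : exists2 k, (j.+1 <= k)%N & sval (U j.+1) j.+1 = sval (U j) k.
  exists (sval (sval (H' (j.+1, U j))) j.+1) => //.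
  exact: (increasing_le (svalP (sval (H' (j.+1, U j))))).
exists (fun j => sval (U j) j).
  apply: increasingS => j; have [k jk ->] := UE j; exact: (svalP (U j)).
by move=> j; have [k jk ->] := UE j; exact: Uj.
Qed.

End subsequences.

(** * Contractions of all the L^p spaces *)

Section markov_contractions.
Context d (T : measurableType d) (R : realType).
Variable mu : {measure set T -> \bar R}.
Hypothesis mu1 : mu setT = 1%E.
Implicit Types (Q : (T -> R) -> (T -> R)) (f g : T -> R).

(** Operators are given on representatives, whence linearity modulo null sets;
    [L^1] contains all the other spaces, [mu] being a probability. *)
Definition Lp_contraction Q : Prop :=
  (forall p f, 1 <= p -> Lp mu p f ->
     Lp mu p (Q f) /\ nrm mu p (Q f) <= nrm mu p f) /\
  (forall c f g, Lp mu 1 f -> Lp mu 1 g ->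
     Q (fun x => c * f x + g x) = (fun x => c * Q f x + Q g x) %[ae mu]).

Variable Q : (T -> R) -> (T -> R).
Hypothesis hQ : Lp_contraction Q.

Let le11 : 1 <= 1 :> R. Proof. exact: lexx. Qed.

Lemma contraction_Lp p f : 1 <= p -> Lp mu p f -> Lp mu p (Q f).
Proof. by move=> p1 fp; have [] := hQ.1 _ _ p1 fp. Qed.

Lemma contraction_nrm p f : 1 <= p -> Lp mu p f -> nrm mu p (Q f) <= nrm mu p f.
Proof. by move=> p1 fp; have [] := hQ.1 _ _ p1 fp. Qed.

Lemma contraction_lin c f g : Lp mu 1 f -> Lp mu 1 g ->
  Q (fun x => c * f x + g x) = (fun x => c * Q f x + Q g x) %[ae mu].
Proof. exact: hQ.2. Qed.

Lemma contractionB f g : Lp mu 1 f -> Lp mu 1 g ->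
  Q (fun x => f x - g x) = (fun x => Q f x - Q g x) %[ae mu].
Proof.
move=> f1 g1; have := contraction_lin (-1) g1 f1.
rewrite (_ : (fun x => -1 * g x + f x) = (fun x => f x - g x)); last first.
  by apply/funext => x; rewrite mulN1r addrC.
by apply: filterS => x /[apply] ->; rewrite mulN1r addrC.
Qed.

Lemma contraction0 : Q (fun=> 0) = cst 0 %[ae mu].
Proof.
have [h0 n0] := Lp0 mu le11.
apply: (nrm_eq0 le11 (contraction_Lp le11 h0)).
by apply: le_trans (contraction_nrm le11 h0) _; rewrite n0.
Qed.

Lemma contractionZ c f : Lp mu 1 f ->
  Q (fun x => c * f x) = (fun x => c * Q f x) %[ae mu].
Proof.
move=> f1; have [h0 _] := Lp0 mu le11.
have -> : (fun x => c * f x) = (fun x => c * f x + 0).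
  by apply/funext => x; rewrite addr0.
apply: filterS2 (contraction_lin c f1 h0) contraction0 => x /(_ I) -> /(_ I) ->.
by rewrite addr0.
Qed.

(** Linearity and boundedness alone make an operator on representatives respect
    equality almost everywhere. *)
Lemma contraction_ae f g : Lp mu 1 f -> measurable_fun setT g ->
  f = g %[ae mu] -> Q f = Q g %[ae mu].
Proof.
move=> f1 mg fg; have [g1 _] := nrm_ae ltr01 f1 mg fg.
have [fg1 _] := LpB le11 f1 g1.
have [_ n0] : Lp mu 1 (fun x => f x - g x) /\ nrm mu 1 (fun x => f x - g x) = 0.
  have [h0 <-] := Lp0 mu le11.
  apply: nrm_ae => //; first exact: fg1.1.
  by apply: filterS fg => x /[apply] ->; rewrite subrr.
have : nrm mu 1 (Q (fun x => f x - g x)) <= 0.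
  by rewrite -n0; exact: contraction_nrm.
move/(nrm_eq0 le11 (contraction_Lp le11 fg1)).
apply: filterS2 (contractionB f1 g1) => x /(_ I) h1 /(_ I) h2 _.
by apply/eqP; rewrite -subr_eq0 -h1 h2.
Qed.

Lemma contraction_nrmB p f g : 1 <= p -> Lp mu p f -> Lp mu p g ->
  nrm mu p (fun x => Q f x - Q g x) <= nrm mu p (fun x => f x - g x).
Proof.
move=> p1 fp gp; have p0 : 0 < p by exact: lt_le_trans p1.
have [f1 _] := Lp_sub1 mu1 p1 fp; have [g1 _] := Lp_sub1 mu1 p1 gp.
have [fgp _] := LpB p1 fp gp.
have [QB _] := LpB p1 (contraction_Lp p1 fp) (contraction_Lp p1 gp).
have [_ ->] := nrm_ae p0 (contraction_Lp p1 fgp) QB.1 (contractionB f1 g1).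
exact: contraction_nrm.
Qed.

Lemma contraction_sum n (c : nat -> R) (F : nat -> T -> R) :
  (forall i, Lp mu 1 (F i)) ->
  Q (fun x => \sum_(i < n) c i * F i x) =
  (fun x => \sum_(i < n) c i * Q (F i) x) %[ae mu].
Proof.
move=> F1; elim: n => [|n IH].
  rewrite (_ : (fun x => _) = (fun=> 0)); last first.
    by apply/funext => x; rewrite big_ord0.
  by apply: filterS contraction0 => x /[apply] ->; rewrite big_ord0.
have h1 : Lp mu 1 (fun x => \sum_(i < n) c i * F i x).
  by apply: (Lp_sum n (F := fun i x => c i * F i x) le11 _).1 => i;
     apply: (LpZ _ le11 (F1 i)).1.
rewrite (_ : (fun x => _) =
    (fun x => c n * F n x + \sum_(i < n) c i * F i x)); last first.
  by apply/funext => x; rewrite big_ord_recr addrC.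
apply: filterS2 IH (contraction_lin (c n) (F1 n) h1) => x /(_ I) e1 /(_ I) e2 _.
by rewrite e2 e1 big_ord_recr addrC.
Qed.

End markov_contractions.

Section iterates.
Context d (T : measurableType d) (R : realType).
Variable mu : {measure set T -> \bar R}.
Hypothesis mu1 : mu setT = 1%E.
Variable Q : (T -> R) -> (T -> R).
Hypothesis hQ : Lp_contraction mu Q.

Lemma contraction_iter n : Lp_contraction mu (iter n Q).
Proof.
elim: n => [|n IH]; first by split=> // *; exact: aeW.
split=> [p f p1 fp|c f g f1 g1] /=.
  have [h1 h2] := IH.1 p f p1 fp; split; first exact: (contraction_Lp hQ).
  exact: le_trans (contraction_nrm hQ p1 h1) h2.
have [f2 g2] := ((IH.1 _ _ (lexx 1) f1).1, (IH.1 _ _ (lexx 1) g1).1).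
have fg1 := (LpD (lexx 1) (LpZ c (lexx 1) f1).1 g1).1.
have fg2 := (LpD (lexx 1) (LpZ c (lexx 1) f2).1 g2).1.
have := contraction_ae hQ (IH.1 _ _ (lexx 1) fg1).1 fg2.1 (IH.2 c f g f1 g1).
by apply: filterS2 (contraction_lin hQ c f2 g2) => x /(_ I) -> /(_ I) ->.
Qed.

Lemma iter_ae n (f g : T -> R) : Lp mu 1 f -> measurable_fun setT g ->
  f = g %[ae mu] -> iter n Q f = iter n Q g %[ae mu].
Proof. exact: (contraction_ae (contraction_iter n)). Qed.

End iterates.

(** * The Markov operator on real functions *)

Section markov_real.
Context d (T : measurableType d) (R : realType).
Variables (mu : probability T R) (P : R.-pker T ~> T).
Hypothesis hbi : bistochastic mu P.
Implicit Types (f g : T -> R) (c p : R).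

(** On complex functions [markov_op] is [kmean] applied to the real and to the
    imaginary part. *)
Definition kmean f : T -> R := fun x => \int[P x]_y f y.
Local Notation M := kmean.

Let mu1 : mu setT = 1%E. Proof. exact: probability_setT. Qed.
Let P1 x : P x setT = 1%E. Proof. exact: prob_kernel. Qed.
Let le11 : 1 <= 1 :> R. Proof. exact: lexx. Qed.
Let le12 : 1 <= 2 :> R. Proof. by rewrite ler1n. Qed.

Lemma measurable_kernel_integral (h : T -> \bar R) : (forall y, 0 <= h y)%E ->
  measurable_fun setT h -> measurable_fun setT (fun x => \int[P x]_y h y)%E.
Proof.
move=> h0 mh; apply: measurable_fun_integral_kernel => // U mU.
exact: (measurable_kernel P U mU).
Qed.

Import HBNNSimple.

(** Bistochasticity says that [mu] is the average of the measures [P x]. *)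
Lemma stationary_integral (h : T -> \bar R) : (forall y, 0 <= h y)%E ->
  measurable_fun setT h -> (\int[mu]_x \int[P x]_y h y = \int[mu]_x h x)%E.
Proof.
move=> h0 mh.
have simple (f : {nnsfun T >-> R}) :
    (\int[mu]_x \int[P x]_y (f y)%:E = \int[mu]_x (f x)%:E)%E.
  under eq_integral.
    move=> x _; rewrite integralT_nnsfun sintegralE; over.
  rewrite /= ge0_integral_fsum//; last 2 first.
    - move=> r; apply: measurable_funeM.
      exact: (measurable_kernel P (f @^-1` [set r])).
    - move=> n x _; have := mulemu_ge0 (fun n => f @^-1` [set n]).
      by apply; exact: preimage_nnfun0.
  rewrite integralT_nnsfun sintegralE; apply: eq_fsbigr => r _.
  have [r0|r0] := leP 0%R r.
    rewrite ge0_integralZl//; first by congr (_ * _)%E; exact: hbi.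
    exact: (measurable_kernel P (f @^-1` [set r])).
  rewrite preimage_nnfun0// integral0_eq; last by move=> x _; rewrite measure0 mule0.
  by rewrite measure0 mule0.
pose h_ := nnsfun_approx measurableT mh.
have hE x : h x = limn (fun n => (h_ n x)%:E).
  by apply/esym/cvg_lim => //; exact: cvg_nnsfun_approx.
have ndh y : {homo (fun n => (h_ n y)%:E) : m n / (m <= n)%N >-> (m <= n)%E}.
  by move=> m n mn; rewrite lee_fin; exact/lefP/nd_nnsfun_approx.
have mh_ n : measurable_fun setT (fun y => (h_ n y)%:E) by exact/measurable_EFinP.
have mc (nu : {measure set T -> \bar R}) :
    (\int[nu]_y h y = limn (fun n => \int[nu]_y (h_ n y)%:E))%E.
  under eq_integral do rewrite hE.
  by rewrite monotone_convergence// => n x _; rewrite lee_fin.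
rewrite mc; under eq_integral do rewrite mc.
rewrite monotone_convergence//.
- by congr (limn _); apply/funext => n; rewrite simple.
- by move=> n; apply: measurable_kernel_integral => // y; rewrite lee_fin.
- by move=> n x _; apply: integral_ge0 => y _; rewrite lee_fin.
- move=> x _ m n mn; apply: ge0_le_integral => // y _; first by rewrite lee_fin.
  exact: ndh.
Qed.

Lemma stationary_integrable f : Lp mu 1 f ->
  {ae mu, forall x, (P x).-integrable setT (EFin \o f)}.
Proof.
move=> f1; have mf : measurable_fun setT (EFin \o f).
  by apply/measurable_EFinP; exact: f1.1.
have i1 : mu.-integrable setT (fun x => \int[P x]_y `|(f y)%:E|)%E.
  apply/integrableP; split.
    by apply: measurable_kernel_integral => //; exact: measurableT_comp.
  under eq_integral do rewrite gee0_abs ?integral_ge0//.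
  rewrite stationary_integral//; last exact: measurableT_comp.
  by have /integrableP[] := (Lp1_integrable _ _).1 f1.
have := integrable_ae measurableT i1; apply: filterS => x /(_ I) h.
by apply/integrableP; split=> //; rewrite -ge0_fin_numE// integral_ge0.
Qed.

Lemma measurable_kmean f : measurable_fun setT f -> measurable_fun setT (M f).
Proof.
move=> mf; have mf' : measurable_fun setT (EFin \o f) by exact/measurable_EFinP.
rewrite /kmean /Rintegral.
apply: (@measurableT_comp _ _ _ _ _ _ (@fine R)) => //.
under eq_fun do rewrite integralE.
by apply: emeasurable_funB; apply: measurable_kernel_integral => //;
  [exact: measurable_funepos|exact: measurable_funeneg].
Qed.

(** Jensen's inequality, as the inclusion of [L^p] in [L^1] for the probability
    [P x]. *)
Lemma kmean_powR p f x : 1 <= p -> measurable_fun setT f ->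
  (P x).-integrable setT (EFin \o f) ->
  ((`|M f x| `^ p)%:E <= \int[P x]_y (`|f y| `^ p)%:E)%E.
Proof.
move=> p1 mf fi; have p0 : 0 < p by exact: lt_le_trans p1.
have [h|h] := ltP (\int[P x]_y (`|f y| `^ p)%:E)%E +oo%E; last first.
  exact: le_trans (leey _) h.
have fp : Lp (P x) p f by apply/Lp_powR.
have [_ h1] := Lp_sub1 (P1 x) p1 fp.
rewrite -nrm_powR// lee_fin ge0_ler_powR ?nnegrE ?nrm_ge0//; first exact: ltW.
apply: le_trans h1; rewrite nrm1E; exact: le_normr_Rintegral.
Qed.

Lemma kmean_contraction : Lp_contraction mu M.
Proof.
split=> [p f p1 fp|c f g f1 g1].
  have p0 : 0 < p by exact: lt_le_trans p1.
  have mf := fp.1; have mMf := measurable_kmean mf.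
  have h : (\int[mu]_x (`|M f x| `^ p)%:E <= \int[mu]_x (`|f x| `^ p)%:E)%E.
    have mfp : measurable_fun setT (fun y => (`|f y| `^ p)%:E).
      exact/measurable_EFinP/measurable_powRnorm.
    rewrite -(stationary_integral (h := fun y => (`|f y| `^ p)%:E))//.
    apply: ae_ge0_le_integral => //.
    - exact/measurable_EFinP/measurable_powRnorm.
    - by move=> x _; exact: integral_ge0.
    - exact: measurable_kernel_integral.
    - apply: filterS (stationary_integrable (Lp_sub1 mu1 p1 fp).1) => x fi _.
      exact: kmean_powR.
  have Mp : Lp mu p (M f).
    by apply/Lp_powR => //; apply: (le_lt_trans h); apply/Lp_powR.
  split=> //; rewrite leNgt; apply/negP => /(gt0_ltr_powR p0).
  rewrite !nnegrE !nrm_ge0 => /(_ isT isT).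
  by rewrite -lte_fin !nrm_powR// ltNge h.
apply: filterS2 (stationary_integrable f1) (stationary_integrable g1) => x fi gi _.
rewrite /kmean RintegralD ?RintegralZl//.
exact: (integrableZl measurableT c fi).
Qed.

Let MC := kmean_contraction.

Lemma kmean_cst c : M (fun=> c) = fun=> c.
Proof.
by apply/funext => x; rewrite /kmean Rintegral_cst// P1 mulr1.
Qed.

Lemma integral_kmean f : Lp mu 1 f ->
  \int[mu]_x M f x = \int[mu]_x f x.
Proof.
have pos g : Lp mu 1 g -> (forall x, 0 <= g x) ->
    \int[mu]_x M g x = \int[mu]_x g x.
  move=> g1 g0; have mg := g1.1.
  rewrite /Rintegral -(stationary_integral (h := EFin \o g))//; last first.
    exact/measurable_EFinP.
  congr fine; apply: ae_eq_integral => //.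
  - by apply/measurable_EFinP; exact: measurable_kmean.
  - apply: measurable_kernel_integral; first by move=> y; rewrite lee_fin.
    exact/measurable_EFinP.
  - apply: filterS (stationary_integrable g1) => x gi _.
    by rewrite /kmean /Rintegral fineK//; exact: integrable_fin_num.
move=> f1; have mf := f1.1.
have part (s : T -> R) : (forall x, `|s x| <= `|f x|) -> measurable_fun setT s ->
    Lp mu 1 s by move=> sf ms; apply: (Lp_dom ltr01 f1 ms _).1; exact: aeW.
pose a x := Num.max (f x) 0; pose b x : R := Num.max (- f x) 0.
have a1 : Lp mu 1 a.
  apply: part => [x|]; last by apply: measurable_maxr.
  by rewrite /a; case: (leP (f x) 0) => _; rewrite ?normr0.
have b1 : Lp mu 1 b.
  apply: part => [x|]; last by apply: measurable_maxr => //; exact: measurableT_comp.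
  by rewrite /b; case: (leP (- f x) 0) => _; rewrite ?normrN ?normr0.
have fab : f = (fun x => a x - b x).
  by apply/funext => x; rewrite /a /b; case: (leP (f x) 0); case: (leP (- f x) 0) => *; lra.
have ge0 (s : T -> R) x : 0 <= Num.max (s x) 0 by rewrite le_max lexx orbT.
have int s : Lp mu 1 s -> mu.-integrable setT (EFin \o s).
  by move=> ?; exact/Lp1_integrable.
rewrite [in RHS]fab RintegralB//; [|exact: int|exact: int].
rewrite -(pos a a1 (ge0 f)) -(pos b b1 (ge0 (fun x => - f x))).
have Ma := contraction_Lp MC le11 a1; have Mb := contraction_Lp MC le11 b1.
rewrite -RintegralB//; [|exact: int|exact: int].
rewrite /Rintegral; congr fine; apply: ae_eq_integral => //.
- by apply/measurable_EFinP; exact: measurable_kmean.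
- by apply/measurable_EFinP; apply: measurable_funB; [exact: Ma.1|exact: Mb.1].
- by rewrite [in M f]fab; apply: filterS (contractionB MC a1 b1) => x /[apply] ->.
Qed.

(** The variance of [f] under [P x], integrated against [mu], is
    [||f||^2 - ||M f||^2]; when it vanishes, so do almost all the variances. *)
Lemma deterministic f : Lp mu 2 f -> nrm mu 2 f <= nrm mu 2 (M f) ->
  {ae mu, forall x, {ae P x, forall y, f y = M f x}}.
Proof.
move=> f2 nf; have mf := f2.1; have mMf := measurable_kmean mf.
have Mf2 := contraction_Lp MC le12 f2.
pose f_2 x := f x ^+ 2; pose g x := M f_2 x - M f x ^+ 2.
have f_21 : Lp mu 1 f_2.
  by apply/Lp1_integrable; exact: (Lp2P _ mf).1.
have Mf_21 : Lp mu 1 (fun x => M f x ^+ 2).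
  by apply/Lp1_integrable; exact: (Lp2P _ mMf).1.
have var x : (P x).-integrable setT (EFin \o f) ->
    (P x).-integrable setT (EFin \o f_2) ->
    g x = \int[P x]_y (f y - M f x) ^+ 2.
  move=> fi f2i; set c := M f x.
  have f1x : Lp (P x) 1 f by exact/Lp1_integrable.
  have [cx _] := Lp_cst (P1 x) (c ^+ 2) le11.
  have [cfx _] := LpZ (- 2 * c) le11 f1x.
  have -> : \int[P x]_y (f y - c) ^+ 2 =
            \int[P x]_y (f_2 y + ((- 2 * c) * f y + c ^+ 2)).
    by apply: eq_Rintegral => y _; rewrite /f_2; ring.
  rewrite RintegralD//; last by apply/Lp1_integrable; exact: (LpD le11 cfx cx).1.
  rewrite RintegralD//; [|exact/Lp1_integrable|exact/Lp1_integrable].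
  rewrite RintegralZl// Rintegral_cst// P1/= mulr1 -/(M f x) -/c /g -/c /kmean.
  ring.
have good : {ae mu, forall x, (P x).-integrable setT (EFin \o f) /\
    (P x).-integrable setT (EFin \o f_2)}.
  apply: filterS2 (stationary_integrable (Lp_sub1 mu1 le12 f2).1)
    (stationary_integrable f_21) => x ? ?; split=> //.
have g1 : Lp mu 1 g.
  exact: (LpB le11 (contraction_Lp MC le11 f_21) Mf_21).1.
have g_ge0 : {ae mu, forall x, 0 <= g x}.
  apply: filterS good => x [h1 h2]; rewrite var//.
  by apply: Rintegral_ge0 => y _; exact: sqr_ge0.
have ig : \int[mu]_x g x <= 0.
  rewrite RintegralB//; [|apply/Lp1_integrable..]; last 2 first.
  - exact: (contraction_Lp MC le11 f_21).
  - exact: Mf_21.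
  rewrite integral_kmean// subr_le0.
  have -> : \int[mu]_x f_2 x = nrm mu 2 f ^+ 2 by rewrite nrm2_ip.
  have -> : \int[mu]_x M f x ^+ 2 = nrm mu 2 (M f) ^+ 2 by rewrite nrm2_ip.
  by rewrite ler_pXn2r ?nnegrE ?nrm_ge0.
have g0 : g = cst 0 %[ae mu].
  apply: (nrm_eq0 le11 g1); rewrite nrm1E (le_trans _ ig)// /Rintegral.
  rewrite (ae_eq_integral (EFin \o g))//.
  - by apply/measurable_EFinP; apply: measurableT_comp => //; exact: g1.1.
  - by apply/measurable_EFinP; exact: g1.1.
  - by apply: filterS g_ge0 => x gx _ /=; rewrite ger0_norm.
apply: filterS2 g0 good => x /(_ I) gx [h1 h2].
have f2x : Lp (P x) 2 f by apply/Lp2P.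
have [c2x _] := Lp_cst (P1 x) (M f x) le12.
have [fc2 _] := LpB le12 f2x c2x.
have : nrm (P x) 2 (fun y => f y - M f x) <= 0.
  rewrite -(@ler_pXn2r _ 2) ?nnegrE ?nrm_ge0// nrm2_ip// expr0n/=.
  by rewrite -[leLHS]/(\int[P x]_y (f y - M f x) ^+ 2) -var// gx.
move/(nrm_eq0 le12 fc2); apply: filterS => y /(_ I) h.
by apply/eqP; rewrite -subr_eq0 h.
Qed.

(** Where [M] preserves the norm it acts as composition with a point map, hence
    commutes with every pointwise operation, here taking a superlevel set. *)
Lemma kmean_level f t : Lp mu 2 f -> nrm mu 2 f <= nrm mu 2 (M f) ->
  M (\1_[set x | t < f x]) = \1_[set x | t < M f x] %[ae mu].
Proof.
move=> f2 nf; apply: filterS (deterministic f2 nf) => x fx _.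
have -> : \1_[set x | t < M f x] x = \int[P x]_y \1_[set x | t < M f x] x.
  by rewrite Rintegral_cst// P1 mulr1.
rewrite /kmean /Rintegral; congr fine; apply: ae_eq_integral => //.
- apply/measurable_EFinP; apply: measurable_indic; exact: measurable_level f2.1.
- apply: filterS fx => y fy _; rewrite !indicE.
  suff -> : (y \in [set z | t < f z]) = (x \in [set z | t < M f z]) by [].
  by apply/idP/idP; rewrite !inE /= fy.
Qed.

End markov_real.

(** * Complex functions through their real and imaginary parts *)

Section complex_numbers.
Variable R : realType.
Implicit Types (z w : R[i]) (x : R).

Lemma ReCD z w : complex.Re (z + w) = complex.Re z + complex.Re w.
Proof. by case: z => a b; case: w => c d. Qed.

Lemma ImCD z w : complex.Im (z + w) = complex.Im z + complex.Im w.
Proof. by case: z => a b; case: w => c d. Qed.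

Lemma ReCB z w : complex.Re (z - w) = complex.Re z - complex.Re w.
Proof. by case: z => a b; case: w => c d. Qed.

Lemma ImCB z w : complex.Im (z - w) = complex.Im z - complex.Im w.
Proof. by case: z => a b; case: w => c d. Qed.

Lemma ReCM z w : complex.Re (z * w) =
  complex.Re z * complex.Re w - complex.Im z * complex.Im w.
Proof. by case: z => a b; case: w => c d. Qed.

Lemma ImCM z w : complex.Im (z * w) =
  complex.Re z * complex.Im w + complex.Im z * complex.Re w.
Proof. by case: z => a b; case: w => c d. Qed.

Lemma ReC_sum n (F : 'I_n -> R[i]) :
  complex.Re (\sum_i F i) = \sum_i complex.Re (F i).
Proof. by elim/big_ind2: _ => // x1 x2 y1 y2 <- <-; rewrite ReCD. Qed.

Lemma ImC_sum n (F : 'I_n -> R[i]) :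
  complex.Im (\sum_i F i) = \sum_i complex.Im (F i).
Proof. by elim/big_ind2: _ => // x1 x2 y1 y2 <- <-; rewrite ImCD. Qed.

Lemma complexP z w : complex.Re z = complex.Re w ->
  complex.Im z = complex.Im w -> z = w.
Proof. by case: z => a b; case: w => c d /= -> ->. Qed.

Lemma cabsE z : cabs z = Num.sqrt (complex.Re z ^+ 2 + complex.Im z ^+ 2).
Proof. by case: z. Qed.

Lemma cabs_ge0 z : 0 <= cabs z.
Proof. by rewrite cabsE sqrtr_ge0. Qed.

Lemma cabsD z w : cabs (z + w) <= cabs z + cabs w.
Proof. exact: le_normcD. Qed.

Lemma cabsM z w : cabs (z * w) = cabs z * cabs w.
Proof. exact: complex.ComplexField.Normc.normcM. Qed.

Lemma cabs_eq0 z : cabs z = 0 -> z = 0.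
Proof. exact: complex.ComplexField.Normc.eq0_normc. Qed.

Lemma normc_cabs z : `|z| = (cabs z)%:C%C.
Proof. by rewrite normc_def cabsE. Qed.

Lemma cabs_unit z : `|z| = 1 <-> cabs z = 1.
Proof.
rewrite normc_cabs; split=> [[]//|->//].
Qed.

Lemma cabs_real x : cabs x%:C%C = `|x|.
Proof. by rewrite cabsE/= expr0n/= addr0 sqrtr_sqr. Qed.

Lemma cabsX z n : cabs (z ^+ n) = cabs z ^+ n.
Proof.
elim: n => [|n IH]; first by rewrite !expr0 (cabs_real 1) normr1.
by rewrite !exprS cabsM IH.
Qed.

Lemma cabs_unity_root z n : (0 < n)%N -> z ^+ n = 1 -> cabs z = 1.
Proof.
move=> n0 zn; have /eqP : cabs z ^+ n = 1 by rewrite -cabsX zn (cabs_real 1) normr1.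
by rewrite pexpr_eq1 ?cabs_ge0// => /eqP.
Qed.

Lemma Re_le_cabs z : `|complex.Re z| <= cabs z.
Proof. by rewrite cabsE -sqrtr_sqr ler_sqrt ?addr_ge0 ?sqr_ge0// lerDl sqr_ge0. Qed.

Lemma Im_le_cabs z : `|complex.Im z| <= cabs z.
Proof. by rewrite cabsE -sqrtr_sqr ler_sqrt ?addr_ge0 ?sqr_ge0// lerDr sqr_ge0. Qed.

Lemma cabs_le z : cabs z <= `|complex.Re z| + `|complex.Im z|.
Proof.
have -> : z = (complex.Re z)%:C%C + (0 +i* complex.Im z)%C.
  by apply: complexP; rewrite ?ReCD ?ImCD/= ?addr0 ?add0r.
apply: le_trans (cabsD _ _) _; rewrite cabs_real ReCD ImCD/= addr0 add0r lerD2l.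
by rewrite expr0n/= add0r sqrtr_sqr.
Qed.

End complex_numbers.

Section complex_Lp_norm.
Context d (T : measurableType d) (R : realType).
Variable mu : {measure set T -> \bar R}.
Implicit Types (f g : T -> R[i]) (p : R) (a : R[i]).

Definition cnrm p f : R := nrm mu p (fun x => cabs (f x)).

Definition re f : T -> R := fun x => complex.Re (f x).
Definition im f : T -> R := fun x => complex.Im (f x).

Lemma measurable_cabs f : cmeasurable f -> measurable_fun setT (fun x => cabs (f x)).
Proof.
move=> [mr mi].
rewrite (_ : (fun x => _) = (fun x => (re f x ^+ 2 + im f x ^+ 2) `^ 2^-1)).
  apply: (@measurableT_comp _ _ _ _ _ _ (@powR R ^~ 2^-1)) => //.
  by apply: measurable_funD; exact: measurable_funX.
by apply/funext => x; rewrite cabsE powR12_sqrt// addr_ge0 ?sqr_ge0.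
Qed.

Lemma nrm_abs p (h : T -> R) : nrm mu p (fun x => `|h x|) = nrm mu p h.
Proof. by rewrite /nrm -[in RHS]Lnorm_abse. Qed.

Lemma Lp_abs p (h : T -> R) : Lp mu p h -> Lp mu p (fun x => `|h x|).
Proof.
move=> [mh hp]; split; first exact: measurableT_comp.
by rewrite -Lnorm_abse in hp.
Qed.

Lemma cLpP p f : 1 <= p ->
  cLp mu p%:E f <-> Lp mu p (re f) /\ Lp mu p (im f).
Proof.
move=> p1; have p0 : 0 < p by exact: lt_le_trans p1.
split=> [[[mr mi] h]|[r i]].
  have fp : Lp mu p (fun x => cabs (f x)) by split=> //; exact: measurable_cabs.
  by split; apply: (Lp_dom p0 fp _ _).1 => //; apply: aeW => x;
    rewrite [leRHS]ger0_norm ?cabs_ge0// ?Re_le_cabs ?Im_le_cabs.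
have mf : cmeasurable f by split; [exact: r.1|exact: i.1].
split=> //.
have [h _] := LpD p1 (Lp_abs r) (Lp_abs i).
apply: (Lp_dom p0 h (measurable_cabs mf) _).1.2; apply: aeW => x.
rewrite ger0_norm ?cabs_ge0// [leRHS]ger0_norm ?addr_ge0//; exact: cabs_le.
Qed.

Lemma cLp_cabs p f : cLp mu p%:E f -> Lp mu p (fun x => cabs (f x)).
Proof. by move=> [mf h]; split=> //; exact: measurable_cabs. Qed.

Lemma cnormE p f : cLp mu p%:E f -> cnorm mu p%:E f = (cnrm p f)%:E.
Proof. by move=> /cLp_cabs fp; rewrite nrmE. Qed.

Lemma cnrm_ge0 p f : 0 <= cnrm p f.
Proof. exact: nrm_ge0. Qed.

Lemma cnrm_re p f : 1 <= p -> cLp mu p%:E f -> nrm mu p (re f) <= cnrm p f.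
Proof.
move=> p1 fp; have p0 : 0 < p by exact: lt_le_trans p1.
apply: (Lp_dom p0 (cLp_cabs fp) _ _).2; first exact: ((cLpP f p1).1 fp).1.1.
by apply: aeW => x; rewrite [leRHS]ger0_norm ?cabs_ge0// Re_le_cabs.
Qed.

Lemma cnrm_im p f : 1 <= p -> cLp mu p%:E f -> nrm mu p (im f) <= cnrm p f.
Proof.
move=> p1 fp; have p0 : 0 < p by exact: lt_le_trans p1.
apply: (Lp_dom p0 (cLp_cabs fp) _ _).2; first exact: ((cLpP f p1).1 fp).2.1.
by apply: aeW => x; rewrite [leRHS]ger0_norm ?cabs_ge0// Im_le_cabs.
Qed.

Lemma cnrm_le p f : 1 <= p -> cLp mu p%:E f ->
  cnrm p f <= nrm mu p (re f) + nrm mu p (im f).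
Proof.
move=> p1 fp; have p0 : 0 < p by exact: lt_le_trans p1.
have [r i] := (cLpP f p1).1 fp.
have [h h'] := LpD p1 (Lp_abs r) (Lp_abs i).
rewrite -(nrm_abs _ (re f)) -(nrm_abs _ (im f)); apply: le_trans h'.
apply: (Lp_dom p0 h _ _).2; first exact: (cLp_cabs fp).1.
apply: aeW => x; rewrite ger0_norm ?cabs_ge0// [leRHS]ger0_norm ?addr_ge0//; exact: cabs_le.
Qed.

Lemma cLp_lin p a f g : 1 <= p -> cLp mu p%:E f -> cLp mu p%:E g ->
  cLp mu p%:E (fun x => a * f x + g x).
Proof.
move=> p1 /(cLpP _ p1)[fr fi] /(cLpP _ p1)[gr gi]; apply/cLpP => //.
have Z c h (hp : Lp mu p h) := (LpZ c p1 hp).1.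
have D h k (hp : Lp mu p h) (kp : Lp mu p k) := (LpD p1 hp kp).1.
have B h k (hp : Lp mu p h) (kp : Lp mu p k) := (LpB p1 hp kp).1.
split.
- rewrite (_ : re _ = fun x => (complex.Re a * re f x - complex.Im a * im f x) + re g x).
    by apply: (D) => //; apply: B; exact: Z.
  by apply/funext => x; rewrite /re ReCD ReCM.
- rewrite (_ : im _ = fun x => (complex.Re a * im f x + complex.Im a * re f x) + im g x).
    by apply: (D) => //; apply: D; exact: Z.
  by apply/funext => x; rewrite /im ImCD ImCM.
Qed.

Lemma cLpB p f g : 1 <= p -> cLp mu p%:E f -> cLp mu p%:E g ->
  cLp mu p%:E (fun x => f x - g x).
Proof.
move=> p1 fp gp; have := cLp_lin (-1) p1 gp fp.
by under eq_fun do rewrite mulN1r addrC.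
Qed.

Lemma cnrm_tri p f g h : 1 <= p -> cLp mu p%:E f -> cLp mu p%:E g ->
  cLp mu p%:E h -> (forall x, cabs (h x) <= cabs (f x) + cabs (g x)) ->
  cnrm p h <= cnrm p f + cnrm p g.
Proof.
move=> p1 fp gp hp fgh; have p0 : 0 < p by exact: lt_le_trans p1.
have [k k'] := LpD p1 (cLp_cabs fp) (cLp_cabs gp).
apply: le_trans k'; apply: (Lp_dom p0 k _ _).2; first exact: (cLp_cabs hp).1.
by apply: aeW => x; rewrite !ger0_norm ?addr_ge0 ?cabs_ge0.
Qed.

Lemma cabsN (z : R[i]) : cabs (- z) = cabs z.
Proof. by rewrite !cabsE; case: z => a b /=; rewrite !sqrrN. Qed.

Lemma cnrm_triangle p f g h : 1 <= p -> cLp mu p%:E f -> cLp mu p%:E g ->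
  cLp mu p%:E h ->
  cnrm p (fun x => f x - h x) <=
  cnrm p (fun x => f x - g x) + cnrm p (fun x => g x - h x).
Proof.
move=> p1 fp gp hp; apply: cnrm_tri => //; try exact: cLpB.
by move=> x; rewrite -[f x - h x](subrKA (g x)); exact: cabsD.
Qed.

Lemma cnrmZ p a f : 1 <= p -> cLp mu p%:E f ->
  cLp mu p%:E (fun x => a * f x) /\ cnrm p (fun x => a * f x) = cabs a * cnrm p f.
Proof.
move=> p1 fp; split.
  have p0' : cLp mu p%:E (fun x => f x - f x) by exact: cLpB.
  have := cLp_lin a p1 fp p0'.
  by under eq_fun do rewrite subrr addr0.
rewrite /cnrm; under eq_fun do rewrite cabsM.
have [_ ->] := LpZ (cabs a) p1 (cLp_cabs fp).
by rewrite ger0_norm ?cabs_ge0.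
Qed.

Lemma cnrm_ae p f g : 0 < p -> cLp mu p%:E f -> cmeasurable g ->
  f = g %[ae mu] -> cLp mu p%:E g /\ cnrm p g = cnrm p f.
Proof.
move=> p0 fp mg fg.
have [h1 h2] := nrm_ae p0 (cLp_cabs fp) (measurable_cabs mg)
  (filterS (fun x (e : setT x -> f x = g x) (I : setT x) => congr1 (@cabs R) (e I)) fg).
by split=> //; split=> //; exact: h1.2.
Qed.

Lemma cnrm_eq0 p f : 1 <= p -> cLp mu p%:E f -> cnrm p f <= 0 -> f = cst 0 %[ae mu].
Proof.
move=> p1 fp h; have := nrm_eq0 p1 (cLp_cabs fp) h.
by apply: filterS => x /[apply] /cabs_eq0.
Qed.

Definition of_real (h : T -> R) : T -> R[i] := fun x => (h x)%:C%C.

Lemma cLp_of_real p h : 1 <= p -> Lp mu p h ->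
  cLp mu p%:E (of_real h) /\ cnrm p (of_real h) = nrm mu p h.
Proof.
move=> p1 hp; split.
  by apply/cLpP => //; split=> //; exact: (Lp0 mu p1).1.
by rewrite /cnrm /of_real; under eq_fun do rewrite cabs_real; exact: nrm_abs.
Qed.

End complex_Lp_norm.

Arguments cLpP {d T R mu p} f p1.

(** * Asymptotic compactness *)

Section asymptotic_compactness.
Context d (T : measurableType d) (R : realType).
Variables (mu : probability T R) (P : R.-pker T ~> T).
Hypothesis hbi : bistochastic mu P.
Implicit Types (f g : T -> R).
Local Notation M := (kmean P).
Local Notation L2 := (Lp mu 2).
Local Notation n2 := (nrm mu 2).

Let mu1 : mu setT = 1%E. Proof. exact: probability_setT. Qed.
Let le12 : 1 <= 2 :> R. Proof. by rewrite ler1n. Qed.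
Let lt02 : 0 < 2 :> R. Proof. by rewrite ltr0n. Qed.
Let MC : Lp_contraction mu M. Proof. exact: kmean_contraction. Qed.
Let MCn n : Lp_contraction mu (iter n M). Proof. exact: contraction_iter. Qed.

Lemma expr_small (r e : R) : 0 <= r < 1 -> 0 < e -> exists n, r ^+ n <= e.
Proof.
move=> /andP[r0 r1] e0.
have : geometric 1 r @ \oo --> (0 : R).
  by apply: cvg_geometric; rewrite ger0_norm.
move=> /cvgrPdist_le /(_ e e0)[n _ /(_ n (leqnn n))]/=.
by rewrite sub0r normrN mul1r => h; exists n; apply: le_trans h; exact: ler_norm.
Qed.

Lemma re_markov_iter n (f : T -> R[i]) :
  re (iter n (markov_op P) f) = iter n M (re f).
Proof. by elim: n => //= n <-. Qed.

Lemma im_markov_iter n (f : T -> R[i]) :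
  im (iter n (markov_op P) f) = iter n M (im f).
Proof. by elim: n => //= n <-. Qed.

Lemma markov_iter_cLp n p (f : T -> R[i]) : 1 <= p -> cLp mu p%:E f ->
  cLp mu p%:E (iter n (markov_op P) f).
Proof.
move=> p1 /(cLpP _ p1)[fr fi]; apply/cLpP => //.
rewrite re_markov_iter im_markov_iter.
by split; apply: (contraction_Lp (MCn n)).
Qed.

Lemma markov_iter_of_real n f :
  iter n (markov_op P) (of_real f) = of_real (iter n M f).
Proof.
have im0 : iter n M (fun=> 0) = fun=> 0.
  by elim: n => //= n ->; exact: kmean_cst.
apply/funext => x; apply: complexP.
  by have := congr1 (fun h => h x) (re_markov_iter n (of_real f)).
have := congr1 (fun h => h x) (im_markov_iter n (of_real f)).
by move=> e; rewrite [LHS]e -[RHS]/((fun=> 0) x) -im0.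
Qed.

Hypothesis hqc : quasi_compact mu 2%:E (markov_op P).

Definition in_ball f := L2 f /\ n2 f <= 1.

(** [K] need not send real functions to real ones, hence the complex norm. *)
Let quasi_compact_real : exists (n : nat) (K : (T -> R[i]) -> (T -> R[i])) (q : R),
  [/\ compact_operator mu 2%:E K, 0 <= q < 1 &
   forall f, in_ball f ->
   cnrm mu 2 (fun x => of_real (iter n M f) x - K (of_real f) x) <= q].
Proof.
have [_ [n [K [n0 Kc nq]]]] := hqc; exists n, K.
set o := opnorm _ _ _ in nq.
have ub f : in_ball f ->
    ((cnrm mu 2 (fun x => of_real (iter n M f) x - K (of_real f) x))%:E <= o)%E.
  move=> [f2 f1]; have [cf cf1] := cLp_of_real le12 f2.
  rewrite -cnormE; last first.
    apply: cLpB => //; last by have [[h _ _] _] := Kc; exact: h.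
    exact: (cLp_of_real le12 (contraction_Lp (MCn n) le12 f2)).1.
  apply: ereal_sup_ubound; exists (of_real f); last by rewrite markov_iter_of_real.
  by split=> //; rewrite cnormE// cf1 lee_fin.
have b0 : in_ball (fun=> 0) by rewrite /in_ball; have [? ->] := Lp0 mu le12.
have o0 : (0 <= o)%E by apply: le_trans (ub _ b0); rewrite lee_fin cnrm_ge0.
have of_ : o \is a fin_num by rewrite ge0_fin_numE// (lt_trans nq)// ltry.
exists (fine o); split=> //.
  by rewrite -!lee_fin -lte_fin fineK// o0.
by move=> f fb; rewrite -lee_fin [leRHS]fineK//; exact: ub.
Qed.

Lemma contraction_pair n c f g h : L2 f -> L2 g -> L2 h ->
  (forall x, f x = c * h x + g x) ->
  n2 (fun x => iter n M f x - iter n M g x) = `|c| * n2 (iter n M h).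
Proof.
move=> f2 g2 h2 e.
have [f1 _] := Lp_sub1 mu1 le12 f2; have [g1 _] := Lp_sub1 mu1 le12 g2.
have [h1 _] := Lp_sub1 mu1 le12 h2.
have Mh := contraction_Lp (MCn n) le12 h2.
have [cMh <-] := LpZ c le12 Mh.
have B := (LpB le12 (contraction_Lp (MCn n) le12 f2) (contraction_Lp (MCn n) le12 g2)).1.
have [|_ ->//] := nrm_ae lt02 cMh B.1.
have -> : f = (fun x => c * h x + g x) by apply/funext.
by apply: filterS (contraction_lin (MCn n) c h1 g1) => x /[apply] ->; rewrite addrK.
Qed.

(** Write [P^n = K + S] with [||S|| <= q]. Along a subsequence where [K (y k)] is
    nearly constant, applying [P^n] multiplies the mutual distances by [q], up to
    the error [e]. *)
Let refine_step : exists2 nq : nat * R, 0 <= nq.2 < 1 &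
  forall (y : nat -> T -> R) (e d' : R), (forall k, in_ball (y k)) ->
    0 < e -> 0 < d' ->
    (forall a b, n2 (fun x => y a x - y b x) <= d') ->
  exists2 phi, increasing phi & forall a b,
    n2 (fun x => iter nq.1 M (y (phi a)) x - iter nq.1 M (y (phi b)) x)
     <= nq.2 * d' + e.
Proof.
have [n [K [q [[[K1 K2 _] K3] q01 Kq]]]] := quasi_compact_real.
exists (n, q) => //= y e d' yb e0 d0 yd.
have cy k : cLp mu 2%:E (of_real (y k)) by apply: (cLp_of_real le12 (yb k).1).1.
have [|phi [g [hphi g2 cv]]] := K3 (fun k => of_real (y k)).
  move=> k; split; first exact: cy.
  by rewrite cnormE// (cLp_of_real le12 (yb k).1).2 lee_fin; exact: (yb k).2.
have e20 : 0 < e / 2 by exact: divr_gt0.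
have [N KN] : exists N, forall k, (N <= k)%N ->
    cnrm mu 2 (fun x => K (of_real (y (phi k))) x - g x) <= e / 2.
  have cv' : (cnrm mu 2 (fun x => K (of_real (y (phi k))) x - g x))%:E
      @[k --> \oo] --> 0%E.
    apply: cvg_trans cv; apply: near_eq_cvg; apply: nearW => k.
    by rewrite cnormE//; apply: cLpB => //; exact: K1.
  have /fine_cvgP[_ /cvgrPdist_le/(_ _ e20)[N _ hN]] := cv'.
  by exists N => k /hN /=; rewrite sub0r normrN ger0_norm ?cnrm_ge0.
exists (fun k => phi (k + N)%N).
  by move=> a b ab; apply: hphi; rewrite ltn_add2r.
move=> a b; set ya := y (phi _); set yb' := y (phi _).
have [a2 b2] := ((yb (phi (a + N)%N)).1, (yb (phi (b + N)%N)).1).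
(* the bounds on [S] hold on the unit ball, which contains [(ya - yb') / d'] *)
pose w x := d'^-1 * (ya x - yb' x).
have [ab2 _] := LpB le12 a2 b2.
have [w2 nw] := LpZ d'^-1 le12 ab2.
have wb : in_ball w.
  split=> //; rewrite nw gtr0_norm ?invr_gt0// ler_pdivrMl// mulr1.
  exact: yd.
have ew x : ya x = d' * w x + yb' x.
  by rewrite /w mulrA divff ?gt_eqF// mul1r subrK.
rewrite (contraction_pair n a2 b2 w2 ew) gtr0_norm//.
have cw : cLp mu 2%:E (of_real w) by apply: (cLp_of_real le12 w2).1.
have [Kw Kya Kyb] : [/\ cLp mu 2%:E (K (of_real w)),
  cLp mu 2%:E (K (of_real ya)) & cLp mu 2%:E (K (of_real yb'))].
  by split; apply: K1 => //; exact: cy.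
have [cMw nMw] := cLp_of_real le12 (contraction_Lp (MCn n) le12 w2).
have Kab : d' * cnrm mu 2 (K (of_real w)) <= e.
  have [cK nK] := cnrmZ d'%:C%C le12 Kw.
  have -> : d' * cnrm mu 2 (K (of_real w)) =
            cnrm mu 2 (fun x => K (of_real ya) x - K (of_real yb') x).
    rewrite -(gtr0_norm d0) -cabs_real -nK.
    have [|_ ->//] := cnrm_ae lt02 cK (cLpB le12 Kya Kyb).1.
    have -> : of_real ya = (fun x => d'%:C%C * of_real w x + of_real yb' x).
      apply/funext => x; rewrite /of_real ew; apply: complexP;
        rewrite ?ReCD ?ImCD ?ReCM ?ImCM/= !(mul0r, mulr0, subr0, addr0)//.
    by apply: filterS (K2 d'%:C%C _ _ cw (cy (phi (b + N)%N))) => x /[apply] ->; rewrite addrK.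
  apply: le_trans (cnrm_triangle le12 Kya g2 Kyb) _; rewrite (splitr e) lerD//.
    by apply: KN; rewrite leq_addl.
  rewrite /cnrm; under eq_fun do rewrite -cabsN opprB.
  by apply: KN; rewrite leq_addl.
apply: (@le_trans _ _ (d' * (q + cnrm mu 2 (K (of_real w))))); last first.
  by rewrite mulrDr mulrC lerD2l.
rewrite ler_pM2l// -nMw.
apply: le_trans (lerD (Kq w wb) (lexx _)).
apply: cnrm_tri => //; first exact: cLpB.
by move=> x; rewrite -{1}[of_real _ x](subrK (K (of_real w) x)); exact: cabsD.
Qed.

(** Diameters shrink geometrically under the repetition of [refine_step]; a ratio
    [q'] slightly larger than [q] absorbs the errors. *)
Let small_diameter e : 0 < e -> exists m, forall y : nat -> T -> R,
  (forall k, in_ball (y k)) -> exists2 phi, increasing phi & forall a b,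
  n2 (fun x => iter m M (y (phi a)) x - iter m M (y (phi b)) x) <= e.
Proof.
move=> e0; have [[n q] /= /andP[q0 q1] step] := refine_step.
pose q' := (1 + q) / 2.
have [q'0 q'1 qq'] : [/\ 0 < q', q' < 1 & q < q'] by rewrite /q'; split; lra.
have [j hj] : exists j, 2 * q' ^+ j <= e.
  have [||j] := @expr_small q' (e / 2); first by rewrite ltW.
    exact: divr_gt0.
  by rewrite ler_pdivlMr// mulrC; exists j.
suff [m hm] : exists m, forall y : nat -> T -> R,
    (forall k, in_ball (y k)) -> exists2 phi, increasing phi & forall a b,
    n2 (fun x => iter m M (y (phi a)) x - iter m M (y (phi b)) x) <= 2 * q' ^+ j.
  exists m => y /hm[phi h1 h2]; exists phi => // a b; exact: le_trans (h2 a b) hj.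
elim: j {hj} => [|j [m IH]].
  exists 0%N => y yb; exists id => // a b; rewrite expr0 mulr1.
  apply: le_trans (LpB le12 (yb a).1 (yb b).1).2 _.
  by rewrite -[2]/(1 + 1) lerD//; [exact: (yb a).2|exact: (yb b).2].
exists (n + m)%N => y yb; have [phi hphi phid] := IH y yb.
have d0 : 0 < 2 * q' ^+ j by rewrite mulr_gt0// exprn_gt0.
have e'0 : 0 < (q' - q) * (2 * q' ^+ j) by rewrite mulr_gt0// subr_gt0.
have [|psi hpsi psid] := step (fun k => iter m M (y (phi k))) _ _ _ e'0 d0 phid.
  move=> k; split; first exact: (contraction_Lp (MCn m) le12 (yb _).1).
  exact: (le_trans (contraction_nrm (MCn m) le12 (yb _).1) (yb _).2).
exists (phi \o psi); first exact: increasing_comp.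
move=> a b /=; rewrite !iterD; apply: le_trans (psid a b) _.
by rewrite -mulrDl addrCA subrr addr0 exprS mulrCA.
Qed.

Definition L2_cvg (x : nat -> T -> R) (g : T -> R) := forall e, 0 < e ->
  exists N, forall k, (N <= k)%N -> n2 (fun t => x k t - g t) <= e.

(** The images of the unit ball under high powers of [M] are nearly compact:
    each factor [P^n = K + S], [||S|| < 1], contracts the diameter of the pieces
    that [K] cannot separate. *)
Lemma asymptotic_compactness (f : nat -> T -> R) (m : nat -> nat) :
  (forall k, in_ball (f k)) -> (forall k, (k <= m k)%N) ->
  exists phi g, [/\ increasing phi, L2 g &
    L2_cvg (fun k => iter (m (phi k)) M (f (phi k))) g].
Proof.
move=> fb hm; pose x k := iter (m k) M (f k).
have x2 k : L2 (x k) by exact: (contraction_Lp (MCn _) le12 (fb k).1).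
have [|phi hphi phid] := @diagonal_subsequence (fun j a b =>
    n2 (fun t => x a t - x b t) <= 1 * (2^-1) ^+ j).
  move=> j phi hphi.
  have [|m0 hm0] := @small_diameter (1 * (2^-1) ^+ j); first by rewrite mul1r exprn_gt0.
  (* from the index [m0] on the exponent is at least [m0]: the excess power is
     applied first and stays in the unit ball *)
  have [|psi hpsi psid] := hm0 (fun k =>
      iter (m (phi (k + m0)%N) - m0) M (f (phi (k + m0)%N))).
    move=> k; split; first exact: (contraction_Lp (MCn _) le12 (fb _).1).
    exact: (le_trans (contraction_nrm (MCn _) le12 (fb _).1) (fb _).2).
  exists (fun k => psi k + m0)%N; first by move=> a b ab; rewrite ltn_add2r hpsi.
  have big k : (m0 <= m (phi (psi k + m0)))%N.
    apply: leq_trans (hm _); apply: leq_trans (increasing_le hphi _).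
    exact: leq_addl.
  by move=> a b; have := psid a b; rewrite -!iterD !subnKC.
have half : 0 <= (2^-1 : R) < 1 by lra.
have [s s2 hs] := L2_series mu1 half (fun j => (LpB le12 (x2 _) (x2 _)).1)
  (fun j => (etrans (congr1 (fun r => r <= _) (nrmBC mu 2 (x (phi j.+1)) _)) (phid j))).
have [g2 _] := LpD le12 s2 (x2 (phi 0)).
exists phi, (fun t => s t + x (phi 0) t); split=> // e e0.
have [||N hN] := @expr_small 2^-1 (e / 2) => //; first exact: divr_gt0.
exists N => k Nk; rewrite nrmBC.
have -> : (fun t => s t + x (phi 0) t - x (phi k) t) =
    (fun t => s t - \sum_(i < k) (x (phi i.+1) t - x (phi i) t)).
  apply/funext => t; rewrite -(big_mkord xpredT (fun i => x (phi i.+1) t - x (phi i) t)).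
  by rewrite telescope_sumr//; ring.
apply: le_trans (hs k) _; rewrite mul1r.
have -> : 1 - 2^-1 = 2^-1 :> R by lra.
rewrite invrK -ler_pdivlMr//; apply: le_trans hN.
by apply: ler_wiXn2l => //; lra.
Qed.

End asymptotic_compactness.

(** * Indicators in L^2 *)

Section indicators.
Context d (T : measurableType d) (R : realType).
Variable mu : probability T R.
Implicit Types (A B : set T) (f g : T -> R).

Let mu1 : mu setT = 1%E. Proof. exact: probability_setT. Qed.
Let le12 : 1 <= 2 :> R. Proof. by rewrite ler1n. Qed.

Definition pr A : R := fine (mu A).

Lemma prE A : measurable A -> (pr A)%:E = mu A.
Proof. by move=> mA; rewrite fineK//; exact: fin_num_measure. Qed.

Lemma pr_ge0 A : 0 <= pr A.
Proof. exact: fine_ge0. Qed.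

Lemma pr_le A B : measurable A -> measurable B -> A `<=` B -> pr A <= pr B.
Proof. by move=> mA mB AB; rewrite -lee_fin !prE// le_measure ?inE. Qed.

Lemma prD A B : measurable A -> measurable B -> pr A = pr (A `&` B) + pr (A `\` B).
Proof.
move=> mA mB; apply: EFin_inj; rewrite EFinD !prE//; last 2 first.
  exact: measurableD.
  exact: measurableI.
by rewrite addeC [LHS](@measureDI _ _ _ mu _ _ mA mB).
Qed.

Lemma Lp_indic p A : 1 <= p -> measurable A -> Lp mu p \1_A.
Proof.
move=> p1 mA; apply: (Lp_bounded mu1 (c := 1) p1 _ _).1.
  exact: (measurable_indic (D := setT) mA).
by apply: aeW => x; rewrite indicE; case: (x \in A); rewrite /= ?normr1 ?normr0.
Qed.

Lemma ip_indic A B : measurable A -> measurable B ->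
  ip mu \1_A \1_B = pr (A `&` B).
Proof.
move=> mA mB; rewrite /ip /pr /Rintegral; congr fine.
rewrite -[in RHS](setIT (A `&` B)) -integral_indic//; last exact: measurableI.
by apply: eq_integral => x _; rewrite indicI.
Qed.

Lemma nrm_indic A : measurable A -> nrm mu 2 \1_A ^+ 2 = pr A.
Proof.
by move=> mA; rewrite nrm2_ip ?ip_indic ?setIid//; exact: Lp_indic.
Qed.

Lemma nrm2_lin c f g : Lp mu 2 f -> Lp mu 2 g ->
  nrm mu 2 (fun x => c * f x + g x) ^+ 2 =
  c ^+ 2 * nrm mu 2 f ^+ 2 + 2 * c * ip mu f g + nrm mu 2 g ^+ 2.
Proof.
move=> f2 g2; have fg := (LpD le12 (LpZ c le12 f2).1 g2).1.
have e k : Lp mu 2 k -> ip mu k (fun x => c * f x + g x) = c * ip mu f k + ip mu g k.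
  by move=> k2; rewrite ipC ip_lin.
by rewrite nrm2_ip// ip_lin// !e// !nrm2_ip// (ipC _ g f); ring.
Qed.

Lemma nrm2_sub f g : Lp mu 2 f -> Lp mu 2 g ->
  nrm mu 2 (fun x => f x - g x) ^+ 2 =
  nrm mu 2 f ^+ 2 - 2 * ip mu f g + nrm mu 2 g ^+ 2.
Proof.
move=> f2 g2; have := nrm2_lin (-1) g2 f2.
rewrite (_ : (fun x => -1 * g x + f x) = (fun x => f x - g x)); last first.
  by apply/funext => x; rewrite mulN1r addrC.
by move=> ->; rewrite (ipC _ g f); ring.
Qed.

Lemma pr0_ae A : measurable A -> pr A = 0 <-> {ae mu, forall x, ~ A x}.
Proof.
move=> mA; split=> [A0|[B [mB B0 AB]]].
  exists A; split=> // [|x /=]; first by rewrite -prE// A0.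
  exact: contrapT.
rewrite /pr (_ : mu A = 0%E)//; apply: (measure_negligible mA).
by exists B; split=> // x Ax; apply: AB => /=; apply.
Qed.

Lemma ip_ae f f' g g' : Lp mu 2 f -> Lp mu 2 g -> measurable_fun setT f' ->
  measurable_fun setT g' ->
  f = f' %[ae mu] -> g = g' %[ae mu] -> ip mu f g = ip mu f' g'.
Proof.
move=> f2 g2 mf' mg' ff gg; rewrite /ip /Rintegral; congr fine.
apply: ae_eq_integral => //.
- by apply/measurable_EFinP/measurable_funM; [exact: f2.1|exact: g2.1].
- exact/measurable_EFinP/measurable_funM.
- by apply: filterS2 ff gg => x /(_ I) -> /(_ I) ->.
Qed.

End indicators.

(** * Functions with an infinite past *)

(** A vector on which a Hilbert space contraction [Q] is isometric satisfies
    [Q* Q g = g]: otherwise [f + t g] would violate [||Q h|| <= ||h||] for some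
    [t]. *)
Lemma contraction_ip d (T : measurableType d) (R : realType)
    (mu : probability T R) (Q : (T -> R) -> (T -> R)) (f g : T -> R) :
  Lp_contraction mu Q -> Lp mu 2 f -> Lp mu 2 g ->
  nrm mu 2 g <= nrm mu 2 (Q g) -> ip mu (Q f) (Q g) = ip mu f g.
Proof.
move=> QC f2 g2 gQ; have mu1 : mu setT = 1%E by exact: probability_setT.
have le12 : 1 <= 2 :> R by rewrite ler1n.
have [Qf2 Qg2] := (contraction_Lp QC le12 f2, contraction_Lp QC le12 g2).
have ng : nrm mu 2 (Q g) = nrm mu 2 g.
  by apply/eqP; rewrite eq_le gQ contraction_nrm.
set a := ip mu (Q f) (Q g); set b := ip mu f g.
have key t : 2 * t * (a - b) <= nrm mu 2 f ^+ 2 - nrm mu 2 (Q f) ^+ 2.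
  have h2 := (LpD le12 (LpZ t le12 g2).1 f2).1.
  have Qh2 := (LpD le12 (LpZ t le12 Qg2).1 Qf2).1.
  have [f1 _] := Lp_sub1 mu1 le12 f2; have [g1 _] := Lp_sub1 mu1 le12 g2.
  have : nrm mu 2 (fun x => t * Q g x + Q f x) <= nrm mu 2 (fun x => t * g x + f x).
    have [|_ ->] := nrm_ae (ltr0n R 2) (contraction_Lp QC le12 h2) Qh2.1.
      exact: contraction_lin.
    exact: contraction_nrm.
  rewrite -(@ler_pXn2r _ 2) ?nnegrE ?nrm_ge0// !nrm2_lin// ng.
  by rewrite (ipC _ (Q g)) (ipC _ g) -/a -/b; lra.
have [/eqP|ab] := eqVneq (a - b) 0; first by rewrite subr_eq0 => /eqP.
set c := nrm mu 2 f ^+ 2 - _ in key.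
have := key ((`|c| + 1) / (2 * (a - b))).
have -> : 2 * ((`|c| + 1) / (2 * (a - b))) * (a - b) = `|c| + 1 by field.
by rewrite leNgt (le_lt_trans (ler_norm c))// ltrDl.
Qed.

Section persistent.
Context d (T : measurableType d) (R : realType).
Variables (mu : probability T R) (P : R.-pker T ~> T).
Hypothesis hbi : bistochastic mu P.
Hypothesis hqc : quasi_compact mu 2%:E (markov_op P).
Implicit Types (f g : T -> R) (A : set T) (u v : nat -> T -> R).
Local Notation M := (kmean P).
Local Notation L2 := (Lp mu 2).
Local Notation n2 := (nrm mu 2).

Let mu1 : mu setT = 1%E. Proof. exact: probability_setT. Qed.
Let le12 : 1 <= 2 :> R. Proof. by rewrite ler1n. Qed.
Let lt02 : 0 < 2 :> R. Proof. by rewrite ltr0n. Qed.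
Let MC : Lp_contraction mu M. Proof. exact: kmean_contraction. Qed.
Let MCn n : Lp_contraction mu (iter n M). Proof. exact: contraction_iter. Qed.
Let L21 f : L2 f -> Lp mu 1 f. Proof. by move=> f2; have [] := Lp_sub1 mu1 le12 f2. Qed.

Definition backward_orbit u := (exists B, forall j, L2 (u j) /\ n2 (u j) <= B) /\
  forall j, M (u j.+1) = u j %[ae mu].

(** Up to null functions these are the combinations of the indicators of the
    cycle constructed below, that is, the real part of the span of the unimodular
    eigenfunctions. *)
Definition persistent f := exists2 u, backward_orbit u & u 0 = f.

Lemma persistent_L2 f : persistent f -> L2 f.
Proof. by move=> [u [[B uB] _] <-]; exact: (uB 0).1. Qed.

Lemma orbit_L2 u j : backward_orbit u -> L2 (u j).
Proof. by move=> [[B uB] _]; exact: (uB j).1. Qed.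

Lemma orbit_shift u i : backward_orbit u -> backward_orbit (fun j => u (j + i)%N).
Proof.
move=> [[B uB] Mu]; split; first by exists B => j; exact: uB.
by move=> j; rewrite addSn; exact: Mu.
Qed.

Lemma orbit_persistent u j : backward_orbit u -> persistent (u j).
Proof. by move=> /(@orbit_shift _ j) h; exists (fun k => u (k + j)%N). Qed.

Lemma orbit_iter u n j : backward_orbit u -> iter n M (u (n + j)%N) = u j %[ae mu].
Proof.
move=> uo; elim: n j => [|n IH] j; first exact: aeW.
rewrite addSnnS iterS.
have h := contraction_ae MC (L21 (contraction_Lp (MCn n) le12 (orbit_L2 _ uo)))
  (orbit_L2 _ uo).1 (IH j.+1).
by apply: filterS2 h (uo.2 j) => x /(_ I) -> /(_ I) ->.
Qed.

Lemma persistent_ae f g : persistent f -> measurable_fun setT g ->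
  f = g %[ae mu] -> persistent g.
Proof.
move=> pf mg fg; have f2 := persistent_L2 pf; case: pf => u [[B uB] Mu] uf.
have [g2 ng] := nrm_ae lt02 f2 mg fg.
exists (fun j => if j is k.+1 then u k.+1 else g) => //; split.
  by exists B => -[|j] //; rewrite ng -uf; split=> //; exact: (uB 0).2.
by move=> [|j] //; apply: filterS2 fg (Mu 0) => x /(_ I) <- /(_ I) -> _; rewrite uf.
Qed.

(** Two members [u a] and [u b] of the orbit, [a < b], are close by compactness;
    [M^b] maps them to [M^(b-a) f] and to [f]. *)
Lemma persistent_recurrent f e : persistent f -> 0 < e ->
  exists2 n, (0 < n)%N & n2 (fun x => iter n M f x - f x) <= e.
Proof.
move=> [u uo <-] e0; have [[B uB] Mu] := uo.
pose B' := `|B| + 1; have B'0 : 0 < B' by rewrite ltr_wpDl.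
have uB' j : n2 (u j) <= B'.
  by apply: le_trans (uB j).2 _; rewrite /B' (le_trans (ler_norm _))// lerDl.
pose y k x := B'^-1 * u (k + k)%N x.
have yL2 k := LpZ B'^-1 le12 (uB (k + k)%N).1.
have yb k : in_ball mu (y k).
  split; first exact: (yL2 k).1.
  rewrite (yL2 k).2 gtr0_norm ?invr_gt0// ler_pdivrMl// mulr1; exact: uB'.
(* [M^k u_(2k) = u_k]: the high powers in the compactness statement cost nothing *)
have [phi [g [hphi g2 cv]]] := asymptotic_compactness hbi hqc yb (fun k => leqnn k).
have yu k : iter k M (y k) = (fun x => B'^-1 * u k x) %[ae mu].
  apply: filterS2 (contractionZ (MCn k) B'^-1 (L21 (uB (k + k)%N).1))
    (orbit_iter k k uo) => x /(_ I) e1 /(_ I) e2 _.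
  by rewrite /y e1 e2.
have e20 : 0 < e / 2 / B' by rewrite !divr_gt0.
have [N hN] := cv _ e20.
have close k : (N <= k)%N -> n2 (fun x => B'^-1 * u (phi k) x - g x) <= e / 2 / B'.
  move=> /hN; apply: le_trans; have [yL _] := LpZ B'^-1 le12 (uB (phi k)).1.
  have ykL := contraction_Lp (MCn (phi k)) le12 (yb (phi k)).1.
  have [|_ ->//] := nrm_ae lt02 (LpB le12 ykL g2).1 (LpB le12 yL g2).1.1.
  by apply: filterS (yu (phi k)) => x /[apply] ->.
set a := phi N; set b := phi N.+1; have ab : (a < b)%N by exact: hphi.
exists (b - a)%N; first by rewrite subn_gt0.
have [aL bL] := ((uB a).1, (uB b).1).
have uab : n2 (fun x => u a x - u b x) <= e.
  have [aZ _] := LpZ B'^-1 le12 aL; have [bZ _] := LpZ B'^-1 le12 bL.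
  have := nrm_triangle le12 aZ g2 bZ.
  rewrite [in X in _ + X]nrmBC => /le_trans.
  move=> /(_ _ (lerD (close N (leqnn N)) (close N.+1 (leqnSn N)))).
  rewrite -mulrDl -splitr.
  have -> : (fun x => B'^-1 * u a x - B'^-1 * u b x) =
            (fun x => B'^-1 * (u a x - u b x)).
    by apply/funext => x; rewrite mulrBr.
  have [_ ->] := LpZ B'^-1 le12 (LpB le12 aL bL).1.
  rewrite gtr0_norm ?invr_gt0// mulrC ler_pM2r ?invr_gt0//.
apply: le_trans uab.
apply: (@le_trans _ _ (n2 (fun x => iter b M (u a) x - iter b M (u b) x))); last first.
  exact: (contraction_nrmB mu1 (MCn b) le12 aL bL).
have [Mb Ma] := (contraction_Lp (MCn b) le12 bL, contraction_Lp (MCn b) le12 aL).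
have Mn0 := contraction_Lp (MCn (b - a)) le12 (uB 0).1.
have [|_ ->//] := nrm_ae lt02 (LpB le12 Ma Mb).1 (LpB le12 Mn0 (uB 0).1).1.1.
have ea : iter b M (u a) = iter (b - a) M (u 0) %[ae mu].
  have -> : iter b M (u a) = iter (b - a) M (iter a M (u a)).
    by rewrite -iterD subnK// ltnW.
  apply: (contraction_ae (MCn (b - a)) _ (uB 0).1.1).
    exact/L21/(contraction_Lp (MCn a)).
  by have := orbit_iter a 0 uo; rewrite addn0.
have eb : iter b M (u b) = u 0 %[ae mu].
  by have := orbit_iter b 0 uo; rewrite addn0.
by apply: filterS2 ea eb => x /(_ I) -> /(_ I) ->.
Qed.

(** Recurrence leaves no room for a loss of norm. *)
Lemma persistent_isometry f : persistent f -> n2 f <= n2 (M f).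
Proof.
move=> pf; have f2 := persistent_L2 pf; rewrite leNgt; apply/negP => fM.
have e0 : 0 < (n2 f - n2 (M f)) / 2 by rewrite divr_gt0// subr_gt0.
have [[//|n] _ nf] := persistent_recurrent pf e0.
have Mf := contraction_Lp MC le12 f2.
have Mn := contraction_Lp (MCn n.+1) le12 f2.
have := nrm_leB le12 f2 Mn; rewrite nrmBC => h.
have h' : n2 (iter n.+1 M f) <= n2 (M f).
  by rewrite iterSr; exact: (contraction_nrm (MCn n) le12 Mf).
by have := le_trans h (lerD h' nf); lra.
Qed.

Lemma orbit_nrm u j : backward_orbit u -> n2 (u j) <= n2 (u 0).
Proof.
move=> uo; elim: j => // j; apply: le_trans.
apply: le_trans (persistent_isometry (orbit_persistent j.+1 uo)) _.
have [uL uL'] := (orbit_L2 j uo, orbit_L2 j.+1 uo).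
have [|_ ->//] := nrm_ae lt02 uL (contraction_Lp MC le12 uL').1.
by apply: filterS (uo.2 j) => x /[apply] ->.
Qed.

Lemma persistent_lin c f g : persistent f -> persistent g ->
  persistent (fun x => c * f x + g x).
Proof.
move=> [u [[B uB] Mu] <-] [v [[C vC] Mv] <-].
exists (fun j x => c * u j x + v j x) => //; split.
  exists (`|c| * B + C) => j.
  have [cu ncu] := LpZ c le12 (uB j).1; have [h1 h2] := LpD le12 cu (vC j).1.
  split=> //; apply: le_trans h2 (lerD _ (vC j).2); rewrite ncu.
  by rewrite ler_wpM2l//; exact: (uB j).2.
move=> j; have := contraction_lin MC c (L21 (uB j.+1).1) (L21 (vC j.+1).1).
by apply: filterS3 (Mu j) (Mv j) => x /(_ I) e1 /(_ I) e2 /(_ I) -> _; rewrite e1 e2.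
Qed.

Lemma persistent_cst c : persistent (fun=> c).
Proof.
exists (fun _ _ => c) => //; split; last by move=> j; rewrite kmean_cst; exact: aeW.
by exists `|c| => _; have [h ->] := Lp_cst mu1 c le12.
Qed.

Lemma persistentN f : persistent f -> persistent (fun x => - f x).
Proof.
move=> pf; have := persistent_lin (-1) pf (persistent_cst 0).
by under eq_fun do rewrite mulN1r addr0.
Qed.

Lemma persistent_kmean f : persistent f -> persistent (M f).
Proof.
move=> [u [[B uB] Mu] uf]; exists (fun j => if j is k.+1 then u k else M f) => //.
have f2 : L2 f by rewrite -uf; exact: (uB 0).1.
split; last by move=> [|j] //=; rewrite uf; exact: aeW.
exists B => -[|j]//; split; first exact: contraction_Lp.
by apply: le_trans (contraction_nrm MC le12 f2) _; rewrite -uf; exact: (uB 0).2.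
Qed.

Lemma persistent_ip f g : L2 f -> persistent g -> ip mu (M f) (M g) = ip mu f g.
Proof.
move=> f2 pg; apply: contraction_ip => //; first exact: persistent_L2.
exact: persistent_isometry.
Qed.

(** The superlevel sets of the members of an orbit form an orbit, since [M] acts on
    them as composition with a point map. *)
Lemma persistent_level f t : persistent f -> persistent \1_[set x | t < f x].
Proof.
move=> [u uo <-]; exists (fun j => \1_[set x | t < u j x]) => //; split.
  exists 1 => j.
  have m : measurable [set x | t < u j x] by apply: measurable_level (orbit_L2 j uo).1.
  have [|h1 h2] := @Lp_bounded _ _ _ _ mu1 2 1 _ le12 (measurable_indic (D := setT) m).
    by apply: aeW => x; rewrite indicE; case: (_ \in _); rewrite /= ?normr1 ?normr0.
  by rewrite normr1 in h2.
move=> j; have pu := orbit_persistent j.+1 uo.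
have := kmean_level hbi t (persistent_L2 pu) (persistent_isometry pu).
apply: filterS2 (uo.2 j) => x /(_ I) e /(_ I) -> _.
rewrite !indicE; suff -> : (x \in [set y | t < M (u j.+1) y]) = (x \in [set y | t < u j y]) by [].
by apply/idP/idP; rewrite !inE /= e.
Qed.

Definition persistent_set A := measurable A /\ persistent \1_A.

(** For a persistent [A] the function [M 1_A] is almost everywhere equal to 0 or 1;
    the threshold [1/2] picks a representative of the set where it is 1. *)
Definition image_set A : set T := [set x | 2^-1 < M \1_A x].

Lemma persistent_setT : persistent_set setT.
Proof. by split=> //; rewrite indicT; exact: persistent_cst. Qed.

Let half : 0 < 2^-1 :> R. Proof. by rewrite invr_gt0. Qed.

Lemma persistent_setI A C : persistent_set A -> persistent_set C ->
  persistent_set (A `&` C).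
Proof.
move=> [mA pA] [mC pC]; split; first exact: measurableI.
(* [1_A + 1_C] takes the value 2 on the intersection and at most 1 elsewhere *)
have := persistent_level (1 + 2^-1) (persistent_lin 1 pA pC).
suff -> : [set x | 1 + 2^-1 < 1 * \1_A x + \1_C x :> R] = A `&` C by [].
apply/seteqP; split=> x /=.
  by rewrite !indicE; have [/set_mem Ax|_] := boolP (x \in A);
    have [/set_mem Cx|_] := boolP (x \in C) => //=; lra.
by move=> [Ax Cx]; rewrite !indicE !mem_set//=; lra.
Qed.

Lemma persistent_setD A C : persistent_set A -> persistent_set C ->
  persistent_set (A `\` C).
Proof.
move=> [mA pA] [mC pC]; split; first exact: measurableD.
have := persistent_level (2^-1) (persistent_lin (-1) pC pA).
suff -> : [set x | 2^-1 < -1 * \1_C x + \1_A x :> R] = A `\` C by [].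
apply/seteqP; split=> x /=.
  by rewrite !indicE; have [/set_mem Ax|_] := boolP (x \in A);
    have [/set_mem Cx|/negP Cx] := boolP (x \in C) => //=; rewrite ?inE in Cx *; try lra.
by move=> [Ax Cx]; rewrite !indicE (mem_set Ax) (memNset Cx)/=; lra.
Qed.

Lemma kmean_image_set A : persistent_set A ->
  M \1_A = \1_(image_set A) %[ae mu].
Proof.
move=> [mA pA].
have := kmean_level hbi 2^-1 (persistent_L2 pA) (persistent_isometry pA).
suff -> : [set x | 2^-1 < \1_A x :> R] = A by [].
apply/seteqP; split=> x /=.
  by rewrite indicE; have [/set_mem//|_] := boolP (x \in A); rewrite /=; lra.
by move=> Ax; rewrite indicE mem_set//=; lra.
Qed.

Lemma persistent_image_set A : persistent_set A -> persistent_set (image_set A).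
Proof.
move=> pA; have pM := persistent_kmean pA.2.
have m : measurable (image_set A) by apply: measurable_level (persistent_L2 pM).1.
split=> //; apply: persistent_ae pM _ (kmean_image_set pA).
exact: (measurable_indic (D := setT) m).
Qed.

Lemma pr_image_setI A C : persistent_set A -> persistent_set C ->
  pr mu (image_set A `&` image_set C) = pr mu (A `&` C).
Proof.
move=> pA pC; have [mA' mC'] := ((persistent_image_set pA).1, (persistent_image_set pC).1).
rewrite -(ip_indic mu mA' mC') -(ip_indic mu pA.1 pC.1).
have A2 := persistent_L2 pA.2; rewrite -(persistent_ip A2 pC.2).
apply/esym/ip_ae; try exact: kmean_image_set.
- exact: contraction_Lp.
- exact: (contraction_Lp MC le12 (persistent_L2 pC.2)).
- exact: (measurable_indic (D := setT) mA').
- exact: (measurable_indic (D := setT) mC').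
Qed.

End persistent.

(** * The cycle of atoms *)

Section cyclic_partition.
Context d (T : measurableType d) (R : realType).
Variables (mu : probability T R) (P : R.-pker T ~> T).
Hypothesis hbi : bistochastic mu P.
Hypothesis hqc : quasi_compact mu 2%:E (markov_op P).
Implicit Types (f g : T -> R) (A B : set T).
Local Notation M := (kmean P).
Local Notation L2 := (Lp mu 2).
Local Notation n2 := (nrm mu 2).
Local Notation pr := (pr mu).
Local Notation pset := (persistent_set mu P).

Let mu1 : mu setT = 1%E. Proof. exact: probability_setT. Qed.
Let le11 : 1 <= 1 :> R. Proof. exact: lexx. Qed.
Let le12 : 1 <= 2 :> R. Proof. by rewrite ler1n. Qed.
Let lt02 : 0 < 2 :> R. Proof. by rewrite ltr0n. Qed.
Let MC : Lp_contraction mu M. Proof. exact: kmean_contraction. Qed.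
Let MCn n : Lp_contraction mu (iter n M). Proof. exact: contraction_iter. Qed.

Lemma ipZ c f g : L2 f -> L2 g -> ip mu (fun x => c * f x) g = c * ip mu f g.
Proof.
move=> f2 g2; rewrite /ip -RintegralZl//; last exact: (L2_mul f2 g2).1.
by apply: eq_Rintegral => x _; rewrite mulrA.
Qed.

Lemma ip_sum n (F : nat -> T -> R) g : (forall i, L2 (F i)) -> L2 g ->
  ip mu (fun x => \sum_(i < n) F i x) g = \sum_(i < n) ip mu (F i) g.
Proof.
move=> F2 g2; elim: n => [|n IH].
  have -> : (fun x => \sum_(i < 0) F i x) = (fun x => 0 * F 0 x).
    by apply/funext => x; rewrite big_ord0 mul0r.
  by rewrite ipZ// mul0r big_ord0.
rewrite big_ord_recr/= -IH addrC -(mul1r (ip mu (F n) g)) -ip_lin//.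
  by apply: eq_Rintegral => x _; rewrite big_ord_recr/= mul1r addrC.
exact: (Lp_sum n le12 F2).1.
Qed.

Lemma indic_ae A B : measurable A -> measurable B -> pr (A `\` B) = 0 ->
  pr (B `\` A) = 0 -> (\1_A : T -> R) = \1_B %[ae mu].
Proof.
move=> mA mB /pr0_ae AB /pr0_ae BA.
apply: filterS2 (AB (measurableD mA mB)) (BA (measurableD mB mA)) => x ab ba _.
rewrite !indicE; suff -> : (x \in A) = (x \in B) by [].
apply/idP/idP; rewrite !inE => h; apply: contrapT => h'; [exact: ab|exact: ba].
Qed.

(** The normalised indicators [e_k] of persistent sets of vanishing measure would
    become orthogonal to each other. But [e_k = M^k u_k] with [u_k] in the unit
    ball, so that a subsequence converges. *)
Lemma persistent_set_lower_bound : exists2 m, 0 < m &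
  forall A, pset A -> 0 < pr A -> m <= pr A.
Proof.
apply: contrapT => H.
have /choice[A hA] : forall k, exists A, [/\ pset A, 0 < pr A & pr A < k.+1%:R^-1].
  move=> k; apply: contrapT => h; apply: H; exists k.+1%:R^-1 => // A pA A0.
  by rewrite leNgt; apply/negP => Ak; apply: h; exists A.
pose c k := Num.sqrt (pr (A k)).
have c0 k : 0 < c k by have [_ ? _] := hA k; rewrite sqrtr_gt0.
have c2 k : c k ^+ 2 = pr (A k) by rewrite sqr_sqrtr// pr_ge0.
pose e k x := (c k)^-1 * \1_(A k) x.
have mA k : measurable (A k) by have [[]] := hA k.
have A2 k : L2 \1_(A k) by exact: Lp_indic.
have e2 k : L2 (e k) by exact: (LpZ _ le12 (A2 k)).1.
have ip_e a b : ip mu (e a) (e b) = (c a)^-1 * (c b)^-1 * pr (A a `&` A b).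
  by rewrite ipZ// ipC ipZ// ipC ip_indic// mulrA.
have ne k : n2 (e k) ^+ 2 = 1.
  rewrite nrm2_ip// ip_e setIid -c2; have := c0 k; set z := c k => z0.
  by field; rewrite gt_eqF.
have pe k : persistent mu P (e k).
  have := persistent_lin hbi (c k)^-1 (let: And3 p _ _ := hA k in p.2)
    (persistent_cst mu P 0).
  by under eq_fun do rewrite addr0.
have /choice[u hu] : forall k, exists u, backward_orbit mu P u /\ u 0 = e k.
  by move=> k; have [v] := pe k; exists v.
have ub k : in_ball mu (u k k).
  have [uo u0] := hu k; split; first exact: (orbit_L2 _ uo).
  apply: le_trans (orbit_nrm hbi hqc k uo) _; rewrite u0.
  by rewrite -(@ler_pXn2r _ 2) ?nnegrE ?nrm_ge0// ne expr1n.
have [phi [g [hphi g2 cv]]] := asymptotic_compactness hbi hqc ub (fun k => leqnn k).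
have [N hN] := cv 4^-1 (ltac:(by rewrite invr_gt0)).
have close k : (N <= k)%N -> n2 (fun x => e (phi k) x - g x) <= 4^-1.
  move=> /hN; apply: le_trans.
  have [uo u0] := hu (phi k).
  have uL := contraction_Lp (MCn (phi k)) le12 (ub (phi k)).1.
  have [|_ ->//] := nrm_ae lt02 (LpB le12 uL g2).1 (LpB le12 (e2 (phi k)) g2).1.1.
  have := orbit_iter hbi (phi k) 0 uo; rewrite addn0 u0.
  by apply: filterS => x /[apply] ->.
set a := phi N.
have [K hK] : exists K, K.+1%:R^-1 <= pr (A a) / 4.
  have p0 : 0 < pr (A a) / 4 by rewrite -c2 divr_gt0// exprn_gt0.
  exists (Num.trunc (pr (A a) / 4)^-1); rewrite invf_ple ?posrE//.
  have p0' : 0 <= (pr (A a) / 4)^-1 by rewrite invr_ge0 ltW.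
  by apply: ltW; have /andP[] := truncn_itv p0'.
pose b := phi (maxn N K).
have bK : pr (A b) < pr (A a) / 4.
  have [_ _ /lt_le_trans] := hA b; apply; apply: le_trans hK.
  rewrite lef_pV2 ?posrE// ler_nat ltnS (leq_trans (leq_maxr N K))//.
  exact: increasing_le.
have near_ab : n2 (fun x => e a x - e b x) <= 2^-1.
  have := nrm_triangle le12 (e2 a) g2 (e2 b).
  move=> /le_trans; apply.
  rewrite [X in _ + X]nrmBC (le_trans (lerD (close N (leqnn N)) (close _ (leq_maxl N K))))//.
  by lra.
have : n2 (fun x => e a x - e b x) ^+ 2 <= 2^-1 ^+ 2.
  by rewrite ler_pXn2r ?nnegrE ?nrm_ge0.
rewrite nrm2_sub// !ne ip_e.
have : (c a)^-1 * (c b)^-1 * pr (A a `&` A b) <= 2^-1.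
  apply: (@le_trans _ _ ((c a)^-1 * (c b)^-1 * pr (A b))).
    rewrite ler_wpM2l ?mulr_ge0 ?invr_ge0 ?(ltW (c0 _))//.
    by apply: pr_le => //; exact: measurableI.
  rewrite -c2; have -> : (c a)^-1 * (c b)^-1 * c b ^+ 2 = (c a)^-1 * c b.
    by have := c0 b; set z := c b => z0; field; rewrite !gt_eqF ?c0.
  rewrite ler_pdivrMl// -(@ler_pXn2r _ 2) ?nnegrE ?mulr_ge0 ?(ltW (c0 _))//.
  by rewrite exprMn !c2; move: bK; lra.
by lra.
Qed.

(** A persistent set smaller than twice the infimum of the possible measures cannot
    be split into two persistent sets of positive measure: it is an atom. *)
Lemma persistent_small_set : exists m A, [/\ 0 < m, pset A, 0 < pr A, pr A < m + m &
  forall B, pset B -> 0 < pr B -> m <= pr B].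
Proof.
have [m0 m00 hm0] := persistent_set_lower_bound.
pose S := [set pr A | A in [set A | pset A /\ 0 < pr A]].
have prT : pr setT = 1 by rewrite /pr mu1.
have S0 : S !=set0.
  exists (pr setT), setT => //; split; last by rewrite prT.
  exact: (persistent_setT mu P).
have lbS : lbound S m0 by move=> _ [A [pA A0] <-]; exact: hm0.
have m1 : m0 <= inf S by exact: lb_le_inf.
have iS : has_inf S by split=> //; exists m0.
have infS0 : 0 < inf S by exact: lt_le_trans m1.
have [_ [A [pA A0] <-] Am] := inf_adherent infS0 iS.
exists (inf S), A; split=> // B pB B0; apply: ge_inf; first by exists m0.
by exists B.
Qed.

(** The classes are indexed by all the natural numbers, periodically modulo null
    sets: [M] is then the shift of the index, without modular arithmetic. *)
Record cyclic_partition (N : nat) (A : nat -> set T) : Prop := CyclicPartition {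
  cyclic_gt0 : (0 < N)%N;
  cyclic_measurable : forall j, measurable (A j);
  cyclic_step : forall j, M \1_(A j) = \1_(A j.+1) %[ae mu];
  cyclic_period : forall j, (\1_(A (j + N)%N) : T -> R) = \1_(A j) %[ae mu];
  cyclic_disjoint : forall i j, (i < N)%N -> (j < N)%N -> i <> j ->
    pr (A i `&` A j) = 0;
  cyclic_pr : forall j, pr (A j) = N%:R^-1;
  cyclic_cover : {ae mu, forall x, \sum_(j < N) \1_(A j) x = 1 :> R} }.

Hypothesis herg : ergodic mu P.

Lemma ergodic_real f c : measurable_fun setT f -> (forall x, `|f x| <= c) ->
  M f = f %[ae mu] -> exists c', f = cst c' %[ae mu].
Proof.
move=> mf fc Mf; have [||c' hc'] := herg (f := of_real f).
- split; first by split=> //; exact: measurable_cst.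
  rewrite /cnorm unlock; case: ifPn => _; last exact: lt0y.
  apply: (@le_lt_trans _ _ c%:E); last exact: ltry.
  apply/ess_supP; apply: aeW => x.
  rewrite -[leLHS]/(`|cabs (of_real f x)|%:E).
  by rewrite lee_fin (ger0_norm (cabs_ge0 _)) cabs_real.
- have -> : markov_op P (of_real f) = of_real (M f).
    exact: (markov_iter_of_real _ 1 f).
  by apply: filterS Mf => x /[apply]; rewrite /of_real => ->.
- exists (complex.Re c'); apply: filterS hc' => x /[apply].
  by rewrite /of_real /cst => <-.
Qed.

(** Following an atom of the persistent sets until it first meets itself gives
    the cycle. The sum of the indicators of the cycle is invariant, hence constant
    by ergodicity, and equal to 1 on the first atom. *)
Lemma exists_cyclic_partition : exists N (A : nat -> set T), cyclic_partition N A /\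
  forall g, persistent mu P g -> (forall j, (j < N)%N -> ip mu \1_(A j) g = 0) ->
    g = cst 0 %[ae mu].
Proof.
have [m [A0 [m0 pA0 A00 A0m hm]]] := persistent_small_set.
pose A j := iter j (image_set P) A0.
have pA j : pset (A j).
  by elim: j => //= j; exact: (persistent_image_set hbi hqc).
have mA j : measurable (A j) by exact: (pA j).1.
have shift i j k : pr (A (k + i)%N `&` A (k + j)%N) = pr (A i `&` A j).
  by elim: k => // k IH; rewrite !addSn (pr_image_setI hbi hqc (pA _) (pA _)).
have prA j : pr (A j) = pr A0.
  by rewrite -[A j]setIid -(addn0 j) shift setIid.
(* each [A j] is an atom, having the measure of [A0] *)
have dich j B : pset B -> pr (A j `&` B) = 0 \/ pr (A j `\` B) = 0.
  move=> pB; have h1 := persistent_setI hbi hqc (pA j) pB.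
  have h2 := persistent_setD hbi hqc (pA j) pB.
  have := prD mu (mA j) pB.1; rewrite prA.
  have [k1|] := ltP 0 (pr (A j `&` B)); last first.
    by move=> k1 _; left; apply/eqP; rewrite eq_le k1 pr_ge0.
  have [k2|] := ltP 0 (pr (A j `\` B)); last first.
    by move=> k2 _; right; apply/eqP; rewrite eq_le k2 pr_ge0.
  by have := hm _ h1 k1; have := hm _ h2 k2; move: A0m; lra.
have step j : M \1_(A j) = \1_(A j.+1) %[ae mu].
  exact: (kmean_image_set hbi hqc).
have A2 j : L2 \1_(A j) by exact: Lp_indic.
have A1 j : Lp mu 1 \1_(A j) by exact: Lp_indic.
have MnA n : iter n M \1_A0 = \1_(A n) %[ae mu].
  elim: n => [|n IH]; first exact: aeW.
  have h := contraction_ae MC (contraction_Lp (MCn n) le11 (A1 0)) (A1 n).1 IH.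
  by apply: filterS2 h (step n) => x /(_ I) /= -> /(_ I).
(* were [A n] disjoint from [A0], the squared distance of their indicators would be
   [2 pr A0], against recurrence *)
have [n0 n00 meet] : exists2 n, (0 < n)%N & 0 < pr (A n `&` A0).
  have e0 : 0 < Num.sqrt (pr A0) by rewrite sqrtr_gt0.
  have [n n0 hn] := persistent_recurrent hbi hqc pA0.2 e0; exists n => //.
  have : n2 (fun x => \1_(A n) x - \1_A0 x) ^+ 2 <= pr A0.
    rewrite -[leRHS]sqr_sqrtr ?pr_ge0// ler_pXn2r ?nnegrE ?nrm_ge0 ?sqrtr_ge0//.
    apply: le_trans hn.
    have ML := contraction_Lp (MCn n) le12 (A2 0).
    have [|_ ->//] := nrm_ae lt02 (LpB le12 ML (A2 0)).1 (LpB le12 (A2 n) (A2 0)).1.1.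
    by apply: filterS (MnA n) => x /[apply] ->.
  rewrite nrm2_sub//; last exact: (A2 0).
  rewrite !nrm_indic// ?ip_indic//; try exact: (mA 0).
  by rewrite prA; move: A00; lra.
have exN : exists n, (0 < n)%N && (0 < pr (A n `&` A0)).
  by exists n0; rewrite n00.
have [N /andP[N0 Nmeet] Nmin] := ex_minnP exN.
have disj n : (0 < n)%N -> (n < N)%N -> pr (A n `&` A0) = 0.
  move=> n_gt0 nN; apply/eqP; rewrite eq_le pr_ge0 andbT leNgt; apply/negP => h.
  by have := Nmin n; rewrite n_gt0 h => /(_ isT); rewrite leqNgt nN.
have period0 : (\1_(A N) : T -> R) = \1_A0 %[ae mu].
  apply: indic_ae => //; first exact: (mA 0).
    by have [h|//] := dich N _ pA0; move: Nmeet; rewrite h ltxx.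
  have [|//] := dich 0 _ (pA N); rewrite setIC => h.
  by move: Nmeet; rewrite h ltxx.
have period j : (\1_(A (j + N)%N) : T -> R) = \1_(A j) %[ae mu].
  elim: j => // j IH; have h := contraction_ae MC (A1 (j + N)%N) (A1 j).1 IH.
  have s1 := step (j + N)%N; have s2 := step j; rewrite addSn.
  by apply: filterS3 h s1 s2 => x /(_ I) -> /(_ I) <- /(_ I) <-.
have disjoint i j : (i < N)%N -> (j < N)%N -> i <> j -> pr (A i `&` A j) = 0.
  have wl a b : (a < b)%N -> (b < N)%N -> pr (A a `&` A b) = 0.
    move=> ab bN; rewrite -{1}(addn0 a) -(subnKC (ltnW ab)) shift setIC.
    by apply: disj; rewrite ?subn_gt0// (leq_ltn_trans (leq_subr _ _)).
  move=> iN jN /eqP; rewrite neq_ltn => /orP[ij|ji]; first exact: wl.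
  by rewrite setIC; exact: wl.
pose s x : R := \sum_(j < N) \1_(A j) x.
have ms : measurable_fun setT s by have [[]] := Lp_sum N le12 A2.
have Ms : M s = s %[ae mu].
  have := contraction_sum MC N (fun=> 1) A1.
  have -> : (fun x => \sum_(i < N) 1 * \1_(A i) x) = s.
    by apply/funext => x; apply: eq_bigr => i _; rewrite mul1r.
  have steps : {ae mu, forall x, forall j, M \1_(A j) x = \1_(A j.+1) x}.
    by apply: ae_foralln => j; apply: filterS (step j) => x; exact.
  apply: filterS3 steps period0 => x hs /(_ I) p0 /(_ I) -> _.
  under eq_bigr do rewrite mul1r hs.
  have e : \1_A0 x + \sum_(i < N) \1_(A i.+1) x = s x + \1_(A N) x :> R.
    by transitivity (\sum_(i < N.+1) \1_(A i) x : R);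
      [rewrite big_ord_recl|rewrite big_ord_recr].
  by move: e; rewrite p0 addrC => /addIr.
have [c hc] : exists c, s = cst c %[ae mu].
  apply: (@ergodic_real s N%:R) => // x.
  rewrite /s (le_trans (ler_norm_sum _ _ _))//.
  apply: (@le_trans _ _ (\sum_(i < N) 1)); last by rewrite sumr_const card_ord.
  by apply: ler_sum => i _; rewrite indicE; case: (_ \in _); rewrite /= ?normr1 ?normr0.
have c1 : c = 1.
  apply: contrapT => c1; have : pr A0 = 0.
    apply/pr0_ae; first exact: (mA 0).
    have D : {ae mu, forall x, forall i, (0 < i < N)%N -> ~ (A i `&` A0) x}.
      apply: ae_foralln => i; have [/andP[i0 iN]|] := boolP (0 < i < N)%N; last first.
        by move=> _; exact: aeW.
      have /pr0_ae h := disj i i0 iN.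
      by apply: filterS (h (measurableI _ _ (mA i) (mA 0))).
    apply: filterS2 hc D => x /(_ I) sx hD Ax; apply: c1; rewrite -[LHS]sx /s.
    have -> : N = N.-1.+1 by rewrite prednK.
    rewrite big_ord_recl/= indicE mem_set// big1 ?addr0// => i _.
    rewrite indicE memNset// => h; apply: (hD (bump 0 i)); last by split.
    by rewrite /bump/= add1n -ltn_predRL ltn_ord.
  by move=> h; move: A00; rewrite h ltxx.
have cover : {ae mu, forall x, \sum_(j < N) \1_(A j) x = 1 :> R}.
  by apply: filterS hc => x /(_ I); rewrite c1.
have prN j : pr (A j) = N%:R^-1.
  have T2 : L2 \1_setT by exact: Lp_indic.
  have e : ip mu s \1_setT = ip mu \1_setT \1_setT.
    apply: ip_ae => //.
    - exact: (Lp_sum N le12 A2).1.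
    - by apply: filterS cover => x e _; rewrite [LHS]e indicT.
    - exact: aeW.
  have prT : pr setT = 1 by rewrite /pr mu1.
  move: e; rewrite (ip_sum N A2 T2) ip_indic// setIid prT.
  under eq_bigr do rewrite ip_indic// setIT prA.
  rewrite sumr_const card_ord prA => e; have NR : N%:R != 0 :> R by rewrite pnatr_eq0 -lt0n.
  by apply: (mulfI NR); rewrite divff// mulr_natl.
exists N, A; split; first by split.
(* the set where [g] is positive is persistent, so it contains or misses each class;
   it contains none, the integrals of [g] over the classes being zero *)
have le0 g : persistent mu P g -> (forall j, (j < N)%N -> ip mu \1_(A j) g = 0) ->
    {ae mu, forall x, g x <= 0}.
  move=> pg hg; have g2 := persistent_L2 pg; pose E := [set x | 0 < g x].
  have mE : measurable E by apply: measurable_level g2.1.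
  have pE : pset E by split=> //; exact: (persistent_level hbi hqc).
  have AE j : (j < N)%N -> {ae mu, forall x, ~ (A j `&` E) x}.
    move=> jN; apply/pr0_ae; first exact: measurableI.
    have [//|/pr0_ae nE] := dich j _ pE.
    have h1 : Lp mu 1 (fun x => \1_(A j) x * g x).
      by apply/Lp1_integrable; exact: (L2_mul (A2 j) g2).1.
    have gE := nE (measurableD (mA j) mE).
    have : nrm mu 1 (fun x => \1_(A j) x * g x) <= 0.
      rewrite nrm1E -(hg j jN) /ip /Rintegral le_eqVlt; apply/orP; left; apply/eqP.
      congr fine; apply: ae_eq_integral => //.
      - by apply/measurable_EFinP; apply: measurableT_comp => //; exact: h1.1.
      - by apply/measurable_EFinP; exact: h1.1.
      - apply: filterS gE => x nAE _; rewrite ger0_norm//.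
        rewrite indicE; have [/set_mem Ax|_] := boolP (x \in A j); last by rewrite mul0r.
        by rewrite mul1r ltW//; apply: contrapT => gx; apply: nAE.
    move=> /(nrm_eq0 le11 h1) h0.
    have : pr (A j) = 0.
      apply/pr0_ae => //; apply: filterS2 h0 gE => x /(_ I) h nAE Ax.
      apply: nAE; split=> // /=; rewrite /E/=.
      by move: h; rewrite indicE mem_set// mul1r /cst => ->; rewrite ltxx.
    by move=> h; move: A00; rewrite -(prA j) h ltxx.
  have AE' : {ae mu, forall x, forall j, (j < N)%N -> ~ (A j `&` E) x}.
    apply: ae_foralln => j; have [jN|_] := boolP (j < N)%N; last exact: aeW.
    by apply: filterS (AE j jN).
  apply: filterS2 cover AE' => x cx hx; rewrite leNgt; apply/negP => gx.
  have : \sum_(j < N) \1_(A j) x = 0 :> R.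
    apply: big1 => j _; rewrite indicE memNset// => Ax.
    by apply: (hx j).
  by rewrite cx => /eqP; rewrite oner_eq0.
move=> g pg hg; have g2 := persistent_L2 pg.
have Ng : forall j, (j < N)%N -> ip mu \1_(A j) (fun x => - g x) = 0.
  move=> j jN; rewrite ipC; under [X in ip mu X _]eq_fun do rewrite -mulN1r.
  by rewrite ipZ// ipC hg// mulr0.
apply: filterS2 (le0 _ pg hg) (le0 _ (persistentN hbi pg) Ng) => x h1 h2 _.
by apply/eqP; rewrite eq_le h1 -oppr_le0 h2.
Qed.

End cyclic_partition.

(** * Uniform decay orthogonally to the cycle *)

Section decay.
Context d (T : measurableType d) (R : realType).
Variables (mu : probability T R) (P : R.-pker T ~> T).
Hypothesis hbi : bistochastic mu P.
Hypothesis hqc : quasi_compact mu 2%:E (markov_op P).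
Variables (N : nat) (A : nat -> set T).
Hypothesis cyc : cyclic_partition mu P N A.
Implicit Types (f g : T -> R).
Local Notation M := (kmean P).
Local Notation L2 := (Lp mu 2).
Local Notation n2 := (nrm mu 2).

Let mu1 : mu setT = 1%E. Proof. exact: probability_setT. Qed.
Let le12 : 1 <= 2 :> R. Proof. by rewrite ler1n. Qed.
Let lt02 : 0 < 2 :> R. Proof. by rewrite ltr0n. Qed.
Let MC : Lp_contraction mu M. Proof. exact: kmean_contraction. Qed.
Let MCn n : Lp_contraction mu (iter n M). Proof. exact: contraction_iter. Qed.
Let mA j : measurable (A j). Proof. exact: cyclic_measurable cyc j. Qed.
Let A2 j : L2 \1_(A j). Proof. exact: Lp_indic. Qed.

Definition centered f := L2 f /\ forall j, ip mu \1_(A j) f = 0.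

Lemma cyclic_modn j : (\1_(A j) : T -> R) = \1_(A (j %% N)%N) %[ae mu].
Proof.
suff h q r : (\1_(A (q * N + r)%N) : T -> R) = \1_(A r) %[ae mu].
  by have := h (j %/ N)%N (j %% N)%N; rewrite -divn_eq.
elim: q => [|q IH]; first exact: aeW.
have := cyclic_period cyc (q * N + r)%N.
rewrite mulSn [(N + _)%N]addnC addnAC.
by apply: filterS2 IH => x /(_ I) <- /(_ I) ->.
Qed.

Lemma centeredP f : L2 f -> (forall j, (j < N)%N -> ip mu \1_(A j) f = 0) ->
  centered f.
Proof.
move=> f2 h; split=> // j.
rewrite -(h (j %% N)%N (ltn_pmod _ (cyclic_gt0 cyc))); apply: ip_ae => //.
- exact: f2.1.
- exact: cyclic_modn.
- exact: aeW.
Qed.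

(** [M] preserves the norm of the indicators of the cycle, so that [M* M] fixes
    them. *)
Lemma cyclic_ip_kmean j f : L2 f -> ip mu \1_(A j.+1) (M f) = ip mu \1_(A j) f.
Proof.
move=> f2; have Mf := contraction_Lp MC le12 f2.
have MA := contraction_Lp MC le12 (A2 j).
have -> : ip mu \1_(A j.+1) (M f) = ip mu (M \1_(A j)) (M f).
  apply/esym/ip_ae => //; [exact: Mf.1|exact: cyclic_step cyc j|exact: aeW].
rewrite ipC (ipC _ _ f); apply: contraction_ip => //.
have [|_ <-] := nrm_ae lt02 MA (A2 j.+1).1; first exact: (cyclic_step cyc j).
rewrite -(@ler_pXn2r _ 2) ?nnegrE ?nrm_ge0// !nrm_indic//.
by rewrite !(cyclic_pr cyc).
Qed.

Lemma centered_kmean f : centered f -> centered (M f).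
Proof.
move=> [f2 h]; apply: centeredP; first exact: contraction_Lp.
move=> j _; have Mf := contraction_Lp MC le12 f2.
have -> : ip mu \1_(A j) (M f) = ip mu \1_(A (j + N)%N) (M f).
  apply/esym/ip_ae => //; [exact: Mf.1| |exact: aeW].
  exact: (cyclic_period cyc).
by rewrite -(prednK (cyclic_gt0 cyc)) addnS cyclic_ip_kmean.
Qed.

Lemma centered_iter n f : centered f -> centered (iter n M f).
Proof. by move=> hf; elim: n => //= n; exact: centered_kmean. Qed.

Hypothesis persistent_centered0 : forall g, persistent mu P g ->
  (forall j, (j < N)%N -> ip mu \1_(A j) g = 0) -> g = cst 0 %[ae mu].

Let power_limit g := L2 g /\ exists (f : nat -> T -> R) (m : nat -> nat),
  [/\ forall k, centered (f k) /\ in_ball mu (f k),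
  forall k, (k <= m k)%N & L2_cvg mu (fun k => iter (m k) M (f k)) g].

(** Lowering the exponents by one and extracting again gives a preimage. *)
Let power_limit_preimage g : power_limit g ->
  exists2 g', power_limit g' & M g' = g %[ae mu].
Proof.
move=> [g2 [f [m [hf hm cv]]]].
have hm' k : (k <= (m k.+1).-1)%N by have := hm k.+1; case: (m k.+1).
have [phi [g' [hphi g'2 cv']]] := @asymptotic_compactness _ _ _ _ _ hbi hqc
  (fun k => f k.+1) (fun k => (m k.+1).-1) (fun k => (hf k.+1).2) hm'.
exists g'.
  split=> //; exists (fun k => f (phi k).+1), (fun k => (m (phi k).+1).-1); split=> // k.
  exact: leq_trans (increasing_le hphi k) (hm' _).
have Mg' := contraction_Lp MC le12 g'2.
suff h : n2 (fun x => M g' x - g x) <= 0.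
  have := nrm_eq0 le12 (LpB le12 Mg' g2).1 h.
  by apply: filterS => x /[apply] /eqP; rewrite subr_eq0 => /eqP.
apply/ler_addgt0Pr => e e0; rewrite add0r.
have e20 : 0 < e / 2 by exact: divr_gt0.
have [K1 h1] := cv _ e20; have [K2 h2] := cv' _ e20.
pose k := maxn K1 K2; pose y := iter (m (phi k).+1).-1 M (f (phi k).+1).
have y2 : L2 y by exact: (contraction_Lp (MCn _) le12 (hf _).2.1).
have My : M y = iter (m (phi k).+1) M (f (phi k).+1).
  rewrite /y -iterS prednK//; exact: leq_ltn_trans (hm _).
have My2 := contraction_Lp MC le12 y2.
apply: le_trans (nrm_triangle le12 Mg' My2 g2) _; rewrite (splitr e) lerD//.
  apply: le_trans (contraction_nrmB mu1 MC le12 g'2 y2) _.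
  by rewrite nrmBC; apply: h2; rewrite leq_maxr.
rewrite My; apply: h1; rewrite (leq_trans (leq_maxl K1 K2))//.
exact: leq_trans (increasing_le hphi _) (leqnSn _).
Qed.

Let power_limit_ball g : power_limit g -> n2 g <= 1 /\ centered g.
Proof.
move=> [g2 [f [m [hf hm cv]]]].
pose y k := iter (m k) M (f k).
have y2 k : L2 (y k) by exact: (contraction_Lp (MCn _) le12 (hf k).2.1).
split.
  apply/ler_addgt0Pr => e e0; have [K h] := cv _ e0.
  apply: le_trans (nrm_leB le12 g2 (y2 K)) _; rewrite nrmBC lerD//; last exact: h.
  exact: le_trans (contraction_nrm (MCn _) le12 (hf K).2.1) (hf K).2.2.
split=> // j; apply/eqP; rewrite -normr_le0; apply/ler_addgt0Pr => e e0; rewrite add0r.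
have e'0 : 0 < e / (n2 \1_(A j) + 1) by rewrite divr_gt0// ltr_wpDl// nrm_ge0.
have [K h] := cv _ e'0.
have yg := (LpB le12 (y2 K) g2).1.
have -> : ip mu \1_(A j) g = - ip mu \1_(A j) (fun x => y K x - g x).
  have e1 : (fun x => y K x - g x) = (fun x => -1 * g x + y K x).
    by apply/funext => x; rewrite mulN1r addrC.
  rewrite ipC e1 (ipC _ \1_(A j)) ip_lin// (ipC _ (y K)).
  by rewrite (centered_iter (m K) (hf K).1).2 addr0 mulN1r opprK.
rewrite normrN; apply: le_trans (L2_mul (A2 j) yg).2 _.
apply: le_trans (ler_wpM2l (nrm_ge0 _ _ _) (h K (leqnn K))) _.
rewrite mulrCA ler_piMr ?(ltW e0)// ler_pdivrMr ?mul1r ?lerDl//.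
by rewrite ltr_wpDl// nrm_ge0.
Qed.

Let power_limit_persistent g : power_limit g -> persistent mu P g.
Proof.
move=> hg.
have H (u : {g | power_limit g}) : {v : {g | power_limit g} | M (sval v) = sval u %[ae mu]}.
  case: u => h hh; apply: cid.
  by have [g' h1 h2] := power_limit_preimage hh; exists (exist _ g' h1).
pose u := fix u j : {g | power_limit g} := if j is k.+1 then sval (H (u k)) else exist _ g hg.
exists (fun j => sval (u j)) => //; split.
  exists 1 => j; have := svalP (u j) => hj; split; first exact: hj.1.
  exact: (power_limit_ball hj).1.
by move=> j; exact: (svalP (H (u j))).
Qed.

(** A sequence of centered unit vectors that [M] fails to contract would
    accumulate at a nonzero centered persistent vector. *)
Lemma centered_decay e : 0 < e -> exists m, forall f, centered f ->
  n2 (iter m M f) <= e * n2 f.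
Proof.
move=> e0.
suff [m hm] : exists m, forall f, centered f -> in_ball mu f -> n2 (iter m M f) <= e.
  exists m => f hf; have f2 := hf.1; have Mf := contraction_Lp (MCn m) le12 f2.
  have [f0|f0] := ltP 0 (n2 f); last first.
    apply: le_trans (contraction_nrm (MCn m) le12 f2) (le_trans f0 _).
    by rewrite mulr_ge0 ?nrm_ge0// ltW.
  have [g2 ng] := LpZ (n2 f)^-1 le12 f2.
  have cg : centered (fun x => (n2 f)^-1 * f x).
    by split=> // j; rewrite ipC ipZ// ipC hf.2 mulr0.
  have bg : in_ball mu (fun x => (n2 f)^-1 * f x).
    by split=> //; rewrite ng gtr0_norm ?invr_gt0// mulVf// gt_eqF.
  have := hm _ cg bg.
  have [Mg2 nMg] := LpZ (n2 f)^-1 le12 Mf.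
  have f1 := (Lp_sub1 mu1 le12 f2).1.
  have [|_ <-] := nrm_ae lt02 (contraction_Lp (MCn m) le12 g2) Mg2.1.
    exact: (contractionZ (MCn m)).
  by rewrite nMg gtr0_norm ?invr_gt0// ler_pdivrMl// mulrC.
apply: contrapT => H.
have /choice[f hf] : forall m, exists f, [/\ centered f, in_ball mu f &
    e < n2 (iter m M f)].
  move=> m; apply: contrapT => h; apply: H; exists m => f cf bf.
  by rewrite leNgt; apply/negP => ef; apply: h; exists f.
have [phi [g [hphi g2 cv]]] := asymptotic_compactness hbi hqc
  (fun k => let: And3 _ b _ := hf k in b) (fun k => leqnn k).
have lg : power_limit g.
  split=> //; exists (fun k => f (phi k)), phi; split=> // k; last exact: increasing_le.
  by have [? ? _] := hf (phi k).
have e20 : 0 < e / 2 by exact: divr_gt0.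
have [K hK] := cv _ e20.
have g0 := persistent_centered0 (power_limit_persistent lg)
  (fun j _ => (power_limit_ball lg).2.2 j).
have ng : n2 g = 0.
  have [z nz] := Lp0 mu le12; rewrite -nz.
  by have [_ ->] := nrm_ae lt02 g2 z.1 g0.
have [_ b ef] := hf (phi K).
have y2 := contraction_Lp (MCn (phi K)) le12 b.1.
have := nrm_leB le12 y2 g2; rewrite ng add0r => /(lt_le_trans ef).
move=> /lt_le_trans /(_ (hK K (leqnn K))); rewrite ltNge.
by rewrite ler_pdivrMr// ler_peMr// ?ler1n// ltW.
Qed.

End decay.

(** * Convergence in L^p *)

Section truncation.
Context d (T : measurableType d) (R : realType).
Variable mu : probability T R.
Implicit Types (f g h : T -> R) (p : R).

Let mu1 : mu setT = 1%E. Proof. exact: probability_setT. Qed.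
Let le11 : 1 <= 1 :> R. Proof. exact: lexx. Qed.
Let le12 : 1 <= 2 :> R. Proof. by rewrite ler1n. Qed.
Let lt02 : 0 < 2 :> R. Proof. by rewrite ltr0n. Qed.

(** Dominated convergence for the truncations of [f] at the heights [n]. *)
Lemma Lp_truncation p f e : 1 <= p -> Lp mu p f -> 0 < e ->
  exists C g, [/\ measurable_fun setT g, forall x, `|g x| <= C &
    nrm mu p (fun x => f x - g x) <= e].
Proof.
move=> p1 fp e0; have p0 : 0 < p by exact: lt_le_trans p1.
have mf := fp.1.
pose B n := [set x | `|f x| <= n%:R].
have mB n : measurable (B n).
  have -> : B n = ~` [set x | n%:R < `|f x|].
    by apply/seteqP; split=> x /=; rewrite /B /= leNgt => /negP.
  by apply/measurableC/measurable_level; exact: measurableT_comp.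
pose g n x := f x * \1_(B n) x.
have mg n : measurable_fun setT (g n).
  by apply: measurable_funM => //; exact: (measurable_indic (D := setT) (mB n)).
have ifp : mu.-integrable setT (fun x => (`|f x| `^ p)%:E).
  apply/integrableP; split; first exact/measurable_EFinP/measurable_powRnorm.
  under eq_integral do rewrite gee0_abs ?lee_fin ?powR_ge0//.
  exact/Lp_powR.
have gf n x : `|f x - g n x| <= `|f x|.
  rewrite /g indicE; case: (_ \in _); rewrite /= ?mulr1 ?mulr0 ?subrr ?subr0 ?normr0//.
have [] := @dominated_convergence _ _ _ mu setT measurableT
  (fun n x => (`|f x - g n x| `^ p)%:E) (cst 0%E) (fun x => (`|f x| `^ p)%:E).
- by move=> n; apply/measurable_EFinP/measurable_powRnorm/measurable_funB.
- exact: measurable_cst.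
- apply: aeW => x _; apply: cvg_near_cst.
  exists (Num.trunc `|f x|).+1 => // n /= hn.
  rewrite /g indicE mem_set ?mulr1 ?subrr ?normr0 ?powR0 ?gt_eqF//.
  rewrite /B /=; apply: le_trans (_ : (Num.trunc `|f x|).+1%:R <= _); last by rewrite ler_nat.
  by apply: ltW; have /andP[] := truncn_itv (normr_ge0 (f x)).
- exact: ifp.
- apply: aeW => x n _; rewrite gee0_abs ?lee_fin ?powR_ge0//.
  by rewrite ge0_ler_powR// ?nnegrE// ltW.
move=> _ _ cv.
have fgp n : Lp mu p (fun x => f x - g n x).
  apply: (Lp_dom p0 fp _ _).1; first exact: measurable_funB.
  by apply: aeW => x; exact: gf.
have cv' : (nrm mu p (fun x => f x - g n x) `^ p)%:E @[n --> \oo] --> 0%E.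
  move: cv; rewrite integral0; apply: cvg_trans; apply: near_eq_cvg; apply: nearW => n.
  by rewrite nrm_powR.
have ep : 0 < e `^ p by rewrite powR_gt0.
have /fine_cvgP[_ /cvgrPdist_le/(_ _ ep)[n _ hn]] := cv'.
have := hn n (leqnn n) => /=; rewrite sub0r normrN ger0_norm ?powR_ge0// => h.
exists n%:R, (g n); split=> //.
- move=> x; rewrite /g indicE; have [/set_mem Bx|_] := boolP (x \in B n).
    by rewrite mulr1.
  by rewrite mulr0 normr0.
- rewrite leNgt; apply/negP => /(gt0_ltr_powR p0).
  by rewrite !nnegrE nrm_ge0 (ltW e0) => /(_ isT isT); rewrite ltNge h.
Qed.

(** Convergence to [0] in [L^2] of a sequence bounded in all [L^q] holds in all
    [L^p]: bound [|h|^p] by [|h| + |h| |h|^(k+1)] and apply the Cauchy-Schwarz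
    inequality to both terms. *)
Lemma nrm_interpolation p (k : nat) h : 1 <= p -> p <= k.+2%:R ->
  (forall q, 1 <= q -> Lp mu q h) ->
  nrm mu p h `^ p <= nrm mu 2 h * (1 + nrm mu (k.+1 * 2)%:R h ^+ k.+1).
Proof.
move=> p1 pk hq; have p0 : 0 < p by exact: lt_le_trans p1.
have h2 := hq _ le12; have h1 := hq _ le11; have hp := hq _ p1.
have mh := h1.1.
have r1 : 1 <= (k.+1 * 2)%:R :> R by rewrite ler1n muln2.
have hr := hq _ r1.
pose hk x := `|h x| ^+ k.+1.
have mhk : measurable_fun setT hk by apply: measurable_funX; exact: measurableT_comp.
have e2 x : `|hk x| `^ 2 = `|h x| `^ (k.+1 * 2)%:R.
  by rewrite !powR_mulrn ?normr_ge0// /hk normrX normr_id exprM.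
have hk2 : Lp mu 2 hk.
  apply/Lp_powR => //; under eq_integral do rewrite e2.
  by apply/Lp_powR => //; rewrite ltr0n muln2.
have nhk : nrm mu 2 hk = nrm mu (k.+1 * 2)%:R h ^+ k.+1.
  have r0 : 0 < (k.+1 * 2)%:R :> R by rewrite ltr0n muln2.
  have := nrm_powR lt02 hk2; under eq_integral do rewrite e2.
  rewrite -(nrm_powR r0 hr) !powR_mulrn ?nrm_ge0// exprM => -[].
  move=> /eqP; rewrite eqrXn2 ?nrm_ge0 ?exprn_ge0 ?nrm_ge0// => /eqP.
  by [].
have ah2 : Lp mu 2 (fun x => `|h x|) by exact: Lp_abs.
have [ihk CS] := L2_mul ah2 hk2.
have i1 : mu.-integrable setT (EFin \o (fun x => `|h x|)).
  by apply/Lp1_integrable; exact: Lp_abs.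
have pw x : `|h x| `^ p <= `|h x| + `|h x| * hk x.
  rewrite -exprS -{2}(powRr1 (normr_ge0 (h x))).
  have [hx|hx] := leP `|h x| 1.
    rewrite -[leLHS]addr0 lerD ?exprn_ge0//.
    have [->|hx0] := eqVneq `|h x| 0; first by rewrite !powR0// gt_eqF.
    by apply: ger_powR => //; rewrite hx andbT lt_neqAle eq_sym hx0 normr_ge0.
  rewrite -[leLHS]add0r lerD ?powR_ge0//.
  by rewrite -powR_mulrn ?normr_ge0//; apply: ler_powR => //; exact: ltW.
have : ((nrm mu p h `^ p)%R%:E <= (\int[mu]_x `|h x| + \int[mu]_x (`|h x| * hk x))%R%:E)%E.
  rewrite nrm_powR// -RintegralD//.
  rewrite /Rintegral fineK; last first.
    apply: integrable_fin_num => //.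
    exact: (integrableD measurableT i1 ihk).
  apply: ge0_le_integral => //.
  - exact/measurable_EFinP/measurable_powRnorm.
  - apply/measurable_EFinP; apply: measurable_funD; first exact: measurableT_comp.
    by apply: measurable_funM => //; exact: measurableT_comp.
  - by move=> x _; rewrite lee_fin.
rewrite lee_fin => /le_trans; apply.
rewrite -nrm1E mulrDr mulr1 lerD//; first exact: (Lp_sub1 mu1 le12 h2).2.
rewrite -nhk -(nrm_abs mu 2 h); exact: le_trans (ler_norm _) CS.
Qed.

End truncation.

Section convergence.
Context d (T : measurableType d) (R : realType).
Variables (mu : probability T R).
Variables (N : nat) (A : nat -> set T) (Q : (T -> R) -> (T -> R)) (s : nat).
Implicit Types (f g h : T -> R) (p : R).
Local Notation n2 := (nrm mu 2).
Let mu1 : mu setT = 1%E. Proof. exact: probability_setT. Qed.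
Let le11 : 1 <= 1 :> R. Proof. exact: lexx. Qed.
Let le12 : 1 <= 2 :> R. Proof. by rewrite ler1n. Qed.
Let lt02 : 0 < 2 :> R. Proof. by rewrite ltr0n. Qed.

Hypothesis N0 : (0 < N)%N.
Hypothesis mA : forall j, measurable (A j).
Hypothesis period : forall j, (\1_(A (j + N)%N) : T -> R) = \1_(A j) %[ae mu].
Hypothesis disjoint : forall i j, (i < N)%N -> (j < N)%N -> i <> j ->
  pr mu (A i `&` A j) = 0.
Hypothesis prA : forall j, pr mu (A j) = N%:R^-1.
Hypothesis QC : Lp_contraction mu Q.
Hypothesis QA : forall j, Q \1_(A j) = \1_(A (j + s)%N) %[ae mu].
Hypothesis decay : forall e, 0 < e -> exists m, forall f, centered mu A f ->
  n2 (iter m Q f) <= e * n2 f.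

Let QCn n : Lp_contraction mu (iter n Q). Proof. exact: contraction_iter. Qed.
Let LpA p j : 1 <= p -> Lp mu p \1_(A j). Proof. by move=> p1; exact: Lp_indic. Qed.

(** As [N = 1 / mu (A l)], this is the conditional expectation of [f] given the
    cycle, moved along [sigma]. *)
Definition transported (sigma : nat -> nat) f : T -> R :=
  fun x => N%:R * \sum_(l < N) (\int[mu]_(y in A l) f y) * \1_(A (sigma l)) x.

Lemma Rintegral_indic (B : set T) f :
  \int[mu]_(y in B) f y = \int[mu]_y (\1_B y * f y).
Proof.
rewrite Rintegral_mkcond; apply: eq_Rintegral => y _.
by rewrite patchE indicE; case: (y \in B); rewrite ?mul1r ?mul0r.
Qed.

Lemma transported_Lp sigma p f : 1 <= p -> Lp mu p f ->
  Lp mu p (transported sigma f) /\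
  nrm mu p (transported sigma f) <= N%:R * N%:R * nrm mu p f.
Proof.
move=> p1 fp; have p0 : 0 < p by exact: lt_le_trans p1.
have c_le l : `|\int[mu]_(y in A l) f y| <= nrm mu p f.
  have [f1 f1'] := Lp_sub1 mu1 p1 fp; apply: le_trans f1'.
  have mI : measurable_fun setT (fun y => \1_(A l) y * f y).
    by apply: measurable_funM; [exact: (LpA l p1).1|exact: fp.1].
  have [g1 g1'] : Lp mu 1 (fun y => \1_(A l) y * f y) /\
      nrm mu 1 (fun y => \1_(A l) y * f y) <= nrm mu 1 f.
    apply: Lp_dom => //; apply: aeW => y.
    by rewrite indicE; case: (y \in A l); rewrite ?mul1r ?mul0r ?normr0.
  rewrite Rintegral_indic; apply: le_trans g1'; rewrite nrm1E.
  by apply: le_normr_Rintegral => //; exact/Lp1_integrable.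
have ind_le l : nrm mu p \1_(A l) <= 1.
  have [|_] := @Lp_bounded _ _ _ _ mu1 p 1 _ p1 (LpA l p1).1.
    by apply: aeW => x; rewrite indicE; case: (_ \in _); rewrite /= ?normr1 ?normr0.
  by rewrite normr1.
pose F l x := (\int[mu]_(y in A l) f y) * \1_(A (sigma l)) x.
have F2 l := LpZ (\int[mu]_(y in A l) f y) p1 (LpA (sigma l) p1).
have [S1 S2] := @Lp_sum _ _ _ mu p N F p1 (fun l => (F2 l).1).
have [G1 G2] := LpZ N%:R p1 S1; split=> //.
rewrite [leLHS]G2 normr_nat -mulrA ler_wpM2l//; apply: le_trans S2 _.
apply: le_trans (_ : \sum_(l < N) nrm mu p f <= _).
  apply: ler_sum => l _; rewrite (F2 l).2 -[leRHS]mulr1.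
  by rewrite ler_pM// ?nrm_ge0.
by rewrite sumr_const card_ord mulr_natl.
Qed.

Lemma transportedB sigma f g : Lp mu 1 f -> Lp mu 1 g -> forall x,
  transported sigma (fun y => f y - g y) x =
  transported sigma f x - transported sigma g x.
Proof.
move=> f1 g1 x; rewrite /transported -mulrBr -sumrB; congr (_ * _).
apply: eq_bigr => l _; rewrite -mulrBl RintegralB//.
- by apply: integrableS (_ : mu.-integrable setT _) => //; exact/Lp1_integrable.
- by apply: integrableS (_ : mu.-integrable setT _) => //; exact/Lp1_integrable.
Qed.

Lemma period_mul j q : (\1_(A (j + q * N)%N) : T -> R) = \1_(A j) %[ae mu].
Proof.
elim: q => [|q IH]; first by rewrite addn0; exact: aeW.
rewrite mulSn addnCA addnC; have := period (j + q * N)%N.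
by apply: filterS2 IH => x /(_ I) <- /(_ I) ->.
Qed.

Lemma iterQA n j : iter n Q \1_(A j) = \1_(A (j + n * s)%N) %[ae mu].
Proof.
elim: n => [|n IH]; first by rewrite addn0; exact: aeW.
have h := contraction_ae QC (contraction_Lp (QCn n) le11 (LpA j le11))
  (LpA (j + n * s) le11).1 IH.
rewrite mulSn addnCA addnC.
by apply: filterS2 h (QA (j + n * s)%N) => x /(_ I) /= -> /(_ I).
Qed.

Lemma transported_congr sigma sigma' f :
  (forall l, (\1_(A (sigma l)) : T -> R) = \1_(A (sigma' l)) %[ae mu]) ->
  transported sigma f = transported sigma' f %[ae mu].
Proof.
move=> ss; have : {ae mu, forall x, forall l,
    \1_(A (sigma l)) x = \1_(A (sigma' l)) x :> R}.
  by apply: ae_foralln => l; apply: filterS (ss l) => x; exact.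
apply: filterS => x h _; rewrite /transported; congr (_ * _).
by apply: eq_bigr => l _; rewrite h.
Qed.

Lemma iter_transported n f : Lp mu 1 f ->
  iter n Q (transported id f) = transported (fun l => l + n * s)%N f %[ae mu].
Proof.
move=> f1; have [S1 _] := @Lp_sum _ _ _ mu 1 N
  (fun l x => (\int[mu]_(y in A l) f y) * \1_(A l) x) le11
  (fun l => (LpZ _ le11 (LpA l le11)).1).
have all : {ae mu, forall x, forall j, iter n Q \1_(A j) x = \1_(A (j + n * s)%N) x}.
  by apply: ae_foralln => j; apply: filterS (iterQA n j) => x; exact.
apply: filterS3 (contractionZ (QCn n) N%:R S1) (contraction_sum (QCn n) N
  (fun l => \int[mu]_(y in A l) f y) (fun l => LpA l le11)) all => x /(_ I) e1 /(_ I) e2 e3 _.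
rewrite [LHS]e1 e2 /transported; congr (_ * _).
by apply: eq_bigr => l _; rewrite e3.
Qed.

Lemma centered_sub_transported f : Lp mu 2 f ->
  centered mu A (fun x => f x - transported id f x).
Proof.
move=> f2; have [E2 _] := transported_Lp id le12 f2.
pose F l x := (\int[mu]_(y in A l) f y) * \1_(A l) x.
have F2 l : Lp mu 2 (F l) by exact: (LpZ _ le12 (LpA l le12)).1.
have S2 := (Lp_sum N le12 F2).1.
have lt j : (j < N)%N -> ip mu \1_(A j) (fun x => f x - transported id f x) = 0.
  move=> jN; rewrite ipC.
  have -> : (fun x => f x - transported id f x) =
      (fun x => - N%:R * (\sum_(l < N) F l x) + f x).
    by apply/funext => x; rewrite /transported mulNr addrC.
  rewrite ip_lin//; last exact: LpA.
  rewrite (ip_sum N F2 (LpA j le12)) (bigD1 (Ordinal jN))//= big1 ?addr0; last first.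
    move=> l lj; rewrite ipZ; [|exact: LpA..].
    rewrite ip_indic// disjoint ?mulr0// => e; move/eqP: lj; apply.
    by apply: val_inj.
  rewrite ipZ; [|exact: LpA..].
  rewrite ip_indic// setIid prA mulrCA mulNr mulfV ?pnatr_eq0 -?lt0n// mulrN1.
  by rewrite Rintegral_indic ipC addNr.
split; first exact: (LpB le12 f2 E2).1.
move=> j; rewrite (divn_eq j N) addnC.
have B2 := (LpB le12 f2 E2).1.
rewrite -(lt (j %% N)%N (ltn_pmod _ N0)); apply: ip_ae => //.
- exact: LpA.
- exact: B2.1.
- exact: period_mul.
- exact: aeW.
Qed.

(** The conditional expectation is moved along the cycle, and the centered rest
    decays. *)
Lemma L2_convergence f e : Lp mu 2 f -> 0 < e -> exists m0, forall m, (m0 <= m)%N ->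
  n2 (fun x => iter m Q f x - transported (fun l => l + m * s)%N f x) <= e.
Proof.
move=> f2 e0; have [E2 _] := transported_Lp id le12 f2.
have [f1 _] := Lp_sub1 mu1 le12 f2; have [E1 _] := Lp_sub1 mu1 le12 E2.
have cf := centered_sub_transported f2.
set g := fun x => f x - transported id f x in cf.
have g2 := cf.1; have g0 := nrm_ge0 mu 2 g.
have e'0 : 0 < e / (n2 g + 1) by rewrite divr_gt0// ltr_wpDl.
have [m0 hm0] := decay e'0; exists m0 => m mm.
have Qf := contraction_Lp (QCn m) le12 f2.
have Tm := (transported_Lp (fun l => l + m * s)%N le12 f2).1.
have [|_ ->] := nrm_ae lt02 (contraction_Lp (QCn m) le12 g2) (LpB le12 Qf Tm).1.1.
  apply: filterS2 (contractionB (QCn m) f1 E1) (iter_transported m f1) => x.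
  by move=> /(_ I) -> /(_ I) ->.
rewrite -(subnK mm) iterD.
apply: le_trans (contraction_nrm (QCn _) le12 (contraction_Lp (QCn m0) le12 g2)) _.
apply: le_trans (hm0 _ cf) _.
by rewrite mulrAC ler_pdivrMr ?ltr_wpDl// ler_wpM2l ?(ltW e0)// lerDl.
Qed.

(** The [L^2] convergence passes to bounded functions in [L^p] by interpolation,
    and to all of [L^p] by density, both operators being bounded there. *)
Lemma Lp_convergence p f e : 1 <= p -> Lp mu p f -> 0 < e ->
  exists m0, forall m, (m0 <= m)%N ->
  nrm mu p (fun x => iter m Q f x - transported (fun l => l + m * s)%N f x) <= e.
Proof.
move=> p1 fp e0; have p0 : 0 < p by exact: lt_le_trans p1.
pose K : R := N%:R * N%:R + 2.
have K0 : 0 < K by rewrite ltr_wpDl// mulr_ge0.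
have eK0 : 0 < e / K by exact: divr_gt0.
have [C [g [mg gC fg]]] := Lp_truncation p1 fp eK0.
have gq q : 1 <= q -> Lp mu q g.
  by move=> q1; apply: (Lp_bounded mu1 (c := C) q1 mg _).1; exact: aeW.
pose h m x := iter m Q g x - transported (fun l => l + m * s)%N g x.
have hq q : 1 <= q -> forall m, Lp mu q (h m) /\
    nrm mu q (h m) <= (1 + N%:R * N%:R) * nrm mu q g.
  move=> q1 m; have Qg := contraction_Lp (QCn m) q1 (gq q q1).
  have [Tg nTg] := transported_Lp (fun l => l + m * s)%N q1 (gq q q1).
  have [h1 h2] := LpB q1 Qg Tg; split=> //; apply: le_trans h2 _.
  by rewrite mulrDl mul1r lerD//; exact: (contraction_nrm (QCn m) q1 (gq q q1)).
pose k := Num.trunc p.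
have pk : p <= k.+2%:R.
  apply: ltW; have /andP[_ h1] := truncn_itv (ltW p0).
  by apply: lt_trans h1 _; rewrite ltr_nat.
pose r : R := (k.+1 * 2)%:R; have r1 : 1 <= r by rewrite /r ler1n muln2.
pose B := 1 + ((1 + N%:R * N%:R) * nrm mu r g) ^+ k.+1.
have B0 : 0 < B by rewrite ltr_wpDr// exprn_ge0// mulr_ge0 ?nrm_ge0// addr_ge0 ?mulr_ge0.
have ep0 : 0 < (e / K) `^ p / B by rewrite divr_gt0// powR_gt0.
have [m0 hm0] := L2_convergence (gq _ le12) ep0.
exists m0 => m mm.
have hsmall : nrm mu p (h m) <= e / K.
  rewrite leNgt; apply/negP => /(gt0_ltr_powR p0).
  rewrite !nnegrE nrm_ge0 (ltW eK0) => /(_ isT isT); apply/negP; rewrite -leNgt.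
  apply: le_trans (nrm_interpolation p1 pk (fun q q1 => (hq q q1 m).1)) _.
  apply: (@le_trans _ _ (n2 (h m) * B)).
    rewrite ler_wpM2l ?nrm_ge0// /B lerD2l lerXn2r ?nnegrE ?nrm_ge0//.
      by rewrite mulr_ge0 ?nrm_ge0// addr_ge0 ?mulr_ge0.
    exact: (hq r r1 m).2.
  by rewrite -ler_pdivlMr//; exact: hm0.
have [f1 _] := Lp_sub1 mu1 p1 fp; have [g1 _] := Lp_sub1 mu1 p1 (gq p p1).
have gp := gq p p1.
have [Qf Qg] := (contraction_Lp (QCn m) p1 fp, contraction_Lp (QCn m) p1 gp).
pose sg l := (l + m * s)%N.
have [Tf _] := transported_Lp sg p1 fp; have [Tg _] := transported_Lp sg p1 gp.
have step1 := nrm_triangle p1 Qf Qg Tf.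
have step2 := nrm_triangle p1 Qg Tg Tf.
have i1 := contraction_nrmB mu1 (QCn m) p1 fp gp.
have i3 : nrm mu p (fun x => transported sg g x - transported sg f x) <=
    N%:R * N%:R * (e / K).
  have [fgp _] := LpB p1 gp fp; have [_] := transported_Lp sg p1 fgp.
  rewrite (_ : transported sg _ = (fun x => transported sg g x - transported sg f x)).
    move=> /le_trans; apply; rewrite ler_wpM2l ?mulr_ge0//.
    by rewrite nrmBC.
  by apply/funext => x; exact: transportedB.
apply: le_trans step1 _.
apply: le_trans (lerD (le_trans i1 fg) (le_trans step2 (lerD hsmall i3))) _.
rewrite -[X in X + _]mul1r -{2}[e / K]mul1r -!mulrDl.
have -> : 1 + (1 + N%:R * N%:R) = K by rewrite /K; ring.
by rewrite mulrCA divff ?mulr1// gt_eqF.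
Qed.

End convergence.

(** * Passage to complex functions *)

Section complexification.
Context d (T : measurableType d) (R : realType).
Variable mu : probability T R.
Implicit Types (f g : T -> R[i]) (a : R[i]) (p : R).

Definition complexify (Q : (T -> R) -> (T -> R)) f : T -> R[i] :=
  fun x => (Q (re f) x +i* Q (im f) x)%C.

Variable Q : (T -> R) -> (T -> R).
Hypothesis QC : Lp_contraction mu Q.

Let mu1 : mu setT = 1%E. Proof. exact: probability_setT. Qed.

Lemma complexify_cLp p f : 1 <= p -> cLp mu p%:E f -> cLp mu p%:E (complexify Q f).
Proof.
move=> p1 /(cLpP _ p1)[fr fi]; apply/cLpP => //.
by split; exact: (contraction_Lp QC).
Qed.

Lemma cLp_sub1 p f : 1 <= p -> cLp mu p%:E f -> cLp mu 1%:E f.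
Proof.
move=> p1 /(cLpP _ p1)[fr fi]; apply/cLpP; first exact: lexx.
by split; [exact: (Lp_sub1 mu1 p1 fr).1|exact: (Lp_sub1 mu1 p1 fi).1].
Qed.

Lemma complexify_lin a f g : cLp mu 1%:E f -> cLp mu 1%:E g ->
  complexify Q (fun x => a * f x + g x) =
  (fun x => a * complexify Q f x + complexify Q g x) %[ae mu].
Proof.
move=> /(cLpP _ (lexx 1))[fr fi] /(cLpP _ (lexx 1))[gr gi].
have lin c c' (u v w : T -> R) : Lp mu 1 u -> Lp mu 1 v -> Lp mu 1 w ->
    Q (fun x => c * u x + (c' * v x + w x)) =
    (fun x => c * Q u x + (c' * Q v x + Q w x)) %[ae mu].
  move=> u1 v1 w1; have vw := (LpD (lexx 1) (LpZ c' (lexx 1) v1).1 w1).1.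
  apply: filterS2 (contraction_lin QC c u1 vw) (contraction_lin QC c' v1 w1) => x.
  by move=> /(_ I) -> /(_ I) ->.
have er : re (fun x => a * f x + g x) = (fun x => complex.Re a * re f x +
    (- complex.Im a * im f x + re g x)).
  by apply/funext => x; rewrite /re /im ReCD ReCM; ring.
have ei : im (fun x => a * f x + g x) = (fun x => complex.Re a * im f x +
    (complex.Im a * re f x + im g x)).
  by apply/funext => x; rewrite /re /im ImCD ImCM; ring.
apply: filterS2 (lin (complex.Re a) (- complex.Im a) _ _ _ fr fi gr)
  (lin (complex.Re a) (complex.Im a) _ _ _ fi fr gi) => x /(_ I) h1 /(_ I) h2 _.
apply: complexP; rewrite ?ReCD ?ImCD ?ReCM ?ImCM /complexify er ei/= ?h1 ?h2; ring.
Qed.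

Lemma cLp0 p : 1 <= p -> cLp mu p%:E (fun=> 0 : R[i]).
Proof. by move=> p1; apply/cLpP => //; split; exact: (Lp0 mu p1).1. Qed.

Lemma complexifyZ a f : cLp mu 1%:E f ->
  complexify Q (fun x => a * f x) = (fun x => a * complexify Q f x) %[ae mu].
Proof.
move=> f1; have -> : (fun x => a * f x) = (fun x => a * f x + 0).
  by apply/funext => x; rewrite addr0.
apply: filterS2 (complexify_lin a f1 (cLp0 (lexx 1))) (contraction0 QC) => x.
move=> /(_ I) -> /(_ I) h _.
suff -> : complexify Q (fun=> 0) x = 0 by rewrite addr0.
by apply: complexP; exact: h.
Qed.

Lemma complexify_ae f g : cLp mu 1%:E f -> cmeasurable g -> f = g %[ae mu] ->
  complexify Q f = complexify Q g %[ae mu].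
Proof.
move=> /(cLpP _ (lexx 1))[fr fi] [mr mi] fg.
have rfg : re f = re g %[ae mu] by apply: filterS fg => x /[apply]; rewrite /re => ->.
have ifg : im f = im g %[ae mu] by apply: filterS fg => x /[apply]; rewrite /im => ->.
have h1 := contraction_ae QC fr mr rfg; have h2 := contraction_ae QC fi mi ifg.
apply: filterS2 h1 h2 => x /(_ I) e1 /(_ I) e2 _.
by apply: complexP; rewrite /complexify/= ?e1 ?e2.
Qed.

(** Treating the real and the imaginary part separately costs the factor 2. *)
Lemma complexify_cnrm p f : 1 <= p -> cLp mu p%:E f ->
  cnrm mu p (complexify Q f) <= 2 * cnrm mu p f.
Proof.
move=> p1 fp; have [fr fi] := (cLpP f p1).1 fp.
apply: le_trans (cnrm_le p1 (complexify_cLp p1 fp)) _.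
rewrite mulr_natl lerD//.
  exact: le_trans (contraction_nrm QC p1 fr) (cnrm_re p1 fp).
exact: le_trans (contraction_nrm QC p1 fi) (cnrm_im p1 fp).
Qed.

End complexification.

Lemma markov_iterE d (T : measurableType d) (R : realType) (P : R.-pker T ~> T)
  n (f : T -> R[i]) : iter n (markov_op P) f = complexify (iter n (kmean P)) f.
Proof.
apply/funext => x; apply: complexP => /=.
  exact: (congr1 (fun h => h x) (re_markov_iter P n f)).
exact: (congr1 (fun h => h x) (im_markov_iter P n f)).
Qed.

(** * The dual operator *)

Section dual.
Context d (T : measurableType d) (R : realType).
Variables (mu : probability T R) (P : R.-pker T ~> T).
Variable Pstar : (T -> R[i]) -> (T -> R[i]).
Hypothesis hbi : bistochastic mu P.
Hypothesis hstar : dual_markov mu P Pstar.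
Implicit Types (f g : T -> R) (B : set T).
Local Notation M := (kmean P).

Let le11 : 1 <= 1 :> R. Proof. exact: lexx. Qed.
Let le12 : 1 <= 2 :> R. Proof. by rewrite ler1n. Qed.
Let MC : Lp_contraction mu M. Proof. exact: kmean_contraction. Qed.

(** The dual of a real function is real almost everywhere ([dual_complexify]);
    taking the real part makes it real everywhere. *)
Definition real_dual g : T -> R := re (Pstar (of_real g)).
Local Notation Q := real_dual.

Lemma dual_cLp p (f : T -> R[i]) : 1 <= p -> cLp mu p%:E f ->
  cLp mu p%:E (Pstar f) /\ cnrm mu p (Pstar f) <= cnrm mu p f.
Proof.
move=> p1 fp; have p1' : (1 <= p%:E)%E by rewrite lee_fin.
by have [h1 h2 _] := hstar p1' fp; split=> //; rewrite -lee_fin -!cnormE.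
Qed.

(** The duality tested on the indicator of [B], whose image [M 1_B] is real. *)
Let pairing B (g : T -> R[i]) : measurable B -> cLp mu 1%:E g ->
  \int[mu]_(x in B) re (Pstar g) x = \int[mu]_x (M \1_B x * re g x) /\
  \int[mu]_(x in B) im (Pstar g) x = \int[mu]_x (M \1_B x * im g x).
Proof.
move=> mB g1; have [_ _ /(_ (of_real \1_B))] := hstar (lexx 1%E) g1.
have -> : markov_op P (of_real \1_B) = of_real (M \1_B).
  exact: (markov_iter_of_real P 1 \1_B).
have cB : cLp mu +oo%E (of_real \1_B).
  split.
    split; last exact: measurable_cst.
    exact: (measurable_indic (D := setT) mB).
  rewrite /cnorm unlock; case: ifPn => _; last exact: lt0y.
  apply: (@le_lt_trans _ _ 1%:E); last exact: ltry.
  apply/ess_supP; apply: aeW => x.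
  rewrite -[leLHS]/(`|cabs (of_real \1_B x)|%:E) lee_fin (ger0_norm (cabs_ge0 _)).
  by rewrite cabs_real indicE; case: (_ \in _); rewrite /= ?normr1 ?normr0.
rewrite hoelder_conjugate1 => /(_ cB) E.
have h1 := congr1 (@complex.Re R) E; have h2 := congr1 (@complex.Im R) E.
rewrite /= in h1 h2.
split; rewrite Rintegral_indic.
  transitivity (\int[mu]_x complex.Re (of_real \1_B x * Pstar g x)).
    by apply: eq_Rintegral => x _; rewrite ReCM/= mul0r subr0.
  rewrite -h1; apply: eq_Rintegral => x _.
  by rewrite ReCM/= mul0r subr0.
transitivity (\int[mu]_x complex.Im (of_real \1_B x * Pstar g x)).
  by apply: eq_Rintegral => x _; rewrite ImCM/= mul0r addr0.
rewrite -h2; apply: eq_Rintegral => x _.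
by rewrite ImCM/= mul0r addr0.
Qed.

Lemma eq_ae_Rintegral f g : Lp mu 1 f -> Lp mu 1 g ->
  (forall B, measurable B -> \int[mu]_(x in B) f x = \int[mu]_(x in B) g x) ->
  f = g %[ae mu].
Proof.
move=> f1 g1 h.
have [f1' g1'] := ((Lp1_integrable _ _).1 f1, (Lp1_integrable _ _).1 g1).
have : ae_eq mu setT (EFin \o f) (EFin \o g).
  apply: integral_ae_eq => //; first by case/integrableP : g1'.
  move=> B _ mB; rewrite -[LHS]fineK; last first.
    by apply: integrable_fin_num => //; exact: integrableS f1'.
  rewrite -[RHS]fineK; last first.
    by apply: integrable_fin_num => //; exact: integrableS g1'.
  by congr EFin; exact: h.
by apply: filterS => x /[apply] -[].
Qed.

Lemma real_dual_Rintegral g B : measurable B -> Lp mu 1 g ->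
  \int[mu]_(x in B) Q g x = \int[mu]_x (M \1_B x * g x).
Proof. by move=> mB g1; rewrite (pairing mB (cLp_of_real le11 g1).1).1. Qed.

Let real_dual_L p g : 1 <= p -> Lp mu p g ->
  Lp mu p (Q g) /\ nrm mu p (Q g) <= nrm mu p g.
Proof.
move=> p1 gp; have [cg ncg] := cLp_of_real p1 gp.
have [h1 h2] := dual_cLp p1 cg; split; first exact: ((cLpP _ p1).1 h1).1.
by rewrite -ncg; apply: le_trans h2; exact: cnrm_re.
Qed.

(** An integrable function is determined by its integrals over measurable sets, and
    those of [Q g] depend linearly on [g]. *)
Lemma real_dual_contraction : Lp_contraction mu Q.
Proof.
split=> [p f p1 fp|c f g f1 g1]; first exact: real_dual_L.
have [cf1 _] := LpZ c le11 f1; have [cfg1 _] := LpD le11 cf1 g1.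
have [Qf _] := real_dual_L le11 f1; have [Qg _] := real_dual_L le11 g1.
have [cQf _] := LpZ c le11 Qf; have [cQfg _] := LpD le11 cQf Qg.
apply: eq_ae_Rintegral => //; first exact: (real_dual_L le11 cfg1).1.
move=> B mB; have int h : Lp mu 1 h -> mu.-integrable B (EFin \o h).
  by move=> /Lp1_integrable; apply: integrableS.
rewrite real_dual_Rintegral// RintegralD//; [|exact: int|exact: int].
rewrite RintegralZl//; last exact: int.
rewrite !real_dual_Rintegral//.
have prod h : Lp mu 1 h -> Lp mu 1 (fun x => M \1_B x * h x).
  move=> h1; have mMB : measurable_fun setT (M \1_B).
    by apply: measurable_kmean; exact: (measurable_indic (D := setT) mB).
  apply: (Lp_dom ltr01 h1 _ _).1; first by apply: measurable_funM => //; exact: h1.1.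
  apply: aeW => x; rewrite normrM ler_piMl//.
  have Bx : Lp (P x) 1 \1_B /\ nrm (P x) 1 \1_B <= `|1|.
    apply: (Lp_bounded (prob_kernel x)) => //.
    by apply: aeW => y; rewrite indicE; case: (_ \in _); rewrite /= ?normr1 ?normr0.
  rewrite normr1 in Bx; apply: le_trans Bx.2; rewrite nrm1E.
  by apply: le_normr_Rintegral => //; apply/Lp1_integrable; exact: Bx.1.
have int' h : Lp mu 1 h -> mu.-integrable setT (EFin \o (fun x => M \1_B x * h x)).
  by move=> h1; apply/Lp1_integrable; exact: prod.
rewrite -RintegralZl//; last exact: int'.
rewrite -RintegralD//; last exact: int'.
  by apply: eq_Rintegral => x _; ring.
by apply/Lp1_integrable; exact: (LpZ c le11 (prod _ f1)).1.
Qed.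

Let QC := real_dual_contraction.

Lemma dual_complexify (f : T -> R[i]) : cLp mu 1%:E f ->
  Pstar f = complexify Q f %[ae mu].
Proof.
move=> f1; have [Pf _] := dual_cLp le11 f1.
have [fr fi] := (cLpP f le11).1 f1; have [Pr Pi] := (cLpP _ le11).1 Pf.
have hr : re (Pstar f) = Q (re f) %[ae mu].
  apply: eq_ae_Rintegral => //; first exact: (contraction_Lp QC).
  by move=> B mB; rewrite real_dual_Rintegral// (pairing mB f1).1.
have hi : im (Pstar f) = Q (im f) %[ae mu].
  apply: eq_ae_Rintegral => //; first exact: (contraction_Lp QC).
  by move=> B mB; rewrite real_dual_Rintegral// (pairing mB f1).2.
apply: filterS2 hr hi => x /(_ I) h1 /(_ I) h2 _.
exact: complexP.
Qed.

Lemma dual_iterE n (f : T -> R[i]) p : 1 <= p -> cLp mu p%:E f ->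
  cLp mu p%:E (iter n Pstar f) /\ iter n Pstar f = complexify (iter n Q) f %[ae mu].
Proof.
move=> p1 fp; elim: n => [|n [IH1 IH2]].
  by split=> //; apply: aeW => x _; apply: complexP.
split; first exact: (dual_cLp p1 IH1).1.
have IH3 := cLp_sub1 p1 IH1; have QCn := contraction_iter QC n.
have c := complexify_cLp QCn le11 (cLp_sub1 p1 fp).
by apply: filterS2 (dual_complexify IH3) (complexify_ae QC IH3 c.1 IH2) => x /(_ I) /= ->.
Qed.

Lemma real_dual_ip f g : Lp mu 2 f -> Lp mu 2 g -> ip mu (M f) g = ip mu f (Q g).
Proof.
move=> f2 g2; have le12' : (1 <= 2%:E :> \bar R)%E by rewrite lee_fin.
have [cf _] := cLp_of_real le12 f2; have [cg _] := cLp_of_real le12 g2.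
have [_ _ /(_ (of_real f))] := hstar le12' cg.
rewrite hoelder_conjugate2 => /(_ cf).
have -> : markov_op P (of_real f) = of_real (M f) by exact: (markov_iter_of_real P 1 f).
move=> /(congr1 (@complex.Re R)) /= h; transitivity (\int[mu]_x complex.Re (of_real (M f) x * of_real g x)).
  by apply: eq_Rintegral => x _; rewrite ReCM/= mul0r subr0.
rewrite h; apply: eq_Rintegral => x _.
by rewrite ReCM/= mul0r subr0.
Qed.

Variables (N : nat) (A : nat -> set T).
Hypothesis cyc : cyclic_partition mu P N A.

Let mA j : measurable (A j). Proof. exact: cyclic_measurable cyc j. Qed.
Let A2 j : Lp mu 2 \1_(A j). Proof. exact: Lp_indic. Qed.

(** Integrated over a set [B], this is [cyclic_ip_kmean] for [1_B]. *)
Lemma real_dual_step j : Q \1_(A j.+1) = \1_(A j) %[ae mu].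
Proof.
apply: eq_ae_Rintegral; first exact: (contraction_Lp QC le11 (Lp_indic mu le11 (mA _))).
  exact: Lp_indic.
move=> B mB; rewrite real_dual_Rintegral//; last exact: Lp_indic.
have B2 : Lp mu 2 \1_B by exact: Lp_indic.
rewrite -[LHS]/(ip mu (M \1_B) \1_(A j.+1)) ipC.
by rewrite (cyclic_ip_kmean hbi cyc j B2) ipC Rintegral_indic.
Qed.

(** One step backwards along the cycle is [N - 1] steps forwards. *)
Lemma real_dual_shift j : Q \1_(A j) = \1_(A (j + N.-1)%N) %[ae mu].
Proof.
have NE := prednK (cyclic_gt0 cyc).
have h := contraction_ae QC (Lp_indic mu le11 (mA (j + N)%N))
  (Lp_indic mu le11 (mA j)).1 (cyclic_period cyc j).
have := real_dual_step (j + N.-1)%N; rewrite -addnS NE.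
by apply: filterS2 h => x /(_ I) -> /(_ I).
Qed.

Lemma real_dual_centered f : centered mu A f -> centered mu A (Q f).
Proof.
move=> [f2 h]; split; first exact: (contraction_Lp QC).
move=> j; rewrite -real_dual_ip// -(h j.+1); apply: ip_ae => //.
- exact: (contraction_Lp MC).
- exact: f2.1.
- exact: (cyclic_step cyc j).
- exact: aeW.
Qed.

Lemma real_dual_iter_ip n f g : Lp mu 2 f -> Lp mu 2 g ->
  ip mu (iter n M f) g = ip mu f (iter n Q g).
Proof.
move=> f2 g2; elim: n f f2 => // n IH f f2.
rewrite iterSr IH; last exact: (contraction_Lp MC).
by rewrite real_dual_ip//; exact: (contraction_Lp (contraction_iter QC n)).
Qed.

(** The dual contracts the centered functions as fast as [M] does, since
    [||Q^m f||^2 = <M^m Q^m f, f>]. *)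
Lemma real_dual_decay :
  (forall e, 0 < e -> exists m, forall f, centered mu A f ->
     nrm mu 2 (iter m M f) <= e * nrm mu 2 f) ->
  forall e, 0 < e -> exists m, forall f, centered mu A f ->
     nrm mu 2 (iter m Q f) <= e * nrm mu 2 f.
Proof.
move=> decay e e0; have [m hm] := decay e e0; exists m => f cf.
have cQ : centered mu A (iter m Q f).
  by elim: m {hm} => //= m; exact: real_dual_centered.
set g := iter m Q f in cQ *.
have MgL := contraction_Lp (contraction_iter MC m) le12 cQ.1.
have [g0|g0] := ltP 0 (nrm mu 2 g); last first.
  by apply: le_trans g0 _; rewrite mulr_ge0 ?nrm_ge0// ltW.
rewrite -(ler_pM2l g0) -expr2 nrm2_ip; last exact: cQ.1.
rewrite -{1}/g -real_dual_iter_ip//; [|exact: cQ.1|exact: cf.1].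
apply: le_trans (ler_norm _) _; apply: le_trans (L2_mul MgL cf.1).2 _.
by rewrite mulrA ler_wpM2r ?nrm_ge0// mulrC; exact: hm.
Qed.

End dual.

(** * Convergence of complex functions *)

Section complex_convergence.
Context d (T : measurableType d) (R : realType).
Variables (mu : probability T R).
Variables (N : nat) (A : nat -> set T).
Implicit Types (f g : T -> R[i]) (p : R) (sigma : nat -> nat).

Lemma complexify_transported sigma f :
  complexify (transported mu N A sigma) f =
  fun x => N%:R * \sum_(l < N) cintegral mu (A l) f * cindic R (A (sigma l)) x.
Proof.
have natE : (N%:R : R[i]) = (N%:R : R)%:C%C by rewrite rmorph_nat.
apply/funext => x; apply: complexP.
  rewrite natE ReCM ReC_sum /= mul0r subr0 /transported; congr (_ * _).
  by apply: eq_bigr => l _; rewrite mulr0 subr0.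
rewrite natE ImCM ImC_sum /= mul0r addr0 /transported; congr (_ * _).
by apply: eq_bigr => l _; rewrite mulr0 add0r.
Qed.

Variables (Q : (T -> R) -> (T -> R)) (s : nat).
Hypothesis N0 : (0 < N)%N.
Hypothesis mA : forall j, measurable (A j).
Hypothesis period : forall j, (\1_(A (j + N)%N) : T -> R) = \1_(A j) %[ae mu].
Hypothesis disjoint : forall i j, (i < N)%N -> (j < N)%N -> i <> j ->
  pr mu (A i `&` A j) = 0.
Hypothesis prA : forall j, pr mu (A j) = N%:R^-1.
Hypothesis QC : Lp_contraction mu Q.
Hypothesis QA : forall j, Q \1_(A j) = \1_(A (j + s)%N) %[ae mu].
Hypothesis decay : forall e, 0 < e -> exists m, forall f : T -> R, centered mu A f ->
  nrm mu 2 (iter m Q f) <= e * nrm mu 2 f.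

Lemma transported_cLp sigma p f : 1 <= p -> cLp mu p%:E f ->
  cLp mu p%:E (complexify (transported mu N A sigma) f).
Proof.
move=> p1 /(cLpP _ p1)[fr fi]; apply/cLpP => //.
by split; [exact: (transported_Lp N mA sigma p1 fr).1|
  exact: (transported_Lp N mA sigma p1 fi).1].
Qed.

Lemma cLp_convergence sigma p j f e : 1 <= p -> cLp mu p%:E f -> 0 < e ->
  (forall l n, (\1_(A (l + (n * N + j) * s)%N) : T -> R) = \1_(A (sigma l)) %[ae mu]) ->
  exists n0, forall n, (n0 <= n)%N ->
  cnrm mu p (fun x => complexify (iter (n * N + j) Q) f x -
                      complexify (transported mu N A sigma) f x) <= e.
Proof.
move=> p1 fp e0 hs; have [fr fi] := (cLpP f p1).1 fp.
have p0 : 0 < p by exact: lt_le_trans p1.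
have e2 : 0 < e / 2 by exact: divr_gt0.
have [m1 h1] := Lp_convergence N0 mA period disjoint prA QC QA decay p1 fr e2.
have [m2 h2] := Lp_convergence N0 mA period disjoint prA QC QA decay p1 fi e2.
exists (maxn m1 m2) => n; rewrite geq_max => /andP[m1n m2n].
have le k : (k <= n)%N -> (k <= n * N + j)%N.
  by move=> kn; apply: leq_trans (leq_addr _ _); apply: leq_trans kn _; rewrite leq_pmulr.
have QL := contraction_Lp (contraction_iter QC (n * N + j)) p1.
have tr (u : T -> R) : Lp mu p u ->
  nrm mu p (fun x => iter (n * N + j) Q u x - transported mu N A sigma u x) =
  nrm mu p (fun x => iter (n * N + j) Q u x -
    transported mu N A (fun l => l + (n * N + j) * s)%N u x).
  move=> up; apply: (nrm_ae p0 _ _ _).2.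
  - by apply: (LpB p1 (QL _ up) _).1; exact: (transported_Lp N mA _ p1 up).1.
  - by apply: (LpB p1 (QL _ up) _).1.1; exact: (transported_Lp N mA _ p1 up).1.
  - apply: filterS (transported_congr N u (fun l => hs l n)) => x h _.
    by rewrite (h I).
have dL : cLp mu p%:E (fun x => complexify (iter (n * N + j) Q) f x -
    complexify (transported mu N A sigma) f x).
  apply: cLpB => //; last exact: transported_cLp.
  exact: (complexify_cLp (contraction_iter QC _)).
apply: le_trans (cnrm_le p1 dL) _; rewrite [e]splitr; apply: lerD.
  rewrite [X in nrm mu p X](_ : _ = (fun x => iter (n * N + j) Q (re f) x -
    transported mu N A sigma (re f) x)); last by apply/funext => x; rewrite /re ReCB.
  by rewrite tr//; apply: h1; exact: le.
rewrite [X in nrm mu p X](_ : _ = (fun x => iter (n * N + j) Q (im f) x -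
  transported mu N A sigma (im f) x)); last by apply/funext => x; rewrite /im ImCB.
by rewrite tr//; apply: h2; exact: le.
Qed.

Lemma cnorm_convergence (U : (T -> R[i]) -> (T -> R[i])) sigma p j f :
  1 <= p -> cLp mu p%:E f ->
  (forall n, cLp mu p%:E (iter n U f) /\
             iter n U f = complexify (iter n Q) f %[ae mu]) ->
  (forall l n, (\1_(A (l + (n * N + j) * s)%N) : T -> R) = \1_(A (sigma l)) %[ae mu]) ->
  cnorm mu p%:E (fun x => iter (n * N + j) U f x - N%:R *
    \sum_(l < N) cintegral mu (A l) f * cindic R (A (sigma l)) x)
    @[n --> \oo] --> 0%E.
Proof.
move=> p1 fp hU hs; have p0 : 0 < p by exact: lt_le_trans p1.
have TL := transported_cLp sigma p1 fp; rewrite complexify_transported in TL.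
have dL n : cLp mu p%:E (fun x => iter (n * N + j) U f x - N%:R *
    \sum_(l < N) cintegral mu (A l) f * cindic R (A (sigma l)) x).
  by apply: cLpB => //; exact: (hU _).1.
under eq_fun do rewrite cnormE//.
apply: cvg_EFin; first exact: nearW.
apply/cvgrPdist_le => e e0.
have [n0 hn0] := cLp_convergence p1 fp e0 hs.
exists n0 => // n /= n0n; rewrite sub0r normrN ger0_norm; last exact: nrm_ge0.
apply: le_trans (hn0 n n0n); rewrite complexify_transported.
have cL : cLp mu p%:E (complexify (iter (n * N + j) Q) f).
  exact: (complexify_cLp (contraction_iter QC _)).
rewrite (cnrm_ae p0 (dL n) (cLpB p1 cL TL).1 _).2//.
by apply: filterS (hU (n * N + j)%N).2 => x h _; rewrite (h I).
Qed.

End complex_convergence.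

(** Since the indicators of the classes add up to one, almost every point lies
    in exactly one of them. *)
Lemma cyclic_class d (T : measurableType d) (R : realType) (mu : probability T R)
    (P : R.-pker T ~> T) N A : cyclic_partition mu P N A ->
  {ae mu, forall x, exists2 k, (k < N)%N &
    forall j, (j < N)%N -> \1_(A j) x = (j == k)%:R :> R}.
Proof.
move=> cyc; apply: filterS (cyclic_cover cyc) => x h.
have [k kN Ak] : exists2 k : nat, (k < N)%N & \1_(A k) x != 0 :> R.
  apply: contrapT => H; move: h; rewrite big1 => [/eqP|i _].
    by rewrite eq_sym oner_eq0.
  by apply/eqP; apply: contrapT => /negP Hi; apply: H; exists i.
have Ak1 : \1_(A k) x = 1 :> R.
  by move: Ak; rewrite indicE; case: (_ \in _); rewrite //= eqxx.
exists k => // j jN; have [->//|jk] := eqVneq j k.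
move: h; rewrite (bigD1 (Ordinal kN))//= Ak1 => /(congr1 (fun t : R => t - 1)).
rewrite addrAC subrr add0r => /eqP; rewrite psumr_eq0; last first.
  by move=> i _; rewrite indicE; case: (_ \in _).
by move=> /allP /(_ (Ordinal jN) (mem_index_enum _)) /implyP /(_ jk) /eqP.
Qed.

(** * Unimodular eigenfunctions *)

Section eigenfunctions.
Context d (T : measurableType d) (R : realType).
Variables (mu : probability T R) (P : R.-pker T ~> T).
Hypothesis hbi : bistochastic mu P.
Variables (N : nat) (A : nat -> set T).
Hypothesis cyc : cyclic_partition mu P N A.
Hypothesis decay : forall e, 0 < e -> exists m, forall f : T -> R, centered mu A f ->
  nrm mu 2 (iter m (kmean P) f) <= e * nrm mu 2 f.
Implicit Types (f g : T -> R[i]) (a lambda : R[i]) (p : R) (u v : T -> R).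
Local Notation M := (kmean P).
Local Notation U := (markov_op P).
Local Notation E := (complexify (transported mu N A id)).

Let mu1 : mu setT = 1%E. Proof. exact: probability_setT. Qed.
Let le11 : 1 <= 1 :> R. Proof. exact: lexx. Qed.
Let le12 : 1 <= 2 :> R. Proof. by rewrite ler1n. Qed.
Let MC : Lp_contraction mu M. Proof. exact: kmean_contraction. Qed.
Let mA j : measurable (A j). Proof. exact: cyclic_measurable cyc j. Qed.
Let LpA p j : 1 <= p -> Lp mu p \1_(A j). Proof. by move=> p1; exact: Lp_indic. Qed.

Lemma markov_cLp p f : 1 <= p -> cLp mu p%:E f -> cLp mu p%:E (U f).
Proof. exact: (complexify_cLp MC). Qed.

Lemma markov_lin a f g : cLp mu 1%:E f -> cLp mu 1%:E g ->
  U (fun x => a * f x + g x) = (fun x => a * U f x + U g x) %[ae mu].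
Proof. exact: (complexify_lin MC). Qed.

Lemma markov_ae f g : cLp mu 1%:E f -> cmeasurable g -> f = g %[ae mu] ->
  U f = U g %[ae mu].
Proof. exact: (complexify_ae MC). Qed.

Lemma markovZ a f : cLp mu 1%:E f -> U (fun x => a * f x) = (fun x => a * U f x) %[ae mu].
Proof. exact: (complexifyZ MC). Qed.

Lemma eigen_iter lambda p f n : 1 <= p -> cLp mu p%:E f ->
  U f = (fun x => lambda * f x) %[ae mu] ->
  iter n U f = (fun x => lambda ^+ n * f x) %[ae mu].
Proof.
move=> p1 fp Uf; elim: n => [|n IH]; first by apply: aeW => x _; rewrite expr0 mul1r.
have f1 := cLp_sub1 p1 fp; have cf := (cnrmZ (lambda ^+ n) le11 f1).1.
have Unf := cLp_sub1 p1 (markov_iter_cLp hbi n p1 fp).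
apply: filterS3 (markov_ae Unf cf.1 IH) (markovZ (lambda ^+ n) f1) Uf => x.
by move=> /(_ I) /= -> /(_ I) -> /(_ I) -> _; rewrite mulrA -exprSr.
Qed.

Let period_mul j q : (\1_(A (j + q * N)%N) : T -> R) = \1_(A j) %[ae mu].
Proof. exact: period_mul (cyclic_period cyc) j q. Qed.

(** On the eigenfunction [P^(nN)] is the multiplication by [lambda^(nN)]; it also
    converges to the conditional expectation given the cycle. *)
Lemma eigen_approx lambda p f e : 1 <= p -> cLp mu p%:E f ->
  U f = (fun x => lambda * f x) %[ae mu] -> 0 < e ->
  exists n0, forall n, (n0 <= n)%N ->
    cnrm mu p (fun x => lambda ^+ (n * N) * f x - E f x) <= e.
Proof.
move=> p1 fp Uf e0; have p0 : 0 < p by exact: lt_le_trans p1.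
have QA j : M \1_(A j) = \1_(A (j + 1)%N) %[ae mu].
  by rewrite addn1; exact: (cyclic_step cyc j).
have hs l n : (\1_(A (l + (n * N + 0) * 1)%N) : T -> R) = \1_(A (id l)) %[ae mu].
  by rewrite muln1 addn0; exact: period_mul.
have [n0 h0] := cLp_convergence (cyclic_gt0 cyc) mA (cyclic_period cyc)
  (cyclic_disjoint cyc) (cyclic_pr cyc) MC QA decay p1 fp e0 hs.
exists n0 => n /h0; rewrite addn0 -markov_iterE; apply: le_trans.
have EL := transported_cLp N mA id p1 fp.
have IL := markov_iter_cLp hbi (n * N) p1 fp.
rewrite (cnrm_ae p0 (cLpB p1 IL EL) (cLpB p1 (cnrmZ _ p1 fp).1 EL).1 _).2//.
by apply: filterS (eigen_iter (n * N) p1 fp Uf) => x h _; rewrite (h I).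
Qed.

(** The powers [lambda^(nN)] form a convergent, hence constant sequence as soon as
    [f] is not zero. *)
Lemma eigen_trivial lambda p f : 1 <= p -> cLp mu p%:E f ->
  U f = (fun x => lambda * f x) %[ae mu] -> cabs lambda = 1 -> lambda ^+ N != 1 ->
  f = cst 0 %[ae mu].
Proof.
move=> p1 fp Uf l1 lN; apply: (cnrm_eq0 p1 fp); rewrite leNgt; apply/negP => nf.
pose c := cabs (1 - lambda ^+ N).
have c0 : 0 < c.
  rewrite lt_neqAle cabs_ge0 andbT eq_sym; apply: contra lN => /eqP /cabs_eq0 /eqP.
  by rewrite subr_eq0 eq_sym.
have e0 : 0 < c * cnrm mu p f / 4 by rewrite divr_gt0// mulr_gt0.
have [n0 h0] := eigen_approx p1 fp Uf e0.
have h1 := h0 n0 (leqnn _); have h2 := h0 n0.+1 (leqnSn _).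
have EL := transported_cLp N mA id p1 fp.
have ZL a := (cnrmZ a p1 fp).1.
pose a := lambda ^+ (n0 * N) * (1 - lambda ^+ N).
have : cnrm mu p (fun x => a * f x) <= c * cnrm mu p f / 4 + c * cnrm mu p f / 4.
  apply: le_trans (lerD h1 h2); apply: cnrm_tri => //.
  - by apply: cLpB.
  - by apply: cLpB.
  move=> x; rewrite -(cabsN (lambda ^+ (n0.+1 * N) * f x - E f x)).
  apply: le_trans (cabsD _ _); rewrite /a mulSn exprD le_eqVlt; apply/orP; left.
  by apply/eqP; congr cabs; ring.
rewrite (cnrmZ a p1 fp).2 /a cabsM cabsX l1 expr1n mul1r -/c.
set y := c * cnrm mu p f; have y0 : 0 < y by exact: mulr_gt0.
lra.
Qed.

Lemma eigen_average lambda p f : 1 <= p -> cLp mu p%:E f ->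
  U f = (fun x => lambda * f x) %[ae mu] -> lambda ^+ N = 1 -> f = E f %[ae mu].
Proof.
move=> p1 fp Uf lN; have EL := transported_cLp N mA id p1 fp.
have : (fun x => f x - E f x) = cst 0 %[ae mu].
  apply: (cnrm_eq0 p1); first exact: cLpB.
  rewrite leNgt; apply/negP => n0.
  have e0 : 0 < cnrm mu p (fun x => f x - E f x) / 2 by exact: divr_gt0.
  have [m0 /(_ m0 (leqnn _))] := eigen_approx p1 fp Uf e0.
  rewrite mulnC exprM lN expr1n; under eq_fun do rewrite mul1r.
  by rewrite leNgt ltr_pdivrMr// ltr_pMr// ltr1n.
by apply: filterS => x /[apply] /eqP; rewrite subr_eq0 => /eqP.
Qed.

Lemma transported_bounded sigma p u : 1 <= p -> Lp mu p (transported mu N A sigma u).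
Proof.
move=> p1; apply: (LpZ _ p1 _).1.
by apply: (Lp_sum N p1 (F := fun l x => (\int[mu]_(y in A l) u y) * \1_(A (sigma l)) x) _).1
  => l; exact: (LpZ _ p1 (LpA _ p1)).1.
Qed.

Lemma transported_class k u x : (k < N)%N ->
  (forall j, (j < N)%N -> \1_(A j) x = (j == k)%:R :> R) ->
  transported mu N A id u x = N%:R * ip mu \1_(A k) u.
Proof.
move=> kN h; rewrite /transported (bigD1 (Ordinal kN))//= h// eqxx mulr1.
rewrite big1 ?addr0 => [|l lk]; first by rewrite Rintegral_indic.
by rewrite h// (_ : (l == k :> nat) = false) ?mulr0//; apply/negbTE.
Qed.

(** Each step along the cycle multiplies the average of the eigenfunction by
    [lambda^-1], which has modulus 1. *)
Lemma eigen_modulus lambda p f : 1 <= p -> cLp mu p%:E f ->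
  U f = (fun x => lambda * f x) %[ae mu] -> cabs lambda = 1 -> lambda ^+ N = 1 ->
  exists c : R, (fun x => cabs (f x)) = cst c %[ae mu].
Proof.
move=> p1 fp Uf l1 lN; have fE := eigen_average p1 fp Uf lN.
have f1 := cLp_sub1 p1 fp.
(* unlike [f], which is only in [L^p], the representative [E f] is bounded *)
pose g := E f.
have g2 q : 1 <= q -> cLp mu q%:E g.
  by move=> q1; apply/cLpP => //; split; exact: transported_bounded.
have Ug : U g = (fun x => lambda * g x) %[ae mu].
  apply: filterS3 (markov_ae f1 (g2 1 le11).1 fE) Uf fE => x.
  by move=> /(_ I) <- /(_ I) -> /(_ I) ->.
have gE := eigen_average le12 (g2 2 le12) Ug lN.
have [u2 v2] := (cLpP _ le12).1 (g2 2 le12).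
set u := re g in u2; set v := im g in v2.
pose a := complex.Re lambda; pose b := complex.Im lambda.
have lin c c' (w w' : T -> R) l : Lp mu 2 w -> Lp mu 2 w' ->
    ip mu \1_(A l) (fun x => c * w x + c' * w' x) =
    c * ip mu \1_(A l) w + c' * ip mu \1_(A l) w'.
  move=> w2 w'2; have [cw' _] := LpZ c' le12 w'2.
  rewrite ipC ip_lin//; last exact: LpA.
  by rewrite (ipC _ _ w) ipZ ?(ipC _ w')//; exact: LpA.
have shift c c' (w w' : T -> R) l : Lp mu 2 w -> Lp mu 2 w' ->
    M w = (fun x => c * w x + c' * w' x) %[ae mu] ->
    ip mu \1_(A l) w = c * ip mu \1_(A l.+1) w + c' * ip mu \1_(A l.+1) w'.
  move=> w2 w'2 Mw; rewrite -lin// -(cyclic_ip_kmean hbi cyc)//.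
  apply: ip_ae => //; [exact: LpA|exact: (contraction_Lp MC)| |exact: aeW].
  by apply: (LpD le12 (LpZ c le12 w2).1 (LpZ c' le12 w'2).1).1.1.
have su l : ip mu \1_(A l) u = a * ip mu \1_(A l.+1) u + (- b) * ip mu \1_(A l.+1) v.
  apply: shift => //; apply: filterS Ug => x /[apply] /(congr1 (@complex.Re R)).
  by rewrite ReCM => h; rewrite [LHS]h; rewrite mulNr.
have sv l : ip mu \1_(A l) v = a * ip mu \1_(A l.+1) v + b * ip mu \1_(A l.+1) u.
  apply: shift => //; apply: filterS Ug => x /[apply] /(congr1 (@complex.Im R)).
  by rewrite ImCM => h; rewrite [LHS]h.
have ab : a ^+ 2 + b ^+ 2 = 1.
  by rewrite -[RHS](expr1n _ 2) -l1 cabsE sqr_sqrtr// addr_ge0// sqr_ge0.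
have const l : ip mu \1_(A l) u ^+ 2 + ip mu \1_(A l) v ^+ 2 =
    ip mu \1_(A 0%N) u ^+ 2 + ip mu \1_(A 0%N) v ^+ 2.
  elim: l => // l <-; rewrite (su l) (sv l).
  set x := ip _ _ u; set y := ip _ _ v; rewrite -[LHS]mul1r -ab; ring.
exists (Num.sqrt (N%:R ^+ 2 * (ip mu \1_(A 0%N) u ^+ 2 + ip mu \1_(A 0%N) v ^+ 2))).
apply: filterS3 (cyclic_class cyc) fE gE => x [k kN h] /(_ I) -> /(_ I) gx _.
rewrite -/g gx cabsE /cst -(const k).
rewrite -[complex.Re _]/(transported mu N A id u x) -[complex.Im _]/(transported mu N A id v x).
by rewrite !(transported_class _ kN h); congr Num.sqrt; ring.
Qed.

(** The value on [A l] is [lambda^(-l)], written with a nonnegative exponent as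
    [lambda^N = 1]. *)
Definition cyclic_eigenfunction lambda : T -> R[i] :=
  fun x => \sum_(l < N) lambda ^+ (N - l) * cindic R (A l) x.

Lemma cyclic_eigenfunction_class lambda :
  {ae mu, forall x, exists k, cyclic_eigenfunction lambda x = lambda ^+ k}.
Proof.
apply: filterS (cyclic_class cyc) => x [k kN h]; exists (N - k)%N.
have h' j : (j < N)%N -> cindic R (A j) x = (j == k)%:R.
  by move=> jN; rewrite /cindic h// rmorph_nat.
rewrite /cyclic_eigenfunction (bigD1 (Ordinal kN))//= h'// eqxx mulr1.
rewrite big1 ?addr0// => l lk.
by rewrite h'// (_ : (l == k :> nat) = false) ?mulr0//; apply/negbTE.
Qed.

Lemma cyclic_eigenfunctionP lambda p : 1 <= p -> lambda ^+ N = 1 ->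
  eigenfunction mu p%:E U lambda (cyclic_eigenfunction lambda).
Proof.
move=> p1 lN; have l1 := cabs_unity_root (cyclic_gt0 cyc) lN.
pose r l := complex.Re (lambda ^+ (N - l)); pose s l := complex.Im (lambda ^+ (N - l)).
have re_ind sigma (x : T) : complex.Re (\sum_(l < N) lambda ^+ (N - l) * cindic R (A (sigma l)) x) =
    \sum_(l < N) r l * \1_(A (sigma l)) x.
  by rewrite ReC_sum; apply: eq_bigr => l _; rewrite ReCM/= mulr0 subr0.
have im_ind sigma (x : T) : complex.Im (\sum_(l < N) lambda ^+ (N - l) * cindic R (A (sigma l)) x) =
    \sum_(l < N) s l * \1_(A (sigma l)) x.
  by rewrite ImC_sum; apply: eq_bigr => l _; rewrite ImCM/= mulr0 add0r.
pose f := cyclic_eigenfunction lambda.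
have reE : re f = fun x => \sum_(l < N) r l * \1_(A l) x.
  by apply/funext => x; exact: (re_ind id x).
have imE : im f = fun x => \sum_(l < N) s l * \1_(A l) x.
  by apply/funext => x; exact: (im_ind id x).
have fp q : 1 <= q -> cLp mu q%:E f.
  move=> q1; apply/cLpP => //; rewrite reE imE; split.
  - by apply: (Lp_sum N q1 (F := fun l x => r l * \1_(A l) x) _).1
      => l; exact: (LpZ _ q1 (LpA _ q1)).1.
  - by apply: (Lp_sum N q1 (F := fun l x => s l * \1_(A l) x) _).1
      => l; exact: (LpZ _ q1 (LpA _ q1)).1.
split; first exact: fp.
  move=> f0; have : pr mu setT = 0.
    apply/pr0_ae => //; apply: filterS2 f0 (cyclic_eigenfunction_class lambda) => x.
    move=> /(_ I) -> [k /(congr1 (@cabs R))].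
    by rewrite cabsX l1 expr1n (cabs_real 0) normr0 => /eqP; rewrite eq_sym oner_eq0.
  by rewrite /pr mu1 => /eqP; rewrite oner_eq0.
have step : {ae mu, forall x, forall j, M \1_(A j) x = \1_(A j.+1) x}.
  by apply: ae_foralln => j; apply: filterS (cyclic_step cyc j) => x; exact.
have hr := contraction_sum MC N r (fun l => LpA l le11).
have hs := contraction_sum MC N s (fun l => LpA l le11).
have hN := cyclic_period cyc 0.
have Uf : U f = (fun x => \sum_(l < N) lambda ^+ (N - l) * cindic R (A l.+1) x) %[ae mu].
  apply: filterS3 hr hs step => x /(_ I) er /(_ I) es st _; apply: complexP.
    rewrite -[LHS]/(M (re f) x) reE er (re_ind S x).
    by apply: eq_bigr => l _; rewrite st.
  rewrite -[LHS]/(M (im f) x) imE es (im_ind S x).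
  by apply: eq_bigr => l _; rewrite st.
apply: filterS2 Uf hN => x /(_ I) -> /(_ I); rewrite add0n => h0 _.
rewrite /cyclic_eigenfunction.
have [n NE] : exists n, N = n.+1 by exists N.-1; rewrite prednK ?(cyclic_gt0 cyc).
move: h0 lN; rewrite NE => h0 lN.
rewrite big_ord_recr big_ord_recl /= mulrDr addrC; congr (_ + _).
  rewrite subSnn subn0 lN mul1r expr1 /cindic; congr (_ * _).
  by rewrite h0.
rewrite mulr_sumr; apply: eq_bigr => l _.
by rewrite /bump/= add1n subSS subSn ?exprS ?mulrA// ltnW.
Qed.

End eigenfunctions.

(** * The resolvent at unimodular points *)

Section neumann.
Context d (T : measurableType d) (R : realType).
Variables (mu : probability T R).
Implicit Types (f g : T -> R[i]) (a : R[i]).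

Let mu1 : mu setT = 1%E. Proof. exact: probability_setT. Qed.
Let le12 : 1 <= 2 :> R. Proof. by rewrite ler1n. Qed.
Let lt02 : 0 < 2 :> R. Proof. by rewrite ltr0n. Qed.
Local Notation cL2 := (cLp mu 2%:E).
Local Notation c2 := (cnrm mu 2).

Lemma cnrmB_le p f g : 1 <= p -> cLp mu p%:E f -> cLp mu p%:E g ->
  cnrm mu p (fun x => f x - g x) <= cnrm mu p f + cnrm mu p g.
Proof.
move=> p1 fp gp; apply: cnrm_tri => //; first exact: cLpB.
by move=> x; rewrite -(cabsN (g x)); exact: cabsD.
Qed.

Lemma cnrmD_le p f g : 1 <= p -> cLp mu p%:E f -> cLp mu p%:E g ->
  cLp mu p%:E (fun x => f x + g x) /\
  cnrm mu p (fun x => f x + g x) <= cnrm mu p f + cnrm mu p g.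
Proof.
move=> p1 fp gp; have fg : cLp mu p%:E (fun x => f x + g x).
  by have := cLp_lin 1 p1 fp gp; under eq_fun do rewrite mul1r.
by split=> //; apply: cnrm_tri => // x; exact: cabsD.
Qed.

Lemma cL2_sum (h : nat -> T -> R[i]) n : (forall i, cL2 (h i)) ->
  cL2 (fun x => \sum_(i < n) h i x).
Proof.
move=> h2; elim: n => [|n IH].
  under eq_fun do rewrite big_ord0.
  by apply/cLpP => //; split; exact: (Lp0 mu le12).1.
by under eq_fun do rewrite big_ord_recr/=; exact: (cnrmD_le le12 _ _).1.
Qed.

Lemma cL2_series (h : nat -> T -> R[i]) C r : 0 <= r < 1 ->
  (forall n, cL2 (h n)) -> (forall n, c2 (h n) <= C * r ^+ n) ->
  exists2 s, cL2 s & forall n,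
    c2 (fun x => s x - \sum_(i < n) h i x) <= 2 * (C * r ^+ n / (1 - r)).
Proof.
move=> r01 h2 hC.
have hr n : Lp mu 2 (re (h n)) by exact: ((cLpP _ le12).1 (h2 n)).1.
have hi n : Lp mu 2 (im (h n)) by exact: ((cLpP _ le12).1 (h2 n)).2.
have [|u u2 hu] := L2_series mu1 r01 hr (C := C).
  by move=> n; apply: le_trans (hC n); exact: cnrm_re.
have [|v v2 hv] := L2_series mu1 r01 hi (C := C).
  by move=> n; apply: le_trans (hC n); exact: cnrm_im.
have sL : cL2 (fun x => u x +i* v x)%C by apply/cLpP.
exists (fun x => u x +i* v x)%C => // n.
apply: le_trans (cnrm_le le12 (cLpB le12 sL (cL2_sum n h2))) _.
rewrite mulr_natl; apply: lerD.
  apply: le_trans (hu n); rewrite le_eqVlt; apply/orP; left; apply/eqP.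
  by congr nrm; apply/funext => x; rewrite /re ReCB ReC_sum.
apply: le_trans (hv n); rewrite le_eqVlt; apply/orP; left; apply/eqP.
by congr nrm; apply/funext => x; rewrite /im ImCB ImC_sum.
Qed.

Variables (W : (T -> R[i]) -> (T -> R[i])) (D : (T -> R[i]) -> Prop) (K r : R).
Hypothesis r01 : 0 <= r < 1.
Hypothesis Wlin : forall a f g, cL2 f -> cL2 g ->
  W (fun x => a * f x + g x) = (fun x => a * W f x + W g x) %[ae mu].
Hypothesis WL : forall f, cL2 f -> cL2 (W f) /\ c2 (W f) <= K * c2 f.
Hypothesis DL : forall g, D g -> cL2 g.
Hypothesis DW : forall g, D g -> D (W g) /\ c2 (W g) <= r * c2 g.

(** The Neumann series, for an operator that contracts strictly only on an
    invariant subspace. *)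
Lemma neumann_series g : D g ->
  exists s, [/\ cL2 s, c2 s <= 2 / (1 - r) * c2 g &
    (fun x => s x - W s x) = g %[ae mu]].
Proof.
move=> Dg; have g2 := DL Dg; have [r0 r1] := andP r01.
pose h n := iter n W g.
have hD n : D (h n) by elim: n => //= n /DW[].
have h2 n : cL2 (h n) by exact: DL.
have hC n : c2 (h n) <= c2 g * r ^+ n.
  elim: n => [|n IH]; first by rewrite expr0 mulr1.
  by apply: le_trans (DW (hD n)).2 _; rewrite exprS mulrCA ler_wpM2l.
have [s s2 hs] := cL2_series r01 h2 hC.
exists s; split=> //.
  have := hs 0; under eq_fun do rewrite big_ord0 subr0.
  by rewrite expr0 mulr1 [_ * c2 g]mulrAC mulrA.
pose S n x := \sum_(i < n) h i x.
have S2 n : cL2 (S n) by exact: cL2_sum.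
have W0 : W (fun=> 0) = cst 0 %[ae mu].
  have z2 : cL2 (fun=> 0) by apply/cLpP => //; split; exact: (Lp0 mu le12).1.
  have := Wlin 1 z2 z2.
  have -> : (fun _ : T => 1 * 0 + 0 : R[i]) = fun=> 0.
    by apply/funext => x; rewrite mulr0 addr0.
  apply: filterS => x /[apply]; rewrite mul1r => /eqP.
  by rewrite -subr_eq subrr => /eqP <-.
have telescope n : (fun x => S n x - W (S n) x) = (fun x => g x - h n x) %[ae mu].
  elim: n => [|n IH].
    have -> : S 0 = fun=> 0 by apply/funext => x; rewrite /S big_ord0.
    by apply: filterS W0 => x /[apply] ->; rewrite /h /= !subrr.
  have SE : S n.+1 = (fun x => 1 * h n x + S n x).
    by apply/funext => x; rewrite /S big_ord_recr/= mul1r addrC.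
  have := Wlin 1 (h2 n) (S2 n); rewrite -SE.
  apply: filterS2 IH => x /(_ I) IH /(_ I) -> _.
  rewrite {1}SE !mul1r -[W (h n)]/(h n.+1).
  have -> : h n x + S n x - (h n.+1 x + W (S n) x) =
    S n x - W (S n) x + h n x - h n.+1 x by ring.
  by rewrite IH; ring.
have WsL := (WL s2).1; have sWL := cLpB le12 s2 WsL; have dL := cLpB le12 sWL g2.
suff : c2 (fun x => s x - W s x - g x) <= 0.
  move=> /(cnrm_eq0 le12 dL); apply: filterS => x /[apply] /eqP.
  by rewrite subr_eq0 => /eqP.
have K0' : 0 <= `|K| by exact: normr_ge0.
pose B := (1 + `|K|) * (2 * (c2 g / (1 - r))) + c2 g.
have B0 : 0 <= B.
  rewrite /B addr_ge0 ?cnrm_ge0// mulr_ge0 ?addr_ge0// mulr_ge0// divr_ge0 ?cnrm_ge0//.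
  by rewrite subr_ge0 ltW.
have bound n : c2 (fun x => s x - W s x - g x) <= B * r ^+ n.
  pose t x := s x - S n x; have t2 : cL2 t by exact: cLpB.
  have [Wt Wtn] := WL t2; have tWL := cLpB le12 t2 Wt.
  have e : (fun x => s x - W s x - g x) = (fun x => t x - W t x - h n x) %[ae mu].
    have sE : s = (fun x => 1 * t x + S n x).
      by apply/funext => x; rewrite /t mul1r subrK.
    have := Wlin 1 t2 (S2 n); rewrite -sE.
    apply: filterS2 (telescope n) => x /(_ I) e1 /(_ I) e2 _.
    rewrite e2 mul1r {1}sE mul1r.
    have -> : t x + S n x - (W t x + W (S n) x) - g x =
      t x - W t x + (S n x - W (S n) x) - g x by ring.
    by rewrite e1; ring.
  rewrite -(cnrm_ae lt02 dL (cLpB le12 tWL (h2 n)).1 e).2.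
  apply: le_trans (cnrmB_le le12 tWL (h2 n)) _.
  rewrite /B mulrDl; apply: lerD; last exact: hC.
  apply: le_trans (cnrmB_le le12 t2 Wt) _.
  apply: (@le_trans _ _ ((1 + `|K|) * c2 t)).
    rewrite mulrDl mul1r lerD2l; apply: le_trans Wtn _.
    by rewrite ler_wpM2r ?cnrm_ge0// ler_norm.
  rewrite -mulrA ler_wpM2l ?addr_ge0//; apply: le_trans (hs n) _.
  by rewrite -[leRHS]mulrA [_ / _ * _]mulrAC.
rewrite leNgt; apply/negP => pos.
have e0 : 0 < c2 (fun x => s x - W s x - g x) / (B + 1) / 2.
  by rewrite divr_gt0// divr_gt0// ltr_wpDl.
have [n hn] := expr_small r01 e0.
have := le_trans (bound n) (ler_wpM2l B0 hn).
set y := c2 _ in pos *; move=> h'.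
have B1 : 0 < B + 1 by rewrite ltr_wpDl.
have : B * (y / (B + 1) / 2) <= y / 2.
  rewrite !mulrA ler_pM2r ?invr_gt0// ler_pdivrMr// mulrDr mulr1 mulrC lerDl.
  exact: ltW.
move=> /(le_trans h'); rewrite ler_pdivlMr// mulr_natr mulr2n; lra.
Qed.

End neumann.

Section resolvent.
Context d (T : measurableType d) (R : realType).
Variables (mu : probability T R) (P : R.-pker T ~> T).
Hypothesis hbi : bistochastic mu P.
Variables (N : nat) (A : nat -> set T).
Hypothesis cyc : cyclic_partition mu P N A.
Hypothesis decay : forall e, 0 < e -> exists m, forall f : T -> R, centered mu A f ->
  nrm mu 2 (iter m (kmean P) f) <= e * nrm mu 2 f.
Implicit Types (f g h : T -> R[i]) (a lambda : R[i]) (u v : T -> R).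
Local Notation M := (kmean P).
Local Notation U := (markov_op P).
Local Notation E := (complexify (transported mu N A id)).
Local Notation cL2 := (cLp mu 2%:E).
Local Notation c2 := (cnrm mu 2).

Let le11 : 1 <= 1 :> R. Proof. exact: lexx. Qed.
Let le12 : 1 <= 2 :> R. Proof. by rewrite ler1n. Qed.
Let MC : Lp_contraction mu M. Proof. exact: kmean_contraction. Qed.
Let MCn n : Lp_contraction mu (iter n M). Proof. exact: contraction_iter. Qed.
Let mA j : measurable (A j). Proof. exact: cyclic_measurable cyc j. Qed.
Let LpA p j : 1 <= p -> Lp mu p \1_(A j). Proof. by move=> p1; exact: Lp_indic. Qed.

Let iter_cL2 n f : cL2 f -> cL2 (iter n U f).
Proof. exact: markov_iter_cLp. Qed.

Let iter_c2 n f : cL2 f -> c2 (iter n U f) <= 2 * c2 f.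
Proof. by rewrite markov_iterE; exact: (complexify_cnrm (MCn n)). Qed.

Let iter_lin n a f g : cL2 f -> cL2 g -> iter n U (fun x => a * f x + g x) =
  (fun x => a * iter n U f x + iter n U g x) %[ae mu].
Proof.
move=> f2 g2; rewrite !markov_iterE.
by apply: (complexify_lin (MCn n)); exact: (cLp_sub1 le12).
Qed.

Lemma centered_lin c c' u v : centered mu A u -> centered mu A v ->
  centered mu A (fun x => c * u x + c' * v x).
Proof.
move=> [u2 hu] [v2 hv]; have [cv _] := LpZ c' le12 v2.
split=> [|j]; first exact: (LpD le12 (LpZ c le12 u2).1 cv).1.
have A2 := LpA j le12.
by rewrite ipC ip_lin// [ip mu u _]ipC hu mulr0 add0r ipZ// [ip mu v _]ipC hv mulr0.
Qed.

(** [lambda - U] divides [lambda^m - U^m], with quotient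
    [sum_(i < m) lambda^(m-1-i) U^i]. *)
Let resolvent_power lambda m : cabs lambda = 1 ->
  exists2 K : R, 0 <= K & forall h', cL2 h' -> exists h, [/\ cL2 h, c2 h <= K * c2 h' &
    (fun x => lambda * h x - U h x) =
    (fun x => lambda ^+ m * h' x - iter m U h' x) %[ae mu]].
Proof.
move=> l1; elim: m => [|m [K K0 IH]].
  exists 0 => // h' h'2; exists (fun=> 0); have z2 := cLp0 mu le12; split=> //.
    have -> : (fun _ : T => 0 : R[i]) = fun=> 0 * 0 by apply/funext => x; rewrite mulr0.
    by rewrite (cnrmZ 0 le12 z2).2 (cabs_real 0) normr0 !mul0r.
  have := markovZ hbi 0 (cLp_sub1 le12 z2).
  have -> : (fun _ : T => 0 * 0 : R[i]) = fun=> 0 by apply/funext => x; rewrite mulr0.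
  by apply: filterS => x /[apply] ->; rewrite mulr0 mul0r expr0 mul1r !subrr.
exists (K + 2); first exact: addr_ge0.
move=> h' h'2; have [h [h2 hK hE]] := IH _ h'2.
have ih2 := iter_cL2 m h'2.
exists (fun x => lambda * h x + iter m U h' x); split.
- exact: cLp_lin.
- have [lh lhn] := cnrmZ lambda le12 h2.
  apply: le_trans (cnrmD_le le12 lh ih2).2 _.
  by rewrite lhn l1 mul1r mulrDl lerD// iter_c2.
- apply: filterS2 (markov_lin hbi lambda (cLp_sub1 le12 h2) (cLp_sub1 le12 ih2)) hE => x.
  move=> /(_ I) -> /(_ I) /(congr1 (fun z => lambda * z)) e _.
  have -> : lambda * (lambda * h x + iter m U h' x) -
      (lambda * U h x + U (iter m U h') x) =
    lambda * (lambda * h x - U h x) + lambda * iter m U h' x - U (iter m U h') x.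
    by ring.
  by rewrite e exprS iterS; ring.
Qed.

Let transported_c2 f : cL2 f -> c2 (E f) <= 2 * (N%:R * N%:R) * c2 f.
Proof.
move=> f2; have [fr fi] := (cLpP f le12).1 f2.
have E2 := transported_cLp N mA id le12 f2.
apply: le_trans (cnrm_le le12 E2) _.
have -> : 2 * (N%:R * N%:R) * c2 f = N%:R * N%:R * c2 f + N%:R * N%:R * c2 f :> R by ring.
apply: lerD.
  apply: le_trans (transported_Lp N mA id le12 fr).2 _.
  by rewrite ler_wpM2l ?mulr_ge0// cnrm_re.
apply: le_trans (transported_Lp N mA id le12 fi).2 _.
by rewrite ler_wpM2l ?mulr_ge0// cnrm_im.
Qed.

Let iter_average q f : cL2 f -> iter (q * N) U (E f) = E f %[ae mu].
Proof.
move=> f2; have [fr fi] := (cLpP f le11).1 (cLp_sub1 le12 f2).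
have QA j : M \1_(A j) = \1_(A (j + 1)%N) %[ae mu].
  by rewrite addn1; exact: (cyclic_step cyc j).
have fix_ u : Lp mu 1 u ->
    iter (q * N) M (transported mu N A id u) = transported mu N A id u %[ae mu].
  move=> u1; apply: filterS2 (iter_transported N mA MC QA (q * N) u1)
    (transported_congr N u (_ : forall l, (\1_(A (l + q * N * 1)%N) : T -> R) =
      \1_(A (id l)) %[ae mu])) => [x /(_ I) -> /(_ I) ->//|l].
  by rewrite muln1; exact: (period_mul (cyclic_period cyc)).
rewrite markov_iterE; apply: filterS2 (fix_ _ fr) (fix_ _ fi) => x /(_ I) e1 /(_ I) e2 _.
exact: complexP.
Qed.

(** On the span of the cycle the power [U^m] is the identity when [N] divides
    [m]; on the centered functions a Neumann series inverts [lambda^m - U^m]. *)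
Let resolvent_block lambda m : cabs lambda = 1 -> lambda ^+ m != 1 -> (N %| m)%N ->
  (forall u, centered mu A u -> nrm mu 2 (iter m M u) <= 1 / 4 * nrm mu 2 u) ->
  exists2 K : R, 0 <= K & forall f, cL2 f -> exists h, [/\ cL2 h, c2 h <= K * c2 f &
    (fun x => lambda ^+ m * h x - iter m U h x) = f %[ae mu]].
Proof.
move=> l1 lm /dvdnP[q qE] small.
set w := lambda ^+ m in lm *.
have w1 : cabs w = 1 by rewrite cabsX l1 expr1n.
have w0 : w != 0.
  by apply/eqP => w0; move: w1; rewrite w0 (cabs_real 0) normr0 => /eqP; rewrite eq_sym oner_eq0.
have wV1 : cabs w^-1 = 1.
  by rewrite -[LHS]mulr1 -w1 -cabsM mulVf// (cabs_real 1) normr1.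
pose W f x := w^-1 * iter m U f x.
pose D g := centered mu A (re g) /\ centered mu A (im g).
have DL g : D g -> cL2 g by move=> [[gr _] [gi _]]; exact/cLpP.
have WL f : cL2 f -> cL2 (W f) /\ c2 (W f) <= 2 * c2 f.
  move=> f2; have [h1 h2] := cnrmZ w^-1 le12 (iter_cL2 m f2); split=> //.
  by rewrite h2 wV1 mul1r; exact: iter_c2.
have Wlin a f g : cL2 f -> cL2 g ->
    W (fun x => a * f x + g x) = (fun x => a * W f x + W g x) %[ae mu].
  move=> f2 g2; apply: filterS (iter_lin m a f2 g2) => x /[apply] e.
  by rewrite /W e mulrDr mulrCA.
have DW g : D g -> D (W g) /\ c2 (W g) <= 1 / 2 * c2 g.
  move=> Dg; have g2 := DL _ Dg; have [gr gi] := Dg.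
  have [ir ii] := (centered_iter hbi cyc m gr, centered_iter hbi cyc m gi).
  split.
    split.
      have -> : re (W g) = (fun x => complex.Re w^-1 * iter m M (re g) x +
          (- complex.Im w^-1) * iter m M (im g) x).
        by apply/funext => x; rewrite /W /re ReCM markov_iterE/= mulNr.
      exact: centered_lin.
    have -> : im (W g) = (fun x => complex.Re w^-1 * iter m M (im g) x +
        complex.Im w^-1 * iter m M (re g) x).
      by apply/funext => x; rewrite /W /im ImCM markov_iterE/=.
    exact: centered_lin.
  rewrite (cnrmZ w^-1 le12 (iter_cL2 m g2)).2 wV1 mul1r.
  apply: le_trans (cnrm_le le12 (iter_cL2 m g2)) _.
  rewrite re_markov_iter im_markov_iter.
  have := lerD (small _ gr) (small _ gi).
  have := cnrm_re le12 g2; have := cnrm_im le12 g2.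
  lra.
have r01 : (0 <= 1 / 2 :> R) && (1 / 2 < 1 :> R).
  by rewrite divr_ge0//= ltr_pdivrMr// mul1r ltr1n.
pose K1 : R := 2 * (N%:R * N%:R); have K10 : 0 <= K1 by rewrite !mulr_ge0.
pose K := cabs (w - 1)^-1 * K1 + 2 / (1 - 1 / 2) * (1 + K1).
have h40 : 0 <= 2 / (1 - 1 / 2) :> R.
  by rewrite divr_ge0// subr_ge0 ltW//; case/andP: r01.
exists K; first by rewrite addr_ge0// mulr_ge0 ?cabs_ge0// addr_ge0.
move=> f f2; have [fr fi] := (cLpP f le12).1 f2.
have E2 := transported_cLp N mA id le12 f2.
pose g x := f x - E f x.
have Dg : D g.
  split.
    have -> : re g = (fun x => re f x - transported mu N A id (re f) x).
      by apply/funext => x; rewrite /re /g ReCB.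
    exact: (centered_sub_transported (cyclic_gt0 cyc) mA (cyclic_period cyc)
      (cyclic_disjoint cyc) (cyclic_pr cyc) fr).
  have -> : im g = (fun x => im f x - transported mu N A id (im f) x).
    by apply/funext => x; rewrite /im /g ImCB.
  exact: (centered_sub_transported (cyclic_gt0 cyc) mA (cyclic_period cyc)
    (cyclic_disjoint cyc) (cyclic_pr cyc) fi).
have [s [s2 sn sE]] := neumann_series r01 Wlin WL DL DW Dg.
have [ws wsn] := cnrmZ w^-1 le12 s2.
have [we wen] := cnrmZ (w - 1)^-1 le12 E2.
exists (fun x => (w - 1)^-1 * E f x + w^-1 * s x); split.
- exact: cLp_lin.
- apply: le_trans (cnrmD_le le12 we ws).2 _.
  rewrite wen wsn wV1 mul1r /K mulrDl; apply: lerD.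
    by rewrite -mulrA ler_wpM2l ?cabs_ge0// transported_c2.
  apply: le_trans sn _; rewrite -[leRHS]mulrA ler_wpM2l//.
  apply: le_trans (cnrmB_le le12 f2 E2) _.
  by rewrite mulrDl mul1r lerD2l transported_c2.
have h1 := iter_lin m (w - 1)^-1 E2 ws.
have h2 : iter m U (fun x => w^-1 * s x) = (fun x => w^-1 * iter m U s x) %[ae mu].
  by rewrite !markov_iterE; apply: (complexifyZ (MCn m)); exact: (cLp_sub1 le12).
have h3 := iter_average q f2; rewrite -qE in h3.
have w10 : w - 1 != 0 by rewrite subr_eq0.
apply: filterS3 h1 (filterI h2 h3) sE => x /(_ I) -> [/(_ I) -> /(_ I) ->] /(_ I) e _.
have -> : f x = E f x + (s x - W s x) by rewrite e /g addrC subrK.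
rewrite /W; set z := E f x; set y := iter m U s x.
have -> : w * ((w - 1)^-1 * z + w^-1 * s x) - ((w - 1)^-1 * z + w^-1 * y) =
  (w - 1) * (w - 1)^-1 * z + (w * w^-1 * s x - w^-1 * y) by ring.
by rewrite !divff// !mul1r.
Qed.

Let resolvent_solution lambda : cabs lambda = 1 -> lambda ^+ N != 1 ->
  exists2 K : R, 0 <= K & forall f, cL2 f -> exists h, [/\ cL2 h, c2 h <= K * c2 f &
    (fun x => lambda * h x - U h x) = f %[ae mu]].
Proof.
move=> l1 lN; have [m0 hm0] := decay (e := 1 / 4) ltac:(lra).
(* [lambda^m] cannot be 1 for two consecutive multiples [m] of [N] *)
have [m [m0m Nm lm]] : exists m, [/\ (m0 <= m)%N, (N %| m)%N & lambda ^+ m != 1].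
  have N1 := cyclic_gt0 cyc.
  have [h|h] := eqVneq (lambda ^+ (N * m0.+1)) 1; last first.
    exists (N * m0.+1)%N; rewrite dvdn_mulr//; split=> //.
    by apply: leq_trans (leqnSn _) _; rewrite leq_pmull.
  exists (N * m0.+2)%N; rewrite dvdn_mulr// mulnS exprD h mulr1; split=> //.
  rewrite -mulnS; apply: leq_trans (leqnSn _) _; apply: leq_trans (leqnSn _) _.
  by rewrite leq_pmull.
have small u : centered mu A u -> nrm mu 2 (iter m M u) <= 1 / 4 * nrm mu 2 u.
  move=> cu; rewrite -(subnK m0m) iterD; apply: le_trans (hm0 _ cu).
  by apply: (contraction_nrm (MCn _)) => //; exact: (contraction_Lp (MCn _) le12 cu.1).
have [K1 K10 H1] := resolvent_power m l1.
have [K2 K20 H2] := resolvent_block l1 lm Nm small.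
exists (K1 * K2); first exact: mulr_ge0.
move=> f f2; have [h' [h'2 h'n h'E]] := H2 f f2; have [h [h2 hn hE]] := H1 h' h'2.
exists h; split=> //.
  by apply: le_trans hn _; rewrite -mulrA ler_wpM2l.
by apply: filterS2 hE h'E => x /(_ I) -> /(_ I).
Qed.

Let resolvent_unique lambda h h' : cabs lambda = 1 -> lambda ^+ N != 1 ->
  cL2 h -> cL2 h' ->
  (fun x => lambda * h x - U h x) = (fun x => lambda * h' x - U h' x) %[ae mu] ->
  h = h' %[ae mu].
Proof.
move=> l1 lN h2 h'2 e; have d2 := cLp_lin (-1) le12 h'2 h2.
have Ud : U (fun x => -1 * h' x + h x) =
    (fun x => lambda * (-1 * h' x + h x)) %[ae mu].
  apply: filterS2 (markov_lin hbi (-1) (cLp_sub1 le12 h'2) (cLp_sub1 le12 h2)) e => x.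
  move=> /(_ I) -> /(_ I) e' _; apply/eqP; rewrite -subr_eq0; apply/eqP.
  rewrite (_ : _ - _ = (lambda * h' x - U h' x) - (lambda * h x - U h x)); last by ring.
  by rewrite e' subrr.
apply: filterS (eigen_trivial hbi cyc decay le12 d2 Ud l1 lN) => x /[apply] /eqP.
by rewrite mulN1r addrC subr_eq0 => /eqP.
Qed.

Lemma unimodular_resolvent lambda : cabs lambda = 1 -> lambda ^+ N != 1 ->
  resolvent_set mu 2%:E U lambda.
Proof.
move=> l1 lN; have [K K0 H] := resolvent_solution l1 lN.
have HV f : {h | cL2 f -> [/\ cL2 h, c2 h <= K * c2 f &
    (fun x => lambda * h x - U h x) = f %[ae mu]]}.
  apply: cid; have [f2|nf] := pselect (cL2 f); last by exists f.
  by have [h hh] := H f f2; exists h.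
pose V f := sval (HV f).
have VL f (f2 : cL2 f) : cL2 (V f) by have [] := svalP (HV f) f2.
have Vn f (f2 : cL2 f) : c2 (V f) <= K * c2 f by have [] := svalP (HV f) f2.
have VE f (f2 : cL2 f) : (fun x => lambda * V f x - U (V f) x) = f %[ae mu].
  by have [] := svalP (HV f) f2.
exists V; split; last first.
  move=> f f2; split; first exact: VE.
  have Uf2 := markov_cLp hbi le12 f2.
  have lf2 := (cnrmZ lambda le12 f2).1.
  have g2 := cLpB le12 lf2 Uf2.
  by apply: (resolvent_unique l1 lN (VL _ g2) f2 _); exact: VE.
split=> [f f2|a f g f2 g2|]; first exact: VL.
- have fg2 := cLp_lin a le12 f2 g2; have V2 := cLp_lin a le12 (VL _ f2) (VL _ g2).
  apply: (resolvent_unique l1 lN (VL _ fg2) V2 _).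
  apply: filterS3 (markov_lin hbi a (cLp_sub1 le12 (VL _ f2)) (cLp_sub1 le12 (VL _ g2)))
    (VE _ fg2) (filterI (VE _ f2) (VE _ g2)) => x /(_ I) -> /(_ I) -> [/(_ I) e1 /(_ I) e2] _.
  by rewrite -[in LHS]e1 -[in LHS]e2; ring.
- apply: (@le_lt_trans _ _ K%:E); last exact: ltry.
  apply: ub_ereal_sup => _ [f [f2 f1] <-].
  rewrite cnormE; last exact: VL.
  rewrite lee_fin; apply: le_trans (Vn _ f2) _.
  by rewrite -[leRHS]mulr1 ler_wpM2l// -lee_fin -cnormE.
Qed.

End resolvent.

(** * The period *)

(** The [m] distinct roots of [X^m - 1] are roots of [X^n - 1]. *)
Lemma unity_root_order (R : realType) (m n : nat) : (0 < m)%N -> (0 < n)%N ->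
  (forall z : R[i], z ^+ m = 1 -> z ^+ n = 1) -> (m <= n)%N.
Proof.
move=> m0 n0 mn; have [r rE] := closed_field_poly_normal ('X^m - 1 : {poly R[i]}).
rewrite (monicP (monicXnsubC 1 m0)) scale1r in rE.
have <- : size r = m.
  by apply: succn_inj; rewrite -(size_XnsubC (1 : R[i]) m0) rE size_prod_XsubC.
apply: max_unity_roots => //.
  apply/allP => z zr; apply/unity_rootP; apply: mn; apply/unity_rootP.
  by rewrite /root_of_unity rE root_prod_XsubC.
by rewrite -separable_prod_XsubC -rE separable_Xn_sub_1// pnatr_eq0 -lt0n.
Qed.

Section spectrum.
Context d (T : measurableType d) (R : realType).
Variables (mu : probability T R).

(** A bounded left inverse of [lambda - U] maps null functions to null functions,
    hence annihilates no eigenfunction. *)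
Lemma eigenvalue_spectrum p (U : (T -> R[i]) -> (T -> R[i])) lambda : 1 <= p ->
  (forall f, cLp mu p%:E f -> cLp mu p%:E (U f)) ->
  eigenvalue_op mu p%:E U lambda -> spectrum mu p%:E U lambda.
Proof.
move=> p1 UL [f [fp f0 Uf]] [V [[VL Vlin Vb] VE]]; apply: f0.
have p0 : 0 < p by exact: lt_le_trans p1.
have z := cLp0 mu p1.
have cz : cnrm mu p (fun=> 0) = 0.
  have -> : (fun _ : T => 0 : R[i]) = fun=> 0 * 0 by apply/funext => x; rewrite mulr0.
  by rewrite (cnrmZ 0 p1 z).2 (cabs_real 0) normr0 mul0r.
pose g x := lambda * f x - U f x.
have gp : cLp mu p%:E g by apply: cLpB => //; [exact: (cnrmZ lambda p1 fp).1|exact: UL].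
have g0 : g = (fun=> 0) %[ae mu].
  by apply: filterS Uf => x /[apply] e; rewrite /g e subrr.
have [_ Vg] := VE f fp; rewrite -/g in Vg.
have V0 : V (fun=> 0) = cst 0 %[ae mu].
  have := Vlin 1 _ _ z z.
  have -> : (fun _ : T => 1 * 0 + 0 : R[i]) = fun=> 0.
    by apply/funext => x; rewrite mulr0 addr0.
  apply: filterS => x /[apply]; rewrite mul1r => /eqP.
  by rewrite -subr_eq subrr => /eqP <-.
have [B hB] : exists B, forall h, cLp mu p%:E h -> cnrm mu p h <= 1 ->
    cnrm mu p (V h) <= B.
  have ub h : cLp mu p%:E h -> cnrm mu p h <= 1 ->
      ((cnrm mu p (V h))%:E <= opnorm mu p%:E V)%E.
    move=> hp h1; rewrite -cnormE; last exact: VL.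
    apply: ereal_sup_ubound; exists h => //; split=> //.
    by rewrite cnormE// lee_fin.
  exists (fine (opnorm mu p%:E V)) => h hp h1; rewrite -lee_fin [leRHS]fineK; first exact: ub.
  rewrite ge0_fin_numE//; apply: le_trans (ub _ z _); rewrite ?cz//.
  by rewrite lee_fin cnrm_ge0.
apply: (cnrm_eq0 p1 fp); rewrite leNgt; apply/negP => nf.
have bound k : k%:R * cnrm mu p f <= B.
  pose kg x := k%:R * g x + 0.
  have kgp : cLp mu p%:E kg by exact: cLp_lin.
  have e : kg = (fun=> 0) %[ae mu].
    by apply: filterS g0 => x /[apply] e; rewrite /kg e mulr0 addr0.
  have nkg : cnrm mu p kg = 0.
    by have [_ <-] := cnrm_ae p0 kgp z.1 e; exact: cz.
  apply: le_trans (hB _ kgp _); last by rewrite nkg.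
  have [kf nkf] := cnrmZ k%:R p1 fp.
  have -> : k%:R * cnrm mu p f = cnrm mu p (fun x => k%:R * f x).
    rewrite nkf; congr (_ * _).
    by rewrite (_ : k%:R = (k%:R : R)%:C%C) ?cabs_real ?normr_nat// rmorph_nat.
  rewrite -(cnrm_ae p0 (VL _ kgp) kf.1 _).2//.
  apply: filterS3 (Vlin k%:R _ _ gp z) V0 Vg => x /(_ I) -> /(_ I) -> /(_ I) ->.
  by rewrite /cst addr0.
have B0 : 0 <= B by apply: le_trans (bound 0); rewrite mul0r.
have /andP[_ h] := truncn_itv (divr_ge0 B0 (ltW nf)).
by have := bound (Num.trunc (B / cnrm mu p f)).+1; rewrite leNgt -ltr_pdivrMr// h.
Qed.

Variables (P : R.-pker T ~> T).
Hypothesis hbi : bistochastic mu P.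
Variables (N : nat) (A : nat -> set T).
Hypothesis cyc : cyclic_partition mu P N A.
Hypothesis decay : forall e, 0 < e -> exists m, forall f : T -> R, centered mu A f ->
  nrm mu 2 (iter m (kmean P) f) <= e * nrm mu 2 f.

Let le12 : 1 <= 2 :> R. Proof. by rewrite ler1n. Qed.

(** Resolvent and eigenfunctions together show that the unimodular spectrum is the
    set of all the [N]-th roots of unity. *)
Lemma period_cyclic (k : nat) : is_period mu P k -> k = N.
Proof.
have N0 := cyclic_gt0 cyc.
move=> [[k0 kroot] kmin]; apply/eqP; rewrite eqn_leq; apply/andP; split.
  apply: kmin; split=> // lambda sp /cabs_unit l1; apply: contrapT => /eqP lN.
  exact: sp (unimodular_resolvent hbi cyc decay l1 lN).
apply: (unity_root_order (R := R)) => // z zN.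
apply: kroot; last by apply/cabs_unit; exact: cabs_unity_root zN.
apply: eigenvalue_spectrum => //; first by move=> f; exact: (markov_cLp hbi le12).
exists (cyclic_eigenfunction N A z).
exact: (cyclic_eigenfunctionP hbi cyc le12 zN).
Qed.

End spectrum.

(** * Invariant sets *)

Section invariant_sets.
Context d (T : measurableType d) (R : realType).
Variables (mu : probability T R) (P : R.-pker T ~> T).
Hypothesis hbi : bistochastic mu P.
Variables (N : nat) (A : nat -> set T).
Hypothesis cyc : cyclic_partition mu P N A.
Hypothesis decay : forall e, 0 < e -> exists m, forall f : T -> R, centered mu A f ->
  nrm mu 2 (iter m (kmean P) f) <= e * nrm mu 2 f.
Implicit Types (B C : set T) (J : set nat).
Local Notation M := (kmean P).
Local Notation U := (markov_op P).
Local Notation inv := (invariant_sets mu P N).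
Local Notation pr := (pr mu).

Let le11 : 1 <= 1 :> R. Proof. exact: lexx. Qed.
Let MC : Lp_contraction mu M. Proof. exact: kmean_contraction. Qed.
Let MCn n : Lp_contraction mu (iter n M). Proof. exact: contraction_iter. Qed.
Let mA j : measurable (A j). Proof. exact: cyclic_measurable cyc j. Qed.
Let LpA p j : 1 <= p -> Lp mu p \1_(A j). Proof. by move=> p1; exact: Lp_indic. Qed.
Let N0 := cyclic_gt0 cyc.
Let muE B : measurable B -> (mu : {measure set T -> \bar R}) B = (pr B)%:E.
Proof. by move=> mB; exact: esym (prE mu mB). Qed.
Let QA j : M \1_(A j) = \1_(A (j + 1)%N) %[ae mu].
Proof. by rewrite addn1; exact: (cyclic_step cyc j). Qed.
Let shift q l : (\1_(A (l + q * N * 1)%N) : T -> R) = \1_(A (id l)) %[ae mu].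
Proof. by rewrite muln1; exact: (period_mul (cyclic_period cyc)). Qed.

Lemma set_ae_eqP B C : measurable B -> measurable C ->
  set_ae_eq mu B C <-> {ae mu, forall x, B x <-> C x}.
Proof.
move=> mB mC; have mBC : measurable (B `+` C).
  by apply: measurableU; exact: measurableD.
split=> h.
  have /(pr0_ae mu mBC) : pr (B `+` C) = 0 by rewrite /pr h.
  by apply: filterS => x nBC; split=> ?; apply: contrapT => ?; apply: nBC; [left|right].
have e : pr (B `+` C) = 0.
  by apply/pr0_ae => //; apply: filterS h => x [h1 h2] [[]|[]]; tauto.
by have := prE mu mBC; rewrite e => /esym.
Qed.

Lemma indic_aeP B C : (\1_B : T -> R) = \1_C %[ae mu] <->
  {ae mu, forall x, B x <-> C x}.
Proof.
split; apply: filterS => x h.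
  move/(_ I): h; rewrite !indicE => h.
  have : (x \in B) = (x \in C).
    by move/eqP: h; rewrite eqr_nat; do 2 case: (_ \in _).
  by move=> e; split=> /mem_set; [rewrite e|rewrite -e] => /set_mem.
move=> _; rewrite !indicE; congr (nat_of_bool _)%:R; apply/idP/idP; rewrite !inE; tauto.
Qed.

Lemma invariant_setsP B : inv B <->
  measurable B /\ iter N M \1_B = \1_B %[ae mu].
Proof.
have E : iter N U (cindic R B) = of_real (iter N M \1_B).
  exact: (markov_iter_of_real P N \1_B).
split=> -[mB h]; split=> //.
  rewrite E in h; apply: filterS h => x /(_ I) h _.
  exact: (congr1 (@complex.Re R) h).
rewrite E; apply: filterS h => x /(_ I) h _.
by rewrite /of_real h.
Qed.

Let invariant_iter B n : inv B -> iter (n * N) M \1_B = \1_B %[ae mu].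
Proof.
move=> /invariant_setsP[mB h]; elim: n => [|n IH]; first exact: aeW.
have BL : Lp mu 1 \1_B by exact: Lp_indic.
rewrite mulSn addnC iterD.
have := iter_ae MC (n * N) (contraction_Lp (MCn N) le11 BL) BL.1 h.
by apply: filterS2 IH => x /(_ I) <- /(_ I).
Qed.

(** The iterates [P^(nN) 1_B] are constant and converge to a combination of the
    indicators of the cycle. *)
Lemma invariant_average B : inv B -> \1_B = transported mu N A id \1_B %[ae mu].
Proof.
move=> iB; have /invariant_setsP[mB _] := iB.
have BL : Lp mu 1 \1_B by exact: Lp_indic.
have [TL _] := transported_Lp N mA id le11 BL.
have dL := (LpB le11 BL TL).1.
have : (fun x => \1_B x - transported mu N A id \1_B x) = cst 0 %[ae mu].
  apply: (nrm_eq0 le11 dL); rewrite leNgt; apply/negP => n0.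
  have e0 : 0 < nrm mu 1 (fun x => \1_B x - transported mu N A id \1_B x) / 2.
    exact: divr_gt0.
  have [m0 hm0] := Lp_convergence N0 mA (cyclic_period cyc) (cyclic_disjoint cyc)
    (cyclic_pr cyc) MC QA decay le11 BL e0.
  have := hm0 (m0 * N)%N (leq_pmulr _ N0).
  have IL := contraction_Lp (MCn (m0 * N)) le11 BL.
  have SL := (transported_Lp N mA (fun l => l + m0 * N * 1)%N le11 BL).1.
  rewrite -(nrm_ae ltr01 (LpB le11 IL SL).1 dL.1 _).2.
    by rewrite leNgt ltr_pdivrMr// ltr_pMr// ltr1n.
  apply: filterS2 (invariant_iter m0 iB) (transported_congr N \1_B (shift m0)) => x.
  by move=> /(_ I) -> /(_ I) ->.
by apply: filterS => x /[apply] /eqP; rewrite subr_eq0 => /eqP.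
Qed.

Let null_classes B : measurable B -> {ae mu, forall x, forall j, (j < N)%N ->
  (pr (A j `&` B) = 0 -> ~ (A j `&` B) x) /\ (pr (A j `\` B) = 0 -> ~ (A j `\` B) x)}.
Proof.
move=> mB; apply: ae_foralln => j.
have [h1|h1] := pselect (pr (A j `&` B) = 0); have [h2|h2] := pselect (pr (A j `\` B) = 0).
- have := (pr0_ae mu (measurableI _ _ (mA j) mB)).1 h1.
  by have := (pr0_ae mu (measurableD (mA j) mB)).1 h2; apply: filterS2.
- by have := (pr0_ae mu (measurableI _ _ (mA j) mB)).1 h1; apply: filterS.
- by have := (pr0_ae mu (measurableD (mA j) mB)).1 h2; apply: filterS.
- exact: aeW.
Qed.

(** An invariant indicator is a combination of the indicators of the classes, hence
    constant on each of them. *)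
Lemma invariant_dichotomy B : measurable B -> inv B <->
  forall j, (j < N)%N -> pr (A j `&` B) = 0 \/ pr (A j `\` B) = 0.
Proof.
move=> mB; split=> [iB j jN|h].
  have [q0|q0] := eqVneq (pr (A j `&` B)) 0; [by left|right].
  apply/pr0_ae; first exact: measurableD.
  apply: filterS2 (cyclic_class cyc) (invariant_average iB) => x [k kN hk] /(_ I).
  rewrite (transported_class mu _ kN hk)// ip_indic// => e [Aj nB].
  have jk : j = k.
    apply/eqP; have := hk j jN; rewrite indicE mem_set//=.
    by case: eqP => // _ /eqP; rewrite oner_eq0.
  move: e; rewrite indicE memNset//= -jk => /esym/eqP.
  by rewrite mulf_eq0 pnatr_eq0 (negbTE q0) orbF gtn_eqF.
have BL : Lp mu 1 \1_B by exact: Lp_indic.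
have TL := transported_Lp N mA id le11 BL.
have null := null_classes mB.
have avg : \1_B = transported mu N A id \1_B %[ae mu].
  apply: filterS2 (cyclic_class cyc) null => x [k kN hk] /(_ k kN) [n1 n2] _.
  rewrite (transported_class mu _ kN hk)// ip_indic//.
  have Akx : A k x.
    have := hk k kN; rewrite eqxx indicE; case: (boolP (x \in A k)) => [/set_mem//|_ /eqP].
    by rewrite eq_sym oner_eq0.
  have [z|z] := h k kN.
    rewrite z mulr0 indicE memNset// => Bx; exact: n1.
  have Bx : B x by apply: contrapT => nBx; exact: (n2 z).
  have := prD mu (mA k) mB; rewrite z addr0 (cyclic_pr cyc) => <-.
  by rewrite indicE mem_set// divff// pnatr_eq0 gtn_eqF.
apply/invariant_setsP; split=> //.
have h1 := iter_ae MC N BL TL.1.1 avg.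
have := iter_transported N mA MC QA N BL.
have := transported_congr N \1_B (shift 1).
apply: filterS3 (filterI h1 avg) => x [/(_ I) -> /(_ I) ->] e1 /(_ I) -> _.
by have := e1 I; rewrite mul1n.
Qed.

Lemma cycle_invariant j : (j < N)%N -> inv (A j).
Proof.
move=> jN; apply/invariant_dichotomy => // k kN.
have [->|/eqP kj] := eqVneq k j; first by right; rewrite setDv /pr measure0.
by left; exact: (cyclic_disjoint cyc).
Qed.

Lemma cycle_atom j : (j < N)%N -> atom mu inv (A j).
Proof.
move=> jN; split; first exact: cycle_invariant.
  by rewrite muE// lte_fin (cyclic_pr cyc) invr_gt0 ltr0n.
move=> B iB BA; have /invariant_setsP[mB _] := iB.
have [h|h] := (invariant_dichotomy mB).1 iB j jN.
  left; rewrite muE//; congr EFin; rewrite (prD mu mB (mA j)) setIC h add0r.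
  by rewrite /pr BA.
by right; rewrite muE ?h//; exact: measurableD.
Qed.

Definition cycle_union J : set T := \bigcup_(j in J) A j.

Lemma measurable_cycle_union J : measurable (cycle_union J).
Proof. by apply: bigcup_measurable. Qed.

(** On the class of [A k], belonging to a union of classes means that [A k] is
    one of them. *)
Lemma cycle_union_class J : J `<=` `I_N -> {ae mu, forall x, exists2 k, (k < N)%N &
  (forall j, (j < N)%N -> A j x <-> j = k) /\ (cycle_union J x <-> J k)}.
Proof.
move=> JN; apply: filterS (cyclic_class cyc) => x [k kN hk]; exists k => //.
have Ax j : (j < N)%N -> A j x <-> j = k.
  move=> /hk; rewrite indicE; case: (boolP (x \in A j)); case: eqP => //=.
  - by move=> -> /set_mem.
  - by move=> _ _ /eqP; rewrite oner_eq0.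
  - by move=> _ _ /eqP; rewrite eq_sym oner_eq0.
  - by move=> jk /negP nA _; split=> // Ajx; case: nA; exact/mem_set.
split=> //; split=> [[j Jj /(Ax _ (JN _ Jj)) <-//]|Jk].
by exists k => //; exact/Ax.
Qed.

Lemma cycle_union_invariant J : J `<=` `I_N -> inv (cycle_union J).
Proof.
move=> JN; have mJ := measurable_cycle_union J.
apply/invariant_dichotomy => // j jN.
have [Jj|nJj] := pselect (J j); [right|left].
  suff -> : A j `\` cycle_union J = set0 by rewrite /pr measure0.
  by apply/seteqP; split=> // x [Ajx]; apply; exists j.
apply/pr0_ae; first exact: measurableI.
apply: filterS (cycle_union_class JN) => x [k kN [hA hJ]] [/(hA _ jN) jk /hJ].
by rewrite -jk.
Qed.

Let occupied B : set nat := [set j | (j < N)%N /\ pr (A j `\` B) = 0].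

Lemma invariant_cycle_union B : inv B -> set_ae_eq mu B (cycle_union (occupied B)).
Proof.
move=> iB; have /invariant_setsP[mB _] := iB; have dich := (invariant_dichotomy mB).1 iB.
have JN : occupied B `<=` `I_N by move=> j [].
apply/set_ae_eqP => //; first exact: measurable_cycle_union.
have null := null_classes mB.
apply: filterS2 (cycle_union_class JN) null => x [k kN [hA hJ]] /(_ k kN) [n1 n2].
have Akx : A k x by exact/hA.
rewrite hJ; split=> [Bx|[_ z]]; last by apply: contrapT => nBx; exact: (n2 z).
by split=> //; case: (dich k kN) => // /n1; case.
Qed.

Lemma invariant_sets_finite : exists F : set (set T), [/\ finite_set F, F `<=` inv &
  forall B, inv B -> exists2 C, F C & set_ae_eq mu B C].
Proof.
pose S (K : {set 'I_N}) : set nat := [set j | exists2 i : 'I_N, i \in K & i = j :> nat].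
have SN K : S K `<=` `I_N by move=> j [i _ <-] /=.
exists [set cycle_union (S K) | K in setT]; split.
- exact: finite_image finite_finset.
- by move=> _ [K _ <-]; exact: cycle_union_invariant.
move=> B iB; exists (cycle_union (S [set i : 'I_N | `[< occupied B i >]]%SET)).
  by exists [set i : 'I_N | `[< occupied B i >]]%SET.
suff -> : S [set i : 'I_N | `[< occupied B i >]]%SET = occupied B.
  exact: invariant_cycle_union.
apply/seteqP; split=> [j [i + <-]|j Bj]; first by rewrite inE => /asboolP.
by exists (Ordinal Bj.1) => //; rewrite inE; apply/asboolP.
Qed.

Lemma invariant_sigma_algebra : sigma_algebra setT inv.
Proof.
split=> [|B iB|B iB].
- apply/invariant_dichotomy => // j _; left; by rewrite setI0 /pr measure0.
- have /invariant_setsP[mB _] := iB; have dich := (invariant_dichotomy mB).1 iB.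
  rewrite setTD; apply/invariant_dichotomy; first exact: measurableC.
  by move=> j jN; rewrite setDE setCK -setDE; case: (dich j jN); [right|left].
have mB n : measurable (B n) by have /invariant_setsP[] := iB n.
apply/invariant_dichotomy; first exact: bigcupT_measurable.
move=> j jN; have [[n hn]|H] := pselect (exists n, pr (A j `\` B n) = 0).
  right; apply/eqP; rewrite eq_le pr_ge0 andbT -hn; apply: pr_le.
  - by apply: measurableD => //; exact: bigcupT_measurable.
  - exact: measurableD.
  - by move=> x [Ax nB]; split=> // Bx; apply: nB; exists n.
left; apply/pr0_ae; first by apply: measurableI => //; exact: bigcupT_measurable.
have : {ae mu, forall x, forall n, ~ (A j `&` B n) x}.
  apply: ae_foralln => n; apply/pr0_ae; first exact: measurableI.
  by case: ((invariant_dichotomy (mB n)).1 (iB n) j jN) => // h; case: H; exists n.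
by apply: filterS => x h [Ax [n _ Bx]]; exact: (h n).
Qed.

Lemma invariant_generated B : measurable B -> inv B <->
  exists2 C, <<s [set A j | j in `I_N] >> C & set_ae_eq mu B C.
Proof.
move=> mB; split=> [iB|[C CA BC]].
  exists (cycle_union (occupied B)); last exact: invariant_cycle_union.
  rewrite /cycle_union bigcup_mkcond; apply: sigma_algebra_bigcup => j.
  case: ifPn => [/set_mem[jN _]|_]; last exact: sigma_algebra0.
  by apply: sub_sigma_algebra; exists j.
have iC : inv C.
  apply: (smallest_sub invariant_sigma_algebra _ CA) => _ [j jN <-].
  exact: cycle_invariant.
have /invariant_setsP[mC hC] := iC.
have BCae := (indic_aeP B C).2 ((set_ae_eqP mB mC).1 BC).
apply/invariant_setsP; split=> //.
have BL : Lp mu 1 \1_B by exact: Lp_indic.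
have := iter_ae MC N BL (Lp_indic mu le11 mC).1 BCae.
by apply: filterS3 hC BCae => x /(_ I) e1 /(_ I) -> /(_ I) ->.
Qed.

End invariant_sets.

(** * The cyclic structure of an ergodic quasi-compact operator *)

Theorem theorem4p11 (disp : measure_display) (T : measurableType disp)
    (R : realType) (mu : probability T R) (P : R.-pker T ~> T)
    (Pstar : (T -> R[i]) -> (T -> R[i])) (d : nat)
    (hbi : bistochastic mu P) (hstar : dual_markov mu P Pstar)
    (herg : ergodic mu P) (hqc : quasi_compact mu 2%:E (markov_op P))
    (hper : is_period mu P d) (hd : (1 < d)%N) :
  (exists A : nat -> set T,
    [/\ (exists F : set (set T), [/\ finite_set F,
           F `<=` invariant_sets mu P d &
           forall B, invariant_sets mu P d B ->
             exists2 C, F C & set_ae_eq mu B C]),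
        (forall j, (j < d)%N -> atom mu (invariant_sets mu P d) (A j)),
        (forall j k, (j < d)%N -> (k < d)%N -> j <> k ->
           mu (A j `&` A k) = 0%E),
        (forall j, (1 <= j <= d.-1)%N ->
           iter j (markov_op P) (cindic R (A 0%N)) = cindic R (A j) %[ae mu]) &
        (forall j, (j < d)%N ->
           markov_op P (cindic R (A j)) =
             cindic R (A (j.+1 %% d)%N) %[ae mu] /\
           Pstar (cindic R (A (j.+1 %% d)%N)) = cindic R (A j) %[ae mu]) /\
        (forall B, measurable B ->
           invariant_sets mu P d B <->
           exists2 C, <<s [set A j | j in `I_d] >> C & set_ae_eq mu B C)] /\
    (forall (p : R) (f : T -> R[i]) (j : nat),
       1 <= p -> cLp mu p%:E f -> (j <= d.-1)%N ->
       cnorm mu p%:E (fun x => iter (n * d + j) (markov_op P) f x -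
         d%:R * \sum_(l < d) cintegral mu (A l) f *
                             cindic R (A ((l + j) %% d)%N) x)
         @[n --> \oo] --> 0%E /\
       cnorm mu p%:E (fun x => iter (n * d + j) Pstar f x -
         d%:R * \sum_(l < d) cintegral mu (A l) f *
                             cindic R (A ((l + (d - j)) %% d)%N) x)
         @[n --> \oo] --> 0%E)) /\
  (forall p : R, 1 <= p ->
     (forall lambda : R[i],
        (`|lambda| = 1 /\ eigenvalue_op mu p%:E (markov_op P) lambda) <->
        lambda ^+ d = 1) /\
     (forall (lambda : R[i]) (f : T -> R[i]), `|lambda| = 1 ->
        eigenfunction mu p%:E (markov_op P) lambda f ->
        exists c : R, (fun x => cabs (f x)) = cst c %[ae mu])).
Proof.
have [N [A [cyc persistent0]]] := exists_cyclic_partition hbi hqc herg.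
have decay := centered_decay hbi hqc cyc persistent0.
have dN := period_cyclic hbi cyc decay hper; subst N.
have d0 : (0 < d)%N by exact: cyclic_gt0 cyc.
have le11 : 1 <= 1 :> R by exact: lexx.
have MC := kmean_contraction hbi; have QC := real_dual_contraction hstar.
have mA j : measurable (A j) by exact: cyclic_measurable cyc j.
have LpA j : Lp mu 1 \1_(A j) by exact: Lp_indic.
have QA j : kmean P \1_(A j) = \1_(A (j + 1)%N) %[ae mu].
  by rewrite addn1; exact: (cyclic_step cyc j).
have indicE (B C : set T) : (\1_B : T -> R) = \1_C %[ae mu] ->
    cindic R B = cindic R C %[ae mu].
  by apply: filterS => x /[apply] e; rewrite /cindic e.
have Ucindic n j : iter n (markov_op P) (cindic R (A j)) = cindic R (A (j + n)%N) %[ae mu].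
  have -> : iter n (markov_op P) (cindic R (A j)) = of_real (iter n (kmean P) \1_(A j)).
    exact: (markov_iter_of_real P n \1_(A j)).
  have := iterQA mA MC QA n j; rewrite muln1.
  by apply: filterS => x /[apply] e; rewrite /of_real e.
split.
  exists A; split.
    split.
    - exact: (invariant_sets_finite hbi cyc decay).
    - by move=> j; exact: (cycle_atom hbi cyc decay).
    - move=> j k jd kd jk; have := prE mu (measurableI _ _ (mA j) (mA k)).
      by rewrite (cyclic_disjoint cyc jd kd jk) => /esym.
    - by move=> j _; have := Ucindic j 0%N; rewrite add0n.
    split; last exact: (invariant_generated hbi cyc decay).
    move=> j _; have modn : (\1_(A j.+1) : T -> R) = \1_(A (j.+1 %% d)%N) %[ae mu].
      exact: (cyclic_modn cyc j.+1).
    split.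
      have := Ucindic 1%N j; rewrite addn1 => h.
      by apply: filterS2 (indicE _ _ modn) h => x /(_ I) <- /(_ I).
    have c1 := (cLp_of_real le11 (LpA (j.+1 %% d)%N)).1.
    apply: filterS3 (filterI (dual_complexify hstar c1) (contraction0 QC))
      (contraction_ae QC (LpA j.+1) (LpA _).1 modn)
      (real_dual_step hbi hstar cyc j) => x [/(_ I) e1 /(_ I) e2] /(_ I) e3 /(_ I) e4 _.
    rewrite [LHS]e1; apply: complexP; last exact: e2.
    exact: etrans (esym e3) e4.
  move=> p f j p1 fp jd; split.
    apply: (cnorm_convergence d0 mA (cyclic_period cyc) (cyclic_disjoint cyc)
      (cyclic_pr cyc) MC QA decay (sigma := fun l => ((l + j) %% d)%N) p1 fp).
      move=> n; split; first exact: markov_iter_cLp.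
      by rewrite markov_iterE; exact: aeW.
    move=> l n; rewrite muln1.
    have := cyclic_modn cyc (l + (n * d + j))%N.
    by rewrite addnCA modnMDl.
  apply: (cnorm_convergence d0 mA (cyclic_period cyc) (cyclic_disjoint cyc)
    (cyclic_pr cyc) QC (real_dual_shift hbi hstar cyc)
    (real_dual_decay hbi hstar cyc decay) (sigma := fun l => ((l + (d - j)) %% d)%N) p1 fp).
    by move=> n; exact: (dual_iterE hstar n p1 fp).
  move=> l n; have := cyclic_modn cyc (l + (n * d + j) * d.-1)%N.
  suff -> : ((l + (n * d + j) * d.-1) %% d = (l + (d - j)) %% d)%N by [].
  apply/eqP; rewrite -(eqn_modDr (n * d + j)) -addnA -mulnSr prednK//.
  (* both indices become [l] modulo [d] once [n d + j] is added *)
  have jd' : (j <= d)%N by exact: leq_trans jd (leq_pred d).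
  have -> : (l + (d - j) + (n * d + j) = n.+1 * d + l)%N.
    by rewrite [(n * d + j)%N]addnC addnA -(addnA l) subnK// -addnA -mulSn addnC.
  by rewrite [X in X == _ %[mod _]]addnC !modnMDl.
have root lambda (p : R) f : 1 <= p -> `|lambda| = 1 ->
    eigenfunction mu p%:E (markov_op P) lambda f -> lambda ^+ d = 1.
  move=> p1 /cabs_unit l1 [fp f0 Uf]; apply: contrapT => /eqP ld.
  by apply: f0; exact: (eigen_trivial hbi cyc decay p1 fp Uf l1 ld).
move=> p p1; split=> [lambda|lambda f l1 ef].
  split=> [[l1 [f ef]]|ld]; first exact: root ef.
  split; first by apply/cabs_unit; exact: cabs_unity_root ld.
  by exists (cyclic_eigenfunction d A lambda); exact: (cyclic_eigenfunctionP hbi cyc p1 ld).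
have ld := root _ _ _ p1 l1 ef; have [fp _ Uf] := ef.
by apply: (eigen_modulus hbi cyc decay p1 fp Uf) => //; exact/cabs_unit.
Qed.
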